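(* Let $p\in\mathbb N$, $\tau,\nu\in\{0,1\}$ and $m=2p-1-\tau-\nu\ge 3$. The mapping $\mathfrak J:\mathfrak X_\nu^\tau\to\mathcal S_\nu^\tau$ given by $\mathfrak J(q)=(s,E_N)$, where $s=s(\cdot,q)$ and $E_N=(z_j)_{j\in\mathbb Z_N}$ is the increasing sequence of all zeros of $w(\cdot,q)$ in $\mathbb D_1$, is one-to-one and onto.
   Context: Jacobi operator: $(Jf)_n=a_{n-1}f_{n-1}+a_nf_{n+1}+b_nf_n$, $n\in\mathbb Z$, on $\ell^2(\mathbb Z)$. The coefficients are encoded by the real sequence $q=(q_n)_{n\in\mathbb Z}$, $q_{2n-1}=b_n$, $q_{2n}=1-a_n$. Class of potentials: for $p\in\mathbb N$ and $\nu,\tau\in\{0,1\}$, $\mathfrak X_\nu^\tau=\mathfrak X_\nu^\tau(p)$ is the set of real sequences $q=(q_n)_{n\in\mathbb Z}$ with $q_{1+\nu}\neq0$, $q_{2p-\tau}\ne0$, $q_{2k}<1$ for all $k\in\mathbb Z$ (so $a_k>0$), and $q_n=0$ for all $n\in\mathbb Z\setminus[1+\nu,2p-\tau]$. Functions $w$ and $s$: let $\psi^\pm=(\psi_n^\pm(z))_{n\in\mathbb Z}$ be the solutions of $a_{n-1}\psi_{n-1}+a_n\psi_{n+1}+b_n\psi_n=(z+\frac1z)\psi_n$, $n\in\mathbb Z$, with $\psi_n^+(z)=z^n$ for $n>p$ and $\psi_n^-(z)=z^{-n}$ for $n\le0$ (they are Laurent polynomials in $z$). Put $\widetilde\psi^-_n(z)=\psi^-_n(z^{-1})$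 and $\{f,u\}_n=a_n(f_nu_{n+1}-u_nf_{n+1})$, which is independent of $n$ for two solutions. Define $w(z)=w(z,q)=z\{\psi^+,\psi^-\}_n$ and $s(z)=s(z,q)=z^{-2}\{\psi^+,\widetilde\psi^-\}_n$; these are polynomials in $z$. Put $\eta(z)=z-\frac1z$ and $\mathbb D_1=\{z\in\mathbb C:|z|<1\}$. The zeros of $w$ in $\mathbb D_1$ are real and nonzero (the numbers $z_j+z_j^{-1}$ are the eigenvalues of $J$) and are labelled $-1<z_{n_-}<\dots<z_{-1}<0<z_1<\dots<z_{n_+}<1$, with $n_+\ge0\ge n_-$, $N=n_+-n_-\ge 0$, $\mathbb Z_N=\{n_-,\dots,-1,1,\dots,n_+\}$. Class of scattering data: $\mathcal S_\nu^\tau=\mathcal S_\nu^\tau(p)$ is the set of pairs $(f,K_f^N)$, for some $N\ge0$, where $f$ is a polynomial with real coefficients of the form $f(z)=Cz^\nu\prod_{n=1}^m(z-\zeta_n)$, $C\in\mathbb R\setminus\{0\}$, $\zeta_n\in\mathbb C\setminus\{0\}$, $m=2p-1-\tau-\nu$, and $K_f^N=(z_j)_{j\in\mathbb Z_N}$ is a sequence of (not necessarily all) zeros of the function $f(z)f(z^{-1})-\eta^2(z)$ such that $-1<z_{n_-}<\dots<z_{-1}<0<z_1<\dots<z_{n_+}<1$, $n_+\ge0\ge n_-$, $N=n_+-n_-$, $\mathbb Z_N=\{n_-,\dots,-1,1,\dots,n_+\}$, and $(-1)^jz_jf(z_j)>0$, $(-1)^jz_jf(z_j^{-1})>0$ for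 all $j\in\mathbb Z_N$, and $(-1)^{n_+}f(1)\ge0$, $(-1)^{n_-}f(-1)\le0$. For $N=0$ the sequence $K_f^0$ is empty. *)

(* Defs.v *)
From HB Require Import structures.
From mathcomp Require Import all_boot all_order all_algebra.
From mathcomp Require Import classical_sets functions reals.
From mathcomp Require Import complex.

Set Implicit Arguments.
Unset Strict Implicit.
Unset Printing Implicit Defensive.

Import Order.TTheory GRing.Theory Num.Theory.

Local Open Scope classical_set_scope.
Local Open Scope ring_scope.
Local Open Scope complex_scope.

Definition coef_a (R : realType) (q : int -> R) (n : int) : R :=
  1 - q (2 * n).

Definition coef_b (R : realType) (q : int -> R) (n : int) : R :=
  q (2 * n - 1).

Definition potentials (R : realType) (p : nat) (nu tau : bool) :
    set (int -> R) :=
  [set q : int -> R |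
    [/\ q (1 + nu%:Z) != 0,
        q (2 * p%:Z - tau%:Z) != 0,
        forall k : int, q (2 * k) < 1
      & forall n : int, ~~ (1 + nu%:Z <= n <= 2 * p%:Z - tau%:Z) -> q n = 0]].

(* Solutions of the Jacobi equation with spectral parameter z + 1/z. *)
Definition jacobi_solution (R : realType) (q : int -> R) (z : R[i])
    (psi : int -> R[i]) : Prop :=
  forall n : int,
    (coef_a q (n - 1))%:C * psi (n - 1) + (coef_a q n)%:C * psi (n + 1)
      + (coef_b q n)%:C * psi n = (z + z^-1) * psi n.

(* The Jost solutions are functions of z and n; they are Laurent polynomials
   in z, so z = 0 is excluded. *)
Definition jost_plus (R : realType) (p : nat) (q : int -> R)
    (psi : R[i] -> int -> R[i]) : Prop :=
  forall z : R[i], z != 0 ->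
    jacobi_solution q z (psi z) /\
    (forall n : int, p%:Z < n -> psi z n = z ^ n).

Definition jost_minus (R : realType) (q : int -> R)
    (psi : R[i] -> int -> R[i]) : Prop :=
  forall z : R[i], z != 0 ->
    jacobi_solution q z (psi z) /\
    (forall n : int, n <= 0 -> psi z n = z ^ (- n)).

Definition wronskian (R : realType) (q : int -> R) (f u : int -> R[i])
    (n : int) : R[i] :=
  (coef_a q n)%:C * (f n * u (n + 1) - u n * f (n + 1)).

Definition ceval (R : realType) (f : {poly R}) (z : R[i]) : R[i] :=
  (map_poly (real_complex R) f).[z].

(* w and s are given by Wronskians only for z != 0, which determines them as
   polynomials; their coefficients are real because those of q are. *)
Definition is_w (R : realType) (p : nat) (q : int -> R) (w : {poly R}) : Prop :=
  exists psip psim : R[i] -> int -> R[i],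
    [/\ jost_plus p q psip, jost_minus q psim
      & forall (z : R[i]) (n : int), z != 0 ->
          ceval w z = z * wronskian q (psip z) (psim z) n].

Definition is_s (R : realType) (p : nat) (q : int -> R) (s : {poly R}) : Prop :=
  exists psip psim : R[i] -> int -> R[i],
    [/\ jost_plus p q psip, jost_minus q psim
      & forall (z : R[i]) (n : int), z != 0 ->
          ceval s z = z ^- 2 * wronskian q (psip z) (psim z^-1) n].

(* E is the increasing sequence of all the complex zeros of w in the open unit
   disk (so in particular these zeros are all real). *)
Definition disk_zeros (R : realType) (w : {poly R}) (E : seq R) : Prop :=
  sorted <%R E /\
  (forall z : R[i],
     (`|z| < 1 /\ ceval w z = 0) <-> exists2 x : R, x \in E & z = x%:C).

Definition scattering_data (R : realType) (p : nat) (q : int -> R) :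
    set ({poly R} * seq R) :=
  [set d | is_s p q d.1 /\ exists2 w : {poly R}, is_w p q w & disk_zeros w d.2].

(* The map q |-> (s, E_N), as a definite description.  The default value
   (0, [::]) lies in no scattering_class below, since a polynomial in such a
   class is nonzero; hence a q sent into scattering_class by scattering_map
   does have scattering data. *)
Definition scattering_map (R : realType) (p : nat) (q : int -> R) :
    {poly R} * seq R :=
  xget (0, [::]) (scattering_data p q).

Definition eta (R : realType) (z : R) : R := z - z^-1.

(* A family -1 < z_{n_-} < ... < z_{-1} < 0 < z_1 < ... < z_{n_+} < 1 is encoded
   by the increasing list K of its (nonzero) values: n_+ is the number of
   positive entries and - n_- the number of negative ones. *)
Definition n_plus (R : realType) (K : seq R) : int :=
  (count (fun x => 0 < x) K)%:Z.

Definition n_minus (R : realType) (K : seq R) : int :=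
  - (count (fun x => x < 0) K)%:Z.

Definition ZN (R : realType) (K : seq R) (j : int) : bool :=
  (n_minus K <= j <= n_plus K) && (j != 0).

(* z_j sits at position j - n_- of K if j < 0 and, the label 0 being skipped,
   at position j - n_- - 1 if j > 0. *)
Definition zlabel (R : realType) (K : seq R) (j : int) : R :=
  nth 0 K (absz (if 0 < j then j - n_minus K - 1 else j - n_minus K)).

Definition m_of (p : nat) (nu tau : bool) : nat := (2 * p - 1 - tau - nu)%N.

Definition scattering_class (R : realType) (p : nat) (nu tau : bool) :
    set ({poly R} * seq R) :=
  [set d : {poly R} * seq R | let f := d.1 in let K := d.2 in
    [/\ exists (C : R) (zeta : 'I_(m_of p nu tau) -> R[i]),
          [/\ C != 0, forall n, zeta n != 0
            & map_poly (real_complex R) f =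
                C%:C *: ('X^nu * \prod_(n < m_of p nu tau) ('X - (zeta n)%:P))],
        [/\ sorted <%R K, all (fun x => -1 < x < 1) K & 0 \notin K],
        forall j : int, ZN K j ->
          f.[zlabel K j] * f.[(zlabel K j)^-1] - eta (zlabel K j) ^+ 2 = 0,
        forall j : int, ZN K j ->
          0 < (-1) ^ j * zlabel K j * f.[zlabel K j] /\
          0 < (-1) ^ j * zlabel K j * f.[(zlabel K j)^-1]
      & 0 <= (-1) ^ n_plus K * f.[1] /\ (-1) ^ n_minus K * f.[-1] <= 0]].

(* Main.v *)
Require Import Defs.
From mathcomp Require Import all_boot all_order all_algebra.
From mathcomp Require Import classical_sets functions reals boolp.
From mathcomp Require Import complex polyrcf cyclic separable cyclotomic zify ring lra.

Set Implicit Arguments.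
Unset Strict Implicit.
Unset Printing Implicit Defensive.

Import Order.TTheory GRing.Theory Num.Theory.

Local Open Scope ring_scope.

(** The Jost solution is [psi^+_n(z) = z^n u_n(z)] with real polynomials [u_n]
that equal 1 for [n > p] ([jost_poly]), and the two Wronskians, taken at
[n = 0], are [w = u_0 - z^2 u_1] and [z s = u_0 - u_1] ([is_wP], [is_sP]).  The
pair [(s, w)] thus determines [(u_0, u_1)], and then the Jacobi equation, read on
the lowest coefficients of two consecutive [u_n], returns the coefficients of the
operator one site after another.  Throughout, [f~(z)] stands for [f(1/z)].

Constancy of the Wronskian of [psi^+(z)] and [psi^+(1/z)] gives the relation
[w w~ = s s~ - (z - 1/z)^2] ([unitarity]); on the unit circle it reads
[|w|^2 = |s|^2 + |z^2 - 1|^2].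

The map has values in the class of scattering data because the disk zeros of [w]
are eigenvalues: they are real ([disk_zeros_real]) and at each of them
[s w' > 0] ([disk_zero_residue]), so they are simple and [s] has there the
alternating signs of [w'].  The sign conditions are used in an equivalent form
that involves only the polynomial whose roots are the given [z_j]
([scattering_classP]).

The map is one-to-one because [w] is recovered from [s] and its disk zeros: after
division by the disk zeros, two candidates have the same modulus on the unit
circle and no zero inside the disk, so they agree up to a unimodular constant
([outer_factor_unique], [disk_zeros_determine]); then layers are stripped off.

It is onto.  Given [(f, K)], a Fejer-Riesz factorisation of [f f~ - (z - 1/z)^2]
([spectral_factor]), followed by the reflection of the zeros [1/z_j] into [z_j],
yields [w] ([outer_function]); the sign conditions at the points 1 and -1 ensure that
[u_0 = (w - z^3 f)/(1 - z^2)] and [u_1 = (w - z f)/(1 - z^2)] are polynomials.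
Stripping these produces candidates [alpha_n] for [a_n^2], and the crux is that
they are positive.  To see it, run the same recursion on the Jost solution from the
left; it gives polynomials [y_n] with [y_n(0) = 1] and
[w y_n~ - z^(3-2n) f y_n = (1 - z^2) t_n], where [t_n] is the stripped polynomial.
Then [t_n(0) / w(0)] is the value at 0 of [g = y_n (1 - z^2) t_n / w].  On the
circle [g = |y_n|^2 - z^(3-2n) (f / w) y_n^2] has positive real part, since
[|f| < |w|] away from 1 and -1, and the sign conditions on [f(z_j)] make the
contribution of each pole of [g] at [z_j] nonnegative.  The mean value property
then gives [t_n(0) > 0] ([stripped_coef_gt0]).  In place of contour integrals, the
mean is taken over roots of [z^M = i] with [M] large, which is exact on polynomials
of degree less than [M].

Finally the Wronskian relation forces each stripping to lower the degree by 2, or to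
0 from degree 1 ([size_strip_step]), so the resulting potential has the
required support ([chain_potentials]). *)

(** * Mean value inequality for the disk algebra *)

Lemma expr_small (R : realType) (x e : R) :
  0 <= x -> x < 1 -> 0 < e -> exists n, x ^+ n < e.
Proof.
move=> x0 x1 e0.
have bern n : x ^+ n * (1 + n%:R * (1 - x)) <= 1.
  elim: n => [|n IH]; first by rewrite expr0 mul0r addr0 mulr1.
  apply: le_trans IH; rewrite exprSr -mulrA ler_wpM2l ?exprn_ge0 //.
  have n0 : 0 <= n%:R :> R by apply: ler0n.
  have : 0 <= (n%:R + 1) * (1 - x) ^+ 2 by rewrite mulr_ge0 ?sqr_ge0 ?addr_ge0.
  by rewrite -natr1; nra.
have d0 : 0 < e * (1 - x) by rewrite mulr_gt0 // subr_gt0.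
have := archi_boundP (ltW (_ : 0 < (e * (1 - x))^-1)); rewrite invr_gt0 => /(_ d0).
set n := Num.Def.archi_bound _ => hn; exists n.
have n0 : 0 <= n%:R :> R by apply: ler0n.
have h1 : 1 < n%:R * (e * (1 - x)) by rewrite -ltr_pdivrMr // div1r.
rewrite ltNge; apply/negP => h2.
have := bern n; rewrite leNgt => /negP; apply.
have h3 : e * (1 + n%:R * (1 - x)) <= x ^+ n * (1 + n%:R * (1 - x)).
  by rewrite ler_wpM2r // addr_ge0 // mulr_ge0 // subr_ge0 ltW.
by apply: lt_le_trans h3; nra.
Qed.

Section MeanValue.
Variable R : realType.
Local Notation C := R[i].
Implicit Types (P Q : {poly C}) (h : C -> C).

Lemma norm_expr_small (x e : C) : `|x| < 1 -> 0 < e -> exists n, `|x| ^+ n < e.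
Proof.
have hx : `|x| = (complex.Re `|x|)%:C%C by rewrite RRe_real // normr_real.
move=> x1 e0; have he : e = (complex.Re e)%:C%C by rewrite RRe_real // gtr0_real.
case: (@expr_small R (complex.Re `|x|) (complex.Re e)).
- by rewrite -lecR -hx; apply: normr_ge0.
- by rewrite -ltcR -hx.
- by rewrite -ltcR -he.
by move=> n; rewrite -ltcR rmorphXn /= -hx -he => ?; exists n.
Qed.

(** The points are the roots of [x ^+ n.+1 = 'i]: shifting away from the roots of
unity keeps 1 and -1 out, where the estimates to be averaged may break down. *)
Lemma averaging_points n : exists s : seq C,
  [/\ s != [::], forall x, x \in s -> `|x| = 1 /\ x ^+ 2 != 1
    & forall P, (size P <= n)%N -> \sum_(x <- s) P.[x] = P.[0] *+ size s].
Proof.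
pose M := n.+1.
have [z zP] : exists z : C, M.-primitive_root z.
  case: (closed_field_poly_normal ('X^M - 1 : {poly C})) => rs rsE.
  have lc : lead_coef ('X^M - 1 : {poly C}) = 1.
    by apply/eqP; rewrite -monicE monicXnsubC.
  rewrite lc scale1r in rsE.
  have sz : size rs = M.
    by apply: succn_inj; rewrite -(size_prod_XsubC rs id) -rsE size_XnsubC.
  have/hasP[x _ xP] : has M.-primitive_root rs; last by exists x.
  apply: has_prim_root; rewrite ?sz //.
    by apply/allP => x xrs; rewrite /root_of_unity rsE root_prod_XsubC.
  by rewrite -separable_prod_XsubC -rsE separable_Xn_sub_1 ?pnatr_eq0.
pose w : C := M.-root 'i.
have wM : w ^+ M = 'i by rewrite rootCK.
have ptM x : x ^+ M = 'i -> `|x| = 1 /\ x ^+ 2 != 1.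
  move=> xM; split.
    apply/eqP; rewrite -(@pexpr_eq1 _ _ M) // -normrX xM.
    by rewrite normCi.
  apply/eqP => x2; have : (x ^+ M) ^+ 2 = 1 by rewrite exprAC x2 expr1n.
  rewrite xM sqrCi => /eqP; rewrite eq_sym -subr_eq0 opprK -(natrD _ 1 1).
  by rewrite pnatr_eq0.
exists [seq w * z ^+ k | k <- iota 0 M]; split=> //.
  move=> x /mapP[k _ ->]; apply: ptM.
  by rewrite exprMn wM exprAC (prim_expr_order zP) expr1n mulr1.
have pw (i : 'I_M) : i != ord0 -> \sum_(k <- iota 0 M) (w * z ^+ k) ^+ i = 0.
  rewrite -val_eqE -lt0n /= => i0.
  rewrite (eq_bigr (fun k => w ^+ i * (z ^+ i) ^+ k)) => [|k _]; last first.
    by rewrite exprMn exprAC.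
  rewrite -mulr_sumr -[RHS](mulr0 (w ^+ i)); congr (_ * _).
  set y := z ^+ i.
  have y1 : y != 1 by rewrite -(prim_order_dvd zP) gtnNdvd.
  have : (y - 1) * \sum_(0 <= k < M) y ^+ k = 0.
    by rewrite big_mkord -subrX1 /y exprAC (prim_expr_order zP) expr1n subrr.
  move/eqP; rewrite mulf_eq0 subr_eq0 (negPf y1) /= => /eqP.
  by rewrite /index_iota subn0.
move=> P szP; rewrite size_map big_map.
have szr := size_iota 0 M; set r := iota 0 M in pw szr *; clearbody r.
transitivity (\sum_(i < M) \sum_(k <- r) P`_i * (w * z ^+ k) ^+ i).
  rewrite exchange_big; apply: eq_bigr => k _.
  by rewrite (@horner_coef_wide _ M) // ltnW.
rewrite (bigD1 ord0) //= [X in _ + X]big1 ?addr0 => [|i i0]; last first.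
  by rewrite -mulr_sumr pw // mulr0.
rewrite (eq_bigr (fun=> P`_0)) => [|k _]; last by rewrite mulr1.
by rewrite big_const_seq count_predT iter_addr_0 horner_coef0.
Qed.

(** Uniform limits of polynomials on the closed disk.  The mean value property,
which for polynomials is an identity between finite sums, passes to such limits. *)
Definition disk_algebra h := forall e : C, 0 < e ->
  exists P, forall z, `|z| <= 1 -> `|h z - P.[z]| <= e.

Lemma poly_disk_bound P :
  exists2 c : C, 0 < c & forall z, `|z| <= 1 -> `|P.[z]| <= c.
Proof.
exists (1 + \sum_(i < size P) `|P`_i|) => [|z z1].
  by rewrite ltr_pwDl // sumr_ge0.
rewrite horner_coef (le_trans (ler_norm_sum _ _ _)) //.
rewrite -[X in X <= _]add0r lerD //; apply: ler_sum => i _.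
by rewrite normrM normrX ler_piMr // exprn_ile1.
Qed.

Lemma disk_algebra_poly P : disk_algebra (fun z => P.[z]).
Proof. by move=> e e0; exists P => z _; rewrite subrr normr0 ltW. Qed.

Lemma disk_algebra_bound h : disk_algebra h ->
  exists2 c : C, 0 < c & forall z, `|z| <= 1 -> `|h z| <= c.
Proof.
case/(_ 1 ltr01) => P hP; have [c c0 Pc] := poly_disk_bound P.
exists (1 + c) => [|z z1]; first by rewrite addr_gt0.
rewrite -[h z](subrK P.[z]) (le_trans (ler_normD _ _)) // lerD //.
  exact: hP.
exact: Pc.
Qed.

Lemma disk_algebraD h1 h2 : disk_algebra h1 -> disk_algebra h2 ->
  disk_algebra (fun z => h1 z + h2 z).
Proof.
move=> H1 H2 e e0.
have [P1 hP1] := H1 (e / 2) (divr_gt0 e0 (ltr0n _ 2)).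
have [P2 hP2] := H2 (e / 2) (divr_gt0 e0 (ltr0n _ 2)).
exists (P1 + P2) => z z1; rewrite hornerD opprD addrACA.
by rewrite (le_trans (ler_normD _ _)) // [e]splitr lerD ?hP1 ?hP2.
Qed.

Lemma disk_algebraM h1 h2 : disk_algebra h1 -> disk_algebra h2 ->
  disk_algebra (fun z => h1 z * h2 z).
Proof.
move=> H1 H2 e e0; have e20 : 0 < e / 2 by rewrite divr_gt0.
have [c1 c10 hc1] := disk_algebra_bound H1.
have [P2 hP2] := H2 (e / 2 / c1) (divr_gt0 e20 c10).
have [c2 c20 hc2] := poly_disk_bound P2.
have [P1 hP1] := H1 (e / 2 / c2) (divr_gt0 e20 c20).
exists (P1 * P2) => z z1; rewrite hornerM.
have -> : h1 z * h2 z - P1.[z] * P2.[z] =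
  h1 z * (h2 z - P2.[z]) + (h1 z - P1.[z]) * P2.[z] by ring.
rewrite (le_trans (ler_normD _ _)) // [e]splitr !normrM lerD //.
  rewrite -[e / 2](divfK (lt0r_neq0 c10)) mulrC ler_pM ?hP2 ?hc1 //.
by rewrite -[e / 2](divfK (lt0r_neq0 c20)) ler_pM ?hP1 ?hc2.
Qed.

Lemma disk_algebra_eq h1 h2 : (forall z, `|z| <= 1 -> h1 z = h2 z) ->
  disk_algebra h1 -> disk_algebra h2.
Proof.
move=> hh H e e0; have [P hP] := H e e0.
by exists P => z z1; rewrite -hh // hP.
Qed.

Lemma disk_algebra_sum (I : eqType) (r : seq I) (h : I -> C -> C) :
  (forall i, i \in r -> disk_algebra (h i)) ->
  disk_algebra (fun z => \sum_(i <- r) h i z).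
Proof.
elim: r => [|i r IH] H.
  apply: (@disk_algebra_eq (fun z => (0 : {poly C}).[z])).
    by move=> z _; rewrite big_nil horner0.
  exact: disk_algebra_poly.
apply: (@disk_algebra_eq (fun z => h i z + \sum_(j <- r) h j z)).
  by move=> z _; rewrite big_cons.
apply: disk_algebraD; first by apply: H; rewrite mem_head.
by apply: IH => j jr; apply: H; rewrite in_cons jr orbT.
Qed.

Lemma disk_algebra_geom (x : C) : `|x| < 1 ->
  disk_algebra (fun z => (1 - x * z)^-1).
Proof.
move=> x1 e e0; have d0 : 0 < 1 - `|x| by rewrite subr_gt0.
have [n xn] := norm_expr_small x1 (mulr_gt0 e0 d0).
exists (\poly_(i < n) x ^+ i) => z z1.
have xz : `|x * z| <= `|x| by rewrite normrM ler_piMr.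
have xzd : 1 - `|x| <= `|1 - x * z|.
  rewrite (le_trans _ (lerB_dist _ _)) // normr1 lerD2l lerN2 //.
have xz1 : 1 - x * z != 0 by rewrite -normr_gt0 (lt_le_trans d0).
rewrite horner_poly.
under eq_bigr => i _ do rewrite -exprMn.
have -> : (1 - x * z)^-1 - \sum_(i < n) (x * z) ^+ i = (x * z) ^+ n / (1 - x * z).
  apply: (mulfI xz1); rewrite mulrBr divff // mulrCA divff // mulr1.
  by rewrite -[1 - x * z]opprB mulNr -subrX1 opprK addrC subrK.
rewrite normrM normfV ler_pdivrMr ?normr_gt0 // normrX.
apply: le_trans (_ : `|x| ^+ n <= _); first by rewrite lerXn2r ?nnegrE.
by apply: le_trans (ltW xn) _; rewrite ler_wpM2l // ltW.
Qed.

(** [P] splits into factors [z - x] with [|x| > 1], whose inverses are geometric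
series. *)
Lemma disk_algebra_inv P : (forall z, `|z| <= 1 -> P.[z] != 0) ->
  disk_algebra (fun z => (P.[z])^-1).
Proof.
case: (closed_field_poly_normal P) => rs -> hP.
have := hP 0; rewrite normr0 ler01 => /(_ isT).
rewrite hornerZ mulf_eq0 negb_or => /andP[c0 _]; set c := lead_coef P in c0 hP *.
have {hP} : forall x, x \in rs -> 1 < `|x|.
  move=> x xrs; rewrite real_ltNge ?normr_real //; apply/negP => x1.
  have := hP x x1; rewrite hornerZ mulf_eq0 negb_or => /andP[_ /negP]; apply.
  by rewrite -rootE root_prod_XsubC.
elim: rs => [|x rs IH] hrs.
  apply: (@disk_algebra_eq (fun z => (c^-1)%:P.[z])).
    by move=> z _; rewrite big_nil hornerZ hornerC hornerC mulr1.
  exact: disk_algebra_poly.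
have x1 : 1 < `|x| by apply: hrs; rewrite mem_head.
have x0 : x != 0 by rewrite -normr_gt0 (lt_trans ltr01).
apply: (@disk_algebra_eq (fun z => (- x^-1)%:P.[z] * (1 - x^-1 * z)^-1 *
   ((c *: \prod_(z0 <- rs) ('X - z0%:P)).[z])^-1)).
  move=> z _; rewrite big_cons !hornerZ hornerM hornerXsubC hornerC !invfM.
  have -> : (z - x)^-1 = - x^-1 * (1 - x^-1 * z)^-1.
    have -> : z - x = - x * (1 - x^-1 * z) by field.
    by rewrite invfM invrN.
  by ring.
apply: disk_algebraM.
  apply: disk_algebraM; first exact: disk_algebra_poly.
  by apply: disk_algebra_geom; rewrite normfV invf_lt1 ?normr_gt0.
by apply: IH => y yrs; apply: hrs; rewrite in_cons yrs orbT.
Qed.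

(** Integrating the inequality over the circle: the mean of ['Re h] is its value at
0, and the mean of [|P|^2] is at least [|P(0)|^2] since the variance
of [P] is nonnegative. *)
Lemma mean_lower_bound h P (c : C) : disk_algebra h -> 0 <= c ->
  (forall z, `|z| = 1 -> z ^+ 2 != 1 -> c * `|P.[z]| ^+ 2 <= 'Re (h z)) ->
  c * `|P.[0]| ^+ 2 <= 'Re (h 0).
Proof.
move=> hA c0 hP.
suff H e : 0 < e -> c * `|P.[0]| ^+ 2 <= 'Re (h 0) + e.
  rewrite real_leNgt ?Creal_Re //; last first.
    by rewrite ger0_real // mulr_ge0 // exprn_ge0.
  apply/negP; rewrite -subr_gt0; set d := _ - _ => d0.
  have := H (d / 2) (divr_gt0 d0 (ltr0n _ 2)); rewrite addrC -lerBlDr -/d => dd.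
  have d2 : d / 2 < d by rewrite ltr_pdivrMr // mulr_natr mulr2n ltrDl.
  by have := le_lt_trans dd d2; rewrite ltxx.
move=> e0; have e20 : 0 < e / 2 by rewrite divr_gt0.
have [G hG] := hA _ e20.
have Re_norm (x : C) : 'Re x <= `|x|.
  exact: (leif_Re_Creal x).1.
have [s [s0 s1 sP]] := averaging_points (maxn (size P) (size G)).
have n0 : 0 < (size s)%:R :> C by rewrite ltr0n lt0n size_eq0.
pose avg (f : C -> C) := (\sum_(x <- s) f x) / (size s)%:R.
have avgP (Q : {poly C}) : (size Q <= maxn (size P) (size G))%N ->
    avg (fun x => Q.[x]) = Q.[0].
  by move=> szQ; rewrite /avg sP // -[_ *+ _]mulr_natr mulfK // gt_eqF.
have avg_le (f g : C -> C) : (forall x, x \in s -> f x <= g x) -> avg f <= avg g.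
  move=> fg; rewrite /avg ler_wpM2r ?invr_ge0 ?(ltW n0) //.
  by rewrite big_seq [X in _ <= X]big_seq; apply: ler_sum.
have avgc k : avg (fun=> k) = k.
  rewrite /avg big_const_seq count_predT iter_addr_0 -[k *+ _]mulr_natr mulfK //.
  by rewrite gt_eqF.
have avgD (f g F : C -> C) : (forall x, F x = f x + g x) -> avg F = avg f + avg g.
  by move=> Ffg; rewrite /avg -mulrDl -big_split; congr (_ / _); apply: eq_bigr.
have avgZ k (f F : C -> C) : (forall x, F x = k * f x) -> avg F = k * avg f.
  move=> Ff; rewrite /avg mulrA mulr_sumr; congr (_ / _).
  by apply: eq_bigr => x _; rewrite Ff.
have avgRe (f : C -> C) : avg (fun x => 'Re (f x)) = 'Re (avg f).
  by rewrite /avg -raddf_sum -ReMr // rpredV realn.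
have lhs : c * `|P.[0]| ^+ 2 <= avg (fun x => c * `|P.[x]| ^+ 2).
  rewrite (avgZ c (fun x => `|P.[x]| ^+ 2)) // ler_wpM2l //.
  have : 0 <= avg (fun x => `|P.[x] - P.[0]| ^+ 2).
    by rewrite -(avgc 0); apply: avg_le => x _; apply: exprn_ge0.
  pose f1 x := `|P.[x]| ^+ 2; pose f2 x := P.[x] * P.[0]^*.
  pose f3 x := 'Re (f2 x); pose f4 x := - 2 * f3 x.
  pose f5 x := f4 x + `|P.[0]| ^+ 2.
  rewrite (_ : avg _ = avg f1 + avg f5); last first.
    apply: avgD => x; rewrite /f5 /f4 /f3 /f2 /f1 !normCK rmorphB /= ReE rmorphM /=.
    by rewrite conjCK; field.
  have -> : avg f5 = avg f4 + avg (fun=> `|P.[0]| ^+ 2) by apply: avgD.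
  have -> : avg f4 = - 2 * avg f3 by apply: avgZ.
  have -> : avg f3 = 'Re (avg f2) by apply: avgRe.
  have -> : avg f2 = P.[0]^* * avg (fun x => P.[x]).
    by apply: avgZ => x; rewrite mulrC.
  rewrite avgc avgP ?leq_maxl // [P.[0]^* * _]mulrC -normCK.
  rewrite (Creal_ReP _ _) ?ger0_real ?exprn_ge0 //.
  have -> : - 2 * `|P.[0]| ^+ 2 + `|P.[0]| ^+ 2 = - (`|P.[0]| ^+ 2) by ring.
  by rewrite subr_ge0.
apply: le_trans lhs _.
apply: le_trans (avg_le _ (fun x => 'Re (h x)) _) _.
  by move=> x /s1[x1 x2]; apply: hP.
apply: le_trans (avg_le _ (fun x => 'Re G.[x] + e / 2) _) _.
  move=> x /s1[x1 _]; rewrite -lerBlDl -raddfB.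
  by rewrite (le_trans (Re_norm _)) // hG // x1.
have -> : avg (fun x => 'Re G.[x] + e / 2) = 'Re G.[0] + e / 2.
  pose g1 x := 'Re G.[x].
  have -> : avg (fun x => 'Re G.[x] + e / 2) = avg g1 + avg (fun=> e / 2).
    exact: avgD.
  by rewrite avgc [avg g1]avgRe avgP ?leq_maxr.
rewrite [in X in _ <= X](splitr e) addrA.
rewrite lerD2r -lerBlDl -raddfB (le_trans (Re_norm _)) //.
by rewrite distrC hG // normr0.
Qed.

End MeanValue.

(** * Real polynomials at complex points *)
Section RealPoly.
Variable R : realType.
Local Notation C := R[i].
Implicit Types (f g : {poly R}) (z : C).

Lemma cevalD f g z : ceval (f + g) z = ceval f z + ceval g z.
Proof. by rewrite /ceval rmorphD hornerD. Qed.
Lemma cevalN f z : ceval (- f) z = - ceval f z.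
Proof. by rewrite /ceval rmorphN hornerN. Qed.
Lemma cevalM f g z : ceval (f * g) z = ceval f z * ceval g z.
Proof. by rewrite /ceval rmorphM hornerM. Qed.
Lemma cevalZ a f z : ceval (a *: f) z = a%:C%C * ceval f z.
Proof. by rewrite /ceval map_polyZ hornerZ. Qed.
Lemma cevalX z : ceval 'X z = z.
Proof. by rewrite /ceval map_polyX hornerX. Qed.
Lemma cevalC a z : ceval a%:P z = a%:C%C.
Proof. by rewrite /ceval map_polyC hornerC. Qed.
Lemma ceval1 z : ceval 1 z = 1.
Proof. by rewrite cevalC. Qed.
Lemma cevalXn f n z : ceval (f ^+ n) z = ceval f z ^+ n.
Proof. by rewrite /ceval rmorphXn horner_exp. Qed.
Lemma ceval_sum (I : Type) (r : seq I) (F : I -> {poly R}) z :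
  ceval (\sum_(i <- r) F i) z = \sum_(i <- r) ceval (F i) z.
Proof. by rewrite /ceval rmorph_sum horner_sum. Qed.
Lemma ceval_real f (x : R) : ceval f x%:C%C = (f.[x])%:C%C.
Proof. by rewrite /ceval horner_map. Qed.
Lemma ceval0 f : ceval f 0 = (f.[0])%:C%C.
Proof. by rewrite -ceval_real. Qed.

Definition cevalE :=
  (cevalM, cevalXn, cevalD, cevalN, cevalZ, cevalX, ceval1, cevalC).

Lemma real_complex_conj (x : R) : (x%:C%C)^* = x%:C%C.
Proof. by rewrite [LHS]conjc_real. Qed.

Lemma ceval_conj f z : (ceval f z)^* = ceval f z^*.
Proof.
rewrite /ceval -horner_map -map_poly_comp /=; congr horner.
by apply: eq_map_poly => x; apply: real_complex_conj.
Qed.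

Lemma unit_conj z : `|z| = 1 -> z^* = z^-1.
Proof. by move=> z1; rewrite invC_norm z1 expr1n invr1 mul1r. Qed.
End RealPoly.

(** * Positivity of a stripped Jost function at the origin *)
Section Positivity.
Variable R : realType.
Local Notation C := R[i].
Implicit Types (f w y t : {poly R}) (z : C) (K : seq R).

Definition root_poly K : {poly R} := \prod_(x <- K) ('X - x%:P).

Definition root_poly_except K (x : R) : {poly R} := \prod_(x' <- K | x' != x) ('X - x'%:P).

Lemma root_polyE K x : uniq K -> x \in K -> root_poly K = ('X - x%:P) * root_poly_except K x.
Proof. by move=> uK xK; rewrite /root_poly (bigD1_seq x). Qed.

Lemma deriv_root_poly K x : uniq K -> x \in K ->
  (root_poly K)^`().[x] = (root_poly_except K x).[x].
Proof.
move=> uK xK; rewrite (root_polyE uK xK) derivM !hornerE derivXsubC.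
by rewrite subrr mul0r addr0 hornerC mul1r.
Qed.

Lemma root_poly_except0 K x x' : x' \in K -> x' != x -> (root_poly_except K x).[x'] = 0.
Proof.
move=> x'K xx'; apply/eqP; rewrite -rootE /root_poly_except -big_filter.
by rewrite root_prod_XsubC mem_filter xx'.
Qed.

(** The partial fraction expansion of [A / (root_poly K * B)] at the simple poles
[K], with denominators cleared; [A2 / B] is the part without poles in [K]. *)
Lemma partial_fractions (A B : {poly R}) K : uniq K ->
  (forall x, x \in K -> B.[x] != 0) ->
  exists A2, A = \sum_(x <- K)
    (A.[x] / ((root_poly K)^`().[x] * B.[x])) *: (B * root_poly_except K x)
    + root_poly K * A2.
Proof.
move=> uK BK; set S := \sum_(x <- K) _.
have : root_poly K %| A - S.
  apply: uniq_roots_dvdp; rewrite ?uniq_rootsE //.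
  apply/allP => x xK; rewrite rootE hornerD hornerN horner_sum.
  rewrite (bigD1_seq x) //= big_seq_cond big1 => [|x' /andP[x'K xx']].
    rewrite deriv_root_poly // ?hornerZ ?hornerM ?addr0.
    have h : (root_poly_except K x).[x] != 0.
      rewrite -rootE /root_poly_except -big_filter root_prod_XsubC mem_filter.
      by rewrite eqxx.
    by apply/eqP; field; rewrite h BK.
  by rewrite hornerZ hornerM root_poly_except0 1?eq_sym // !mulr0.
by case/dvdpP => A2 E; exists A2; rewrite mulrC -E addrC subrK.
Qed.

Lemma normC_lt1 (x : R) : (`|x%:C%C| < 1 :> C) = (-1 < x < 1).
Proof.
by rewrite normc_def /= expr0n addr0 sqrtr_sqr -[1]/(1%:C)%C ltcR ltr_norml.
Qed.
Lemma no_root_sign (g : {poly R}) :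
  (forall z : C, `|z| < 1 -> ceval g z != 0) ->
  forall x : R, -1 < x < 1 -> 0 < g.[0] * g.[x].
Proof.
move=> hg x /andP[x1 x2]; rewrite ltNge; apply/negP => gx.
have nz (u : R) : `|u| < 1 -> g.[u] != 0.
  move=> u1; have := hg u%:C%C; rewrite ceval_real fmorph_eq0; apply.
  by rewrite normC_lt1 -ltr_norml.
have xn : `|x| < 1 by rewrite ltr_norml x1.
have [x0|x0] := leP 0 x.
- have [|u /andP[u0 ux]] := @poly_ivt _ (- g.[0] *: g) 0 x x0.
  + by rewrite !hornerZ !mulNr oppr_le0 oppr_ge0 -expr2 sqr_ge0.
  + rewrite rootZ; last by rewrite oppr_eq0; apply: nz; rewrite normr0.
    by apply/negP; apply: nz; rewrite ger0_norm // (le_lt_trans ux).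
- have [|u /andP[u0 ux]] := @poly_ivt _ (g.[0] *: g) x 0 (ltW x0).
  + by rewrite !hornerZ -expr2 sqr_ge0 gx.
  + rewrite rootZ; last by apply: nz; rewrite normr0.
    by apply/negP; apply: nz; rewrite ler0_norm // ltrNl; apply: lt_le_trans u0.
Qed.

(** With [g = y (1 - z^2) t / w], whose value at 0 is [t(0) / w(0)], the factor [P] of
[w], which collects its zeros at 1 and -1, cancels against [1 - z^2].  Subtracting the
polar parts [r x / (z - x)] of [g] at [K] and adding [r x * z / (1 - x z)], which has
the same real part on the circle, yields a function [h] in the disk algebra with
['Re h = 'Re g] on the circle.  There [g = |y|^2 - u] with
[|u| = |y|^2 |f| / |w|] by the identity, and [|w|^2 - |f|^2 = |z^2 - 1|^2] bounds ['Re g]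
below by a multiple of [|y (z^2 - 1)|^2], so [h(0) > 0]; the difference
[g(0) - h(0)] is the sum of the [- r x / x], which are nonnegative by the sign
condition on [f]. *)
Lemma stripped_coef_gt0 (w f y t P P' B : {poly R}) (K : seq R) (n : nat) :
  P * P' = 'X^2 - 1 -> w = P * root_poly K * B -> 0 < w.[0] ->
  (forall z : C, `|z| < 1 -> ceval P z != 0) ->
  (forall z : C, `|z| <= 1 -> ceval B z != 0) ->
  uniq K -> (forall x, x \in K -> -1 < x < 1 /\ x != 0) ->
  (forall x, x \in K -> 0 < f.[x] * (root_poly K)^`().[x] * (root_poly K).[0]) ->
  (forall z : C, `|z| = 1 ->
     `|ceval w z| ^+ 2 = `|ceval f z| ^+ 2 + `|z ^+ 2 - 1| ^+ 2) ->
  (forall z : C, z != 0 ->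
     ceval w z * ceval y z^-1 - z ^+ 3 * (z^-1 ^+ n) ^+ 2 * ceval f z * ceval y z
       = (1 - z ^+ 2) * ceval t z) ->
  y.[0] = 1 -> 0 < t.[0].
Proof.
move=> hP wE w0 Pnz Bnz uK hK sgnK circ ident y0.
set D := root_poly K.
have Dreal x : x \in K -> D.[x] = 0.
  by move=> xK; apply/eqP; rewrite -rootE root_prod_XsubC.
have BK x : x \in K -> B.[x] != 0.
  move=> /hK[x1 _]; have := Bnz x%:C%C; rewrite ceval_real fmorph_eq0; apply.
  by rewrite ltW // normC_lt1.
have PK x : x \in K -> P.[x] != 0.
  move=> /hK[x1 _]; have := Pnz x%:C%C; rewrite ceval_real fmorph_eq0; apply.
  by rewrite normC_lt1.
have D'K x : x \in K -> D^`().[x] != 0.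
  by move=> /sgnK h; apply/eqP => D0; move: h; rewrite D0 mulr0 mul0r ltxx.
have D0 : D.[0] != 0.
  by apply/eqP => D0; move: w0; rewrite wE !hornerM -/D D0 mulr0 mul0r ltxx.
have BPsgn x : x \in K -> 0 < (P * B).[0] * (P * B).[x].
  move=> /hK[x1 _]; apply: no_root_sign => // z z1.
  by rewrite cevalM mulf_neq0 ?Pnz ?Bnz // ltW.
pose A := - (y * P' * t).
have [A2 AE] := partial_fractions A uK BK.
rewrite -/D in AE.
pose r x := A.[x] / (D^`().[x] * B.[x]).
(* At a zero x of w the identity expresses t(x) through f(x) y(x), which turns the
   residue into a positive multiple of the quantity in the sign condition. *)
have rsgn x : x \in K -> 0 <= - (r x / x).
  move=> xK; have [x1 x0] := hK x xK.
  have xC0 : x%:C%C != 0 :> C by rewrite fmorph_eq0.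
  have := ident _ xC0.
  rewrite -fmorphV !ceval_real -!rmorphXn -!rmorphM -rmorphB /= -[1]/(1%:C)%C.
  rewrite -rmorphB -rmorphM /= => /(@complexI R).
  rewrite wE !hornerM -/D Dreal // mulr0 !mul0r sub0r => idx.
  have hPx : P.[x] * P'.[x] = x ^+ 2 - 1.
    by rewrite -hornerM hP !hornerE.
  have tE : P'.[x] * t.[x] = x ^+ 3 * (x^-1 ^+ n) ^+ 2 * f.[x] * y.[x] / P.[x].
    apply: (mulfI (PK x xK)); rewrite mulrA hPx [RHS]mulrC divfK ?PK //.
    by rewrite -[LHS]opprK -mulNr opprB -idx opprK.
  have -> : - (r x / x) = (x * x^-1 ^+ n * y.[x]) ^+ 2 *
      (f.[x] * D^`().[x] * D.[0]) * ((P * B).[0] * (P * B).[x])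
      / (w.[0] * (D^`().[x] * (P * B).[x]) ^+ 2).
    rewrite /r /A wE hornerN !hornerM -/D -[y.[x] * _ * _]mulrA tE.
    have := D'K _ xK; have := BK _ xK; have := PK _ xK => h1 h2 h3.
    have h4 : P.[0] * D.[0] * B.[0] != 0 by rewrite -!hornerM -wE lt0r_neq0.
    move: h4; rewrite !mulf_eq0 !negb_or => /andP[/andP[h4 _] h5].
    by field; rewrite h1 h2 h3 x0 h4 h5 D0.
  apply: divr_ge0.
    by apply: mulr_ge0; [apply: mulr_ge0; rewrite ?sqr_ge0 ?ltW ?sgnK | rewrite ltW ?BPsgn].
  by rewrite mulr_ge0 ?sqr_ge0 // ltW.
pose h (z : C) := ceval A2 z / ceval B z + \sum_(x <- K) (r x)%:C%C * z / (1 - x%:C%C * z).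
have hA : disk_algebra h.
  apply: disk_algebraD.
    apply: disk_algebraM; first exact: disk_algebra_poly.
    exact: disk_algebra_inv.
  apply: disk_algebra_sum => x /hK[x1 _].
  apply: disk_algebraM; last by apply: disk_algebra_geom; rewrite normC_lt1.
  apply: (@disk_algebra_eq _ (fun z => ((r x)%:C%C *: 'X).[z])).
    by move=> z _; rewrite hornerZ hornerX.
  exact: disk_algebra_poly.
have [cw cw0 wle] := poly_disk_bound (map_poly (real_complex R) w).
have AC z : ceval A z = \sum_(x <- K) (r x)%:C%C * (ceval B z * ceval (root_poly_except K x) z)
   + ceval D z * ceval A2 z.
  rewrite AE cevalD cevalM ceval_sum; congr (_ + _); apply: eq_bigr => x _.
  by rewrite cevalZ cevalM.
have AD z : ceval D z != 0 -> ceval B z != 0 ->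
    ceval A z / (ceval D z * ceval B z) =
    \sum_(x <- K) (r x)%:C%C / (z - x%:C%C) + ceval A2 z / ceval B z.
  move=> Dz Bz; rewrite AC mulrDl; congr (_ + _); last by field; rewrite Dz Bz.
  rewrite mulr_suml [LHS]big_seq [RHS]big_seq; apply: eq_bigr => x xK.
  move: Dz; rewrite /D (root_polyE uK xK) cevalM cevalD cevalN cevalX cevalC.
  by rewrite mulf_eq0 negb_or => /andP[zx Dx]; field; rewrite zx Dx Bz.
have c0 : 0 < (2 * cw ^+ 2)^-1 by rewrite invr_gt0 mulr_gt0 // exprn_gt0.
have circle z : `|z| = 1 -> z ^+ 2 != 1 -> (2 * cw ^+ 2)^-1 *
    `|(map_poly (real_complex R) (y * ('X^2 - 1))).[z]| ^+ 2 <= 'Re (h z).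
  move=> z1 z2.
  rewrite -/(ceval _ _) cevalM !cevalE.
  have z0 : z != 0 by rewrite -normr_gt0 z1.
  set E : C := z ^+ 2 - 1.
  have En : E != 0 by rewrite subr_eq0.
  have wn : 0 < `|ceval w z|.
    rewrite normr_gt0; apply/eqP => wz0; move: (circ z z1).
    rewrite wz0 normr0 expr0n => /eqP; rewrite eq_sym paddr_eq0 ?exprn_ge0 //.
    by rewrite !expf_eq0 /= !normr_eq0 (negPf En) andbF.
  have w0' : ceval w z != 0 by rewrite -normr_gt0.
  move: (w0'); rewrite wE !cevalM -/D !mulf_eq0 !negb_or => /andP[/andP[Pz Dz] Bz].
  have -> : 'Re (h z) = 'Re (ceval A z / (ceval D z * ceval B z)).
    rewrite AD // /h !raddfD /= addrC; congr (_ + _).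
    rewrite !raddf_sum [LHS]big_seq [RHS]big_seq; apply: eq_bigr => x xK.
    have zx : z - x%:C%C != 0.
      apply: contraTneq Dz => /eqP; rewrite subr_eq0 => /eqP ->.
      by rewrite ceval_real Dreal // eqxx.
    have zx' : 1 - x%:C%C * z != 0.
      apply: contraNneq zx => /eqP; rewrite subr_eq0 => /eqP h1.
      have : `|x%:C%C * z| < 1.
        by rewrite normrM z1 mulr1 normC_lt1; have [] := hK x xK.
      by rewrite -h1 normr1 ltxx.
    (* For real x the polar part and its regular substitute are conjugate on the
       circle, because z^-1 is the conjugate of z there. *)
    rewrite -[RHS]Re_conj; congr ('Re _).
    have -> : ((r x)%:C%C / (z - x%:C%C))^* = (r x)%:C%C / (z^-1 - x%:C%C).
      rewrite -[in RHS](unit_conj z1) -[in RHS](real_complex_conj x).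
      by rewrite -[in RHS](real_complex_conj (r x)) -rmorphB -fmorphV -rmorphM.
    have -> : z^-1 - x%:C%C = (1 - x%:C%C * z) / z by field.
    by rewrite invfM invrK mulrA mulrAC.
  have idz := ident z z0.
  have hPz : ceval P z * ceval P' z = E.
    by rewrite -cevalM hP !cevalE.
  set Y := ceval y z.
  set u := z ^+ 3 * (z^-1 ^+ n) ^+ 2 * ceval f z * Y ^+ 2 / ceval w z.
  have -> : ceval A z / (ceval D z * ceval B z) = `|Y| ^+ 2 - u.
    have -> : `|Y| ^+ 2 - u = Y * ((1 - z ^+ 2) * ceval t z) / ceval w z.
      rewrite -idz normCK [Y^*]ceval_conj unit_conj // /u -/Y.
      move: (z^-1 ^+ n) (ceval y z^-1) (ceval f z) => a b c.
      by field.
    have -> : 1 - z ^+ 2 = - (ceval P z * ceval P' z) by rewrite hPz opprB.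
    rewrite /A wE cevalN !cevalM -/Y -/D.
    by field; rewrite Pz Dz Bz.
  have un : `|u| = `|ceval f z| * `|Y| ^+ 2 / `|ceval w z|.
    by rewrite /u !normrM !normfV !normrX normfV z1 invr1 !expr1n !mul1r.
  apply: le_trans (_ : `|Y| ^+ 2 - `|u| <= _); last first.
    rewrite raddfB /= (Creal_ReP _ _) ?lerD2l ?lerN2 ?(leif_Re_Creal u).1 //.
    by rewrite ger0_real // exprn_ge0.
  have cwz : `|ceval w z| <= cw by apply: wle; rewrite z1.
  have cz := circ z z1.
  set W := `|ceval w z| in wn un cwz cz *.
  set F := `|ceval f z| in un cz *.
  rewrite un normrM exprMn -/E.
  have F0 : 0 <= F by apply: normr_ge0.
  have E0 : 0 <= `|E| ^+ 2 by apply: exprn_ge0.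
  have Y0 : 0 <= `|Y| ^+ 2 by apply: exprn_ge0.
  have -> : `|Y| ^+ 2 - F * `|Y| ^+ 2 / W = `|Y| ^+ 2 * ((W - F) / W).
    by field; rewrite gt_eqF.
  rewrite mulrCA ler_wpM2l //.
  have FW : F <= W.
    by rewrite -(@ler_pXn2r _ 2) ?nnegrE ?(ltW wn) // cz lerDl.
  have -> : `|E| ^+ 2 = (W - F) * (W + F).
    by rewrite -subr_sqr cz addrAC subrr add0r.
  rewrite mulrCA ler_wpM2l ?subr_ge0 //.
  rewrite mulrC ler_pdivrMr ?mulr_gt0 ?exprn_gt0 //.
  rewrite mulrC ler_pdivlMr //.
  apply: le_trans (_ : (W + W) * W <= _).
    by rewrite ler_wpM2r ?(ltW wn) // lerD2l.
  rewrite -mulr2n -[W *+ 2]mulr_natl -mulrA ler_wpM2l // -expr2.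
  by rewrite lerXn2r ?nnegrE ?(ltW wn) ?(ltW cw0).
have := mean_lower_bound hA (ltW c0) circle.
rewrite -/(ceval _ _) ceval0 hornerM y0 mul1r !hornerE /= expr0n /= add0r.
rewrite /h => lb.
have lb0 : 0 < 'Re (ceval A2 0 / ceval B 0).
  move: lb; rewrite big1 ?addr0 => [|x _]; last by rewrite mulr0 mul0r.
  apply: lt_le_trans.
  by rewrite !mulr_gt0 ?invr_gt0 ?mulr_gt0 ?normr_gt0 ?fmorph_eq0 ?oppr_eq0 ?oner_eq0.
have B0 : B.[0] != 0.
  by have := Bnz 0; rewrite normr0 ler01 ceval0 fmorph_eq0; apply.
have lbR : 0 < A2.[0] / B.[0].
  rewrite -ltcR; move: lb0; rewrite !ceval0 -fmorph_div (Creal_ReP _ _) //.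
  by apply/complex_realP; exists (A2.[0] / B.[0]).
have e0 : t.[0] / w.[0] = A2.[0] / B.[0] + \sum_(x <- K) - (r x / x).
  have Dz : ceval D 0 != 0 by rewrite ceval0 fmorph_eq0.
  have Bz : ceval B 0 != 0 by rewrite ceval0 fmorph_eq0.
  have hP0 : P.[0] * P'.[0] = -1.
    by rewrite -hornerM hP !hornerE /= expr0n /= add0r.
  have P0 : P.[0] != 0.
    by apply/eqP => P0; move: hP0 => /eqP; rewrite P0 mul0r eq_sym oppr_eq0 oner_eq0.
  have := AD 0 Dz Bz.
  have -> : \sum_(x <- K) (r x)%:C%C / (0 - x%:C%C) = (\sum_(x <- K) - (r x / x))%:C%C :> C.
    rewrite rmorph_sum; apply: eq_bigr => x _.
    by rewrite sub0r invrN mulrN -fmorph_div -rmorphN.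
  rewrite !ceval0 -rmorphM -!fmorph_div -rmorphD => /(@complexI R).
  rewrite addrC => <-; rewrite /A wE hornerN !hornerM y0 mul1r -/D.
  have -> : P'.[0] = - P.[0]^-1 by apply: (mulfI P0); rewrite hP0 mulrN divff.
  by field; rewrite P0 D0 B0.
have : 0 < t.[0] / w.[0].
  by rewrite e0 ltr_pwDl // big_seq; apply: sumr_ge0 => x /rsgn.
by rewrite pmulr_lgt0 // invr_gt0.
Qed.
End Positivity.

(** * Spectral factorisation on the unit circle *)
Lemma poly_eq_nonzero (F : numFieldType) (P Q : {poly F}) :
  (forall z, z != 0 -> P.[z] = Q.[z]) -> P = Q.
Proof.
move=> PQ; apply/eqP; rewrite -subr_eq0; apply/negPn/negP => nz.
set p := P - Q in nz.
pose rs : seq F := [seq i.+1%:R | i <- iota 0 (size p)].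
have := @max_poly_roots _ p rs nz; rewrite size_map size_iota ltnn.
suff [-> ->] : all (root p) rs /\ uniq rs by move/(_ isT isT).
split.
  apply/allP => x /mapP[i _ ->].
  by rewrite rootE hornerD hornerN PQ ?subrr // pnatr_eq0.
by rewrite map_inj_uniq ?iota_uniq // => i j /eqP; rewrite eqr_nat => /eqP [].
Qed.

Section Reversal.
Variable C : numClosedFieldType.
Implicit Types (P Q H : {poly C}) (z : C).

(** The polynomial [z^n * conj (P (1 / conj z))]; on the unit circle it is [z^n]
times the conjugate of [P], so that [P * crev n P] is [z^n |P|^2]. *)
Definition crev n P := \poly_(i < n.+1) (P`_(n - i))^*.

Lemma size_crev n P : (size (crev n P) <= n.+1)%N.
Proof. exact: size_poly. Qed.

Lemma crevE n P z : (size P <= n.+1)%N -> z != 0 ->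
  (crev n P).[z] = z ^+ n * (P.[(z^-1)^*])^*.
Proof.
move=> sP z0; rewrite horner_poly (horner_coef_wide _ sP) rmorph_sum mulr_sumr.
rewrite (reindex_inj rev_ord_inj) /=; apply: eq_bigr => i _.
have lin : (i <= n)%N by rewrite -ltnS.
rewrite subSS subKn // rmorphM rmorphXn /= conjCK mulrCA; congr (_ * _).
by rewrite exprVn exprB ?unitfE.
Qed.

Lemma crev_circle n P z : (size P <= n.+1)%N -> `|z| = 1 ->
  (crev n P).[z] = z ^+ n * (P.[z])^*.
Proof.
move=> sP z1; have z0 : z != 0 by rewrite -normr_gt0 z1.
by rewrite crevE // invC_norm z1 expr1n invr1 mul1r conjCK.
Qed.

Lemma crevD n P Q : crev n (P + Q) = crev n P + crev n Q.
Proof.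
apply/polyP => i; rewrite coefD !coef_poly; case: ifP => _; last by rewrite addr0.
by rewrite coefD rmorphD.
Qed.

Lemma crevK n P : (size P <= n.+1)%N -> crev n (crev n P) = P.
Proof.
move=> sP; apply/polyP => i; rewrite !coef_poly; case: ltnP => [|h].
  by rewrite ltnS => lin; rewrite ltnS leq_subr subKn // conjCK.
by rewrite nth_default // (leq_trans sP).
Qed.

Lemma crevM m n P Q : (size P <= m.+1)%N -> (size Q <= n.+1)%N ->
  crev (m + n) (P * Q) = crev m P * crev n Q.
Proof.
move=> sP sQ; apply: poly_eq_nonzero => z z0.
rewrite hornerM !crevE //; first by rewrite hornerM rmorphM exprD; ring.
apply: leq_trans (size_polyMleq _ _) _; lia.
Qed.

Lemma crevZ n a P : crev n (a *: P) = a^* *: crev n P.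
Proof.
apply/polyP => i; rewrite coefZ !coef_poly; case: ifP => _; last by rewrite mulr0.
by rewrite coefZ rmorphM.
Qed.

Lemma crev_eq0 n P : (size P <= n.+1)%N -> crev n P = 0 -> P = 0.
Proof.
move=> sP P0; rewrite -(crevK sP) P0; apply/polyP => i.
by rewrite coef_poly !coef0 rmorph0 if_same.
Qed.

Lemma crev_map_conj n P :
  crev n (map_poly Num.conj P) = map_poly Num.conj (crev n P).
Proof.
apply/polyP => i; rewrite [LHS]coef_poly coef_map [RHS]coef_map [in RHS]coef_poly /=.
by case: ifP => // _; rewrite rmorph0.
Qed.

Lemma inv_conj_circle z : `|z| = 1 -> (z^-1)^* = z.
Proof. by move=> z1; rewrite invC_norm z1 expr1n invr1 mul1r conjCK. Qed.

(** A root [x] of [P] satisfies [|x| >= 1]; its reflection [1 / conj x] lies in the open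
disk or coincides with [x], so in both cases [x] is a root of [Q], and the common
linear factor cancels. *)
Lemma outer_factor_unique n P Q : (size P <= n.+1)%N -> (size Q <= n.+1)%N ->
  (forall z, `|z| < 1 -> P.[z] != 0) -> (forall z, `|z| < 1 -> Q.[z] != 0) ->
  P * crev n P = Q * crev n Q -> exists2 k : C, `|k| = 1 & Q = k *: P.
Proof.
have [d] := ubnP (size P); elim: d n P Q => // d IH n P Q szd sP sQ Pnz Qnz PQ.
have P00 : P.[0] != 0 by apply: Pnz; rewrite normr0.
have Q00 : Q.[0] != 0 by apply: Qnz; rewrite normr0.
have P0 : P != 0 by apply: contraNneq P00 => ->; rewrite horner0.
have [szP1|szP1] := leqP (size P) 1.
  have [c PE] : exists c, P = c%:P by exists P`_0; apply: size1_polyC.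
  have c0 : c != 0 by move: P00; rewrite PE hornerC.
  have szQ1 : (size Q <= 1)%N.
    rewrite leqNgt; apply/negP => szQ; have/closed_rootP [x] : size Q != 1 by lia.
    move/rootP => Qx; have x0 : x != 0 by apply: contraNneq Q00 => x0; rewrite -[X in Q.[X]]x0 Qx.
    have := congr1 (horner^~ x) PQ; rewrite !hornerM Qx mul0r crevE // PE !hornerC.
    by apply/eqP; rewrite !mulf_neq0 ?expf_neq0 // conjC_eq0.
  have [q QE] : exists c, Q = c%:P by exists Q`_0; apply: size1_polyC.
  have := congr1 (horner^~ 1) PQ; rewrite !hornerM !crevE ?oner_eq0 //.
  rewrite PE QE !hornerC expr1n !mul1r -!normCK => cq.
  exists (q / c); last by rewrite -mul_polyC -polyCM divfK.
  apply/eqP; rewrite -(@pexpr_eq1 _ _ 2) // ?normr_ge0 //.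
  by rewrite normrM normfV exprMn exprVn cq divff // -cq expf_neq0 // normr_eq0.
have/closed_rootP [x Px] : size P != 1 by lia.
have x1 : 1 <= `|x|.
  by rewrite real_leNgt ?normr_real //; apply/negP => /Pnz; rewrite -rootE Px.
have x0 : x != 0 by rewrite -normr_gt0 (lt_le_trans ltr01).
have Qx : root Q x.
  move: (congr1 (horner^~ x) PQ); rewrite !hornerM (rootP Px) mul0r => /esym/eqP.
  rewrite crevE // !mulf_eq0 expf_eq0 (negPf x0) andbF /= conjC_eq0.
  case/orP => //; move: x1; rewrite le_eqVlt => /predU1P[x1|x1].
    by rewrite inv_conj_circle.
  move=> h; have := Qnz (x^-1)^*; rewrite (eqP h) eqxx norm_conjC normfV.
  by rewrite invf_lt1 ?x1 ?(lt_trans ltr01) // => /(_ isT).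
have [P1 PE] := factor_theorem P x Px; have [Q1 QE] := factor_theorem Q x Qx.
have P10 : P1 != 0 by apply: contraNneq P0 => h; rewrite PE h mul0r.
have Q10 : Q1 != 0.
  by apply: contraNneq Q00 => h; rewrite QE h mul0r horner0.
case: n sP sQ PQ => [|n] sP sQ PQ; first by lia.
have szP : size P = (size P1).+1 by rewrite PE size_Mmonic ?monicXsubC // size_XsubC addn2.
have szQ : size Q = (size Q1).+1 by rewrite QE size_Mmonic ?monicXsubC // size_XsubC addn2.
have sX : (size ('X - x%:P : {poly C})%R <= 2)%N by rewrite size_XsubC.
have [||||||k k1 Qk] := IH n P1 Q1.
- by rewrite -ltnS -szP.
- by rewrite -ltnS -szP.
- by rewrite -ltnS -szQ.
- by move=> z /Pnz; rewrite PE hornerM mulf_eq0 negb_or => /andP[].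
- by move=> z /Qnz; rewrite QE hornerM mulf_eq0 negb_or => /andP[].
- have XX : ('X - x%:P) * crev 1 ('X - x%:P) != 0.
    rewrite mulf_neq0 ?polyXsubC_eq0 //; apply/eqP => /(crev_eq0 sX)/eqP.
    by rewrite polyXsubC_eq0.
  apply: (mulfI XX).
  have cr (A : {poly C}) : (size A <= n.+1)%N ->
      crev n.+1 (A * ('X - x%:P)) = crev n A * crev 1 ('X - x%:P).
    by move=> sA; rewrite -crevM // addn1.
  have : P1 * ('X - x%:P) * (crev n P1 * crev 1 ('X - x%:P)) =
         Q1 * ('X - x%:P) * (crev n Q1 * crev 1 ('X - x%:P)).
    have sP1 : (size P1 <= n.+1)%N by rewrite -ltnS -szP.
    have sQ1 : (size Q1 <= n.+1)%N by rewrite -ltnS -szQ.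
    by rewrite -!cr // -PE -QE.
  move=> E; transitivity (P1 * ('X - x%:P) * (crev n P1 * crev 1 ('X - x%:P))).
    by ring.
  by rewrite E; ring.
by exists k => //; rewrite QE Qk PE scalerAl.
Qed.

(** Fejer-Riesz: the roots of [H] come in pairs [x], [1 / conj x] off the circle, and
the outer root of each pair goes to [P].  Positivity at one point of the circle is
enough to make the last constant a square. *)
Lemma spectral_factor n H : (size H <= (n + n).+1)%N -> crev (n + n) H = H ->
  (forall z, `|z| = 1 -> H.[z] != 0) ->
  (exists2 z, `|z| = 1 & 0 < z ^- n * H.[z]) ->
  exists P, [/\ (size P <= n.+1)%N, forall z, `|z| <= 1 -> P.[z] != 0
              & H = P * crev n P].
Proof.
elim: n H => [|n IH] H sH Hrev Hnz [z0 z01 Hz0].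
  have [c HE] : exists c, H = c%:P by exists H`_0; apply: size1_polyC.
  move: Hz0; rewrite HE expr0 invr1 mul1r hornerC => c0.
  have s0 : sqrtC c != 0 by rewrite sqrtC_eq0 gt_eqF.
  exists (sqrtC c)%:P; split; first by rewrite size_polyC; case: eqP.
    by move=> z _; rewrite hornerC.
  apply: poly_eq_nonzero => z z0'; rewrite hornerM crevE ?size_polyC_leq1 // !hornerC.
  rewrite expr0 mul1r -normCK ger0_norm ?sqrtC_ge0 ?(ltW c0) //.
  by rewrite sqrtCK.
have z00 : z0 != 0 by rewrite -normr_gt0 z01.
have coefH i : (i <= n + n + 2)%N -> H`_i = (H`_(n + n + 2 - i))^*.
  move=> li; rewrite -{1}Hrev coef_poly.
  have -> : (n.+1 + n.+1 = n + n + 2)%N by lia.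
  by rewrite ltnS li.
(* If H(0) = 0 then the top coefficient vanishes as well, and X divides H without
   contributing to P. *)
have [H00|H00] := eqVneq H`_0 0.
  have Htop : H`_(n + n + 2) = 0 by rewrite coefH // subnn H00 rmorph0.
  have HE : H = 'X * drop_poly 1 H.
    apply/polyP => -[|i]; first by rewrite coefXM eqxx.
    by rewrite coefXM /= coef_drop_poly addn1.
  set H1 := drop_poly 1 H in HE.
  have sH1 : (size H1 <= (n + n).+1)%N.
    apply/leq_sizeP => j hj; rewrite coef_drop_poly.
    have [->|hj'] := eqVneq j (n + n).+1.
      by rewrite -[RHS]Htop; congr (_`_ _); lia.
    by rewrite nth_default //; apply: leq_trans sH _; lia.
  have [|||P [sP Pnz PE]] := IH H1 sH1.
  - apply/polyP => i; rewrite coef_poly; case: ltnP => hi; last first.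
      by rewrite nth_default // (leq_trans sH1).
    rewrite !coef_drop_poly [in RHS]coefH ?conjCK; last by lia.
    by congr (Num.conj H`_(_)); lia.
  - move=> z z1; have := Hnz z z1.
    by rewrite HE hornerM mulf_eq0 negb_or => /andP[].
  - exists z0 => //; suff -> : z0 ^- n * H1.[z0] = z0 ^- n.+1 * H.[z0] by [].
    by rewrite HE hornerM hornerX exprS invfM mulrACA mulVf // mul1r.
  exists P; split => //; first by rewrite leqW.
  rewrite HE PE mulrCA; congr (_ * _); apply: poly_eq_nonzero => z nz.
  by rewrite hornerM hornerX !crevE ?exprS ?mulrA // leqW.
have Htop : H`_(n + n + 2) != 0.
  by rewrite coefH // subnn conjC_eq0.
have H0 : H != 0 by apply: contraNneq H00 => ->; rewrite coef0.
have szH : size H = (n + n + 3)%N.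
  apply/eqP; rewrite eqn_leq; apply/andP; split.
    by apply: leq_trans sH _; lia.
  by rewrite leqNgt; apply: contra Htop => h; rewrite nth_default // -ltnS -addnS.
have [x [x1 Hx Hx']] : exists x, [/\ 1 < `|x|, root H x & root H (x^-1)^* ].
  have symm x : root H x -> root H (x^-1)^*.
    move=> Hx; have x0 : x != 0.
      by apply: contraNneq H00 => x0; move: Hx; rewrite x0 rootE horner_coef0.
    move: (Hx); rewrite rootE -{1}Hrev crevE // mulf_eq0 expf_eq0 (negPf x0) andbF.
    by rewrite conjC_eq0 rootE.
  have/closed_rootP [x Hx] : size H != 1 by rewrite szH addn3.
  have x0 : x != 0.
    by apply: contraNneq H00 => x0; move: Hx; rewrite x0 rootE horner_coef0.
  have x0' : 0 < `|x| by rewrite normr_gt0.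
  have : `|x| != 1 by apply/eqP => /Hnz; rewrite -rootE Hx.
  rewrite real_neqr_lt ?normr_real ?real1 // => /orP[x1|x1]; last by exists x; rewrite x1 Hx symm.
  exists (x^-1)^*; split; last by exact: (symm _ (symm _ Hx)).
    by rewrite norm_conjC normfV invf_gt1.
  exact: (symm _ Hx).
have x0 : x != 0 by rewrite -normr_gt0 (lt_trans ltr01).
set y := (x^-1)^* in Hx'.
have xc0 : x^* != 0 by rewrite conjC_eq0.
have crX : crev 1 ('X - x%:P) = - x^* *: ('X - y%:P).
  apply: poly_eq_nonzero => z nz; rewrite crevE ?size_XsubC // !hornerE.
  rewrite rmorphB /= conjCK /y fmorphV.
  by field; rewrite xc0 nz.
have xy : x != y.
  apply/eqP => xy; have := x1; rewrite xy /y norm_conjC normfV invf_gt1 ?normr_gt0 //.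
  by rewrite lt_gtF.
have : \prod_(z <- [:: x; y]) ('X - z%:P) %| H.
  apply: uniq_roots_dvdp; first by rewrite /= Hx Hx'.
  by rewrite uniq_rootsE /= inE xy.
rewrite big_cons big_seq1 => /dvdpP[H1 HE'].
pose A := 'X - x%:P : {poly C}.
have sA : (size A <= 2)%N by rewrite size_XsubC.
have A0 : A != 0 by rewrite polyXsubC_eq0.
have cA0 : crev 1 A != 0 by apply/eqP => /(crev_eq0 sA)/eqP; apply/negP.
have [H2 HE] : exists H2, H = H2 * (A * crev 1 A).
  exists ((- x^*)^-1 *: H1); rewrite HE' /A crX -scalerAl -!scalerAr scalerA.
  by rewrite mulVf ?scale1r // oppr_eq0.
have H20 : H2 != 0 by apply: contraNneq H0 => h; rewrite HE h mul0r.
have sAA : size (A * crev 1 A) = 3%N.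
  by rewrite crX -scalerAr size_scale ?oppr_eq0 // size_Mmonic ?monicXsubC ?polyXsubC_eq0 // !size_XsubC.
have sH2 : (size H2 <= (n + n).+1)%N.
  have AA0 : A * crev 1 A != 0 by rewrite mulf_neq0.
  by move: szH; rewrite HE size_mul // sAA addn3 /= addn3 => -[->].
have [|||P1 [sP Pnz PE]] := IH H2 sH2.
- have crH : crev (n.+1 + n.+1) H = crev (n + n) H2 * (A * crev 1 A).
    have -> : (n.+1 + n.+1 = n + n + (1 + 1))%N by rewrite addSn !addnS addn0.
    rewrite HE crevM ?sAA // crevM ?size_crev // crevK //.
    by rewrite [crev 1 A * A]mulrC.
  by apply: (mulIf (mulf_neq0 A0 cA0)); rewrite -crH Hrev.
- by move=> z z1; have := Hnz z z1; rewrite HE hornerM mulf_eq0 negb_or => /andP[].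
- exists z0 => //; move: Hz0.
  have -> : z0 ^- n.+1 * H.[z0] = z0 ^- n * H2.[z0] * `|A.[z0]| ^+ 2.
    rewrite HE !hornerM crev_circle // normCK exprS invfM expr1.
    by field; rewrite expf_neq0.
  have A20 : 0 < `|A.[z0]| ^+ 2.
    rewrite exprn_gt0 // normr_gt0; have := Hnz _ z01.
    by rewrite HE !hornerM !mulf_eq0 !negb_or => /and3P[].
  by rewrite pmulr_lgt0.
exists (P1 * A); split.
- by apply: leq_trans (size_polyMleq _ _) _; rewrite size_XsubC addn2.
- move=> z z1; rewrite hornerM mulf_neq0 ?Pnz // hornerXsubC subr_eq0.
  by apply: contraTneq z1 => ->; rewrite -real_ltNge ?normr_real ?real1.
- by rewrite -[n.+1]addn1 crevM // HE PE; ring.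
Qed.
End Reversal.

(** * Real outer factors, and w from its disk zeros *)
Section RealFactor.
Variable R : realType.
Local Notation C := R[i].
Local Notation toC := (map_poly (real_complex R)).
Implicit Types (f g w : {poly R}) (z : C).

Lemma size_toC f : size (toC f) = size f.
Proof. exact: size_map_poly. Qed.

Lemma crev_toC n f z : (size f <= n.+1)%N -> z != 0 ->
  (crev n (toC f)).[z] = z ^+ n * ceval f z^-1.
Proof.
by move=> sf z0; rewrite crevE ?size_toC // -/(ceval _ _) [(ceval _ _)^*]ceval_conj conjCK.
Qed.

(** The factor of [f f~ + g g~] normalised by [B(0) > 0] is real: its conjugate is
another factor without zeros in the disk, so uniqueness applies. *)
Lemma real_spectral_factor n f g : (size f <= n.+1)%N -> (size g <= n.+1)%N ->
  (forall z, `|z| = 1 -> (ceval f z != 0) || (ceval g z != 0)) ->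
  exists B : {poly R}, [/\ (size B <= n.+1)%N, 0 < B.[0],
    forall z, `|z| <= 1 -> ceval B z != 0 &
    forall z, z != 0 -> ceval B z * ceval B z^-1 =
      ceval f z * ceval f z^-1 + ceval g z * ceval g z^-1].
Proof.
move=> sf sg fg.
pose H := toC f * crev n (toC f) + toC g * crev n (toC g).
have revM (p : {poly R}) : (size p <= n.+1)%N ->
    crev (n + n) (toC p * crev n (toC p)) = toC p * crev n (toC p).
  by move=> sp; rewrite crevM ?size_crev ?size_toC // crevK ?size_toC // mulrC.
have szM (P : {poly C}) : (size P <= n.+1)%N ->
    (size (P * crev n P)%R <= (n + n).+1)%N.
  move=> sP; apply: leq_trans (size_polyMleq _ _) _.
  have lea (a b : nat) : (a <= n.+1 -> b <= n.+1 -> (a + b).-1 <= (n + n).+1)%N by lia.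
  exact: lea sP (size_crev n P).
have sH : (size H <= (n + n).+1)%N.
  apply: leq_trans (size_polyD _ _) _.
  by rewrite geq_max !szM // size_toC.
have Hz z : `|z| = 1 -> z ^- n * H.[z] = `|ceval f z| ^+ 2 + `|ceval g z| ^+ 2.
  move=> z1; have z0 : z != 0 by rewrite -normr_gt0 z1.
  rewrite hornerD !hornerM !crev_circle ?size_toC // !normCK /ceval.
  by field; rewrite expf_neq0.
have Hpos z : `|z| = 1 -> 0 < z ^- n * H.[z].
  move=> z1; rewrite Hz //; case/orP: (fg z z1) => h.
    by rewrite ltr_pwDl ?exprn_ge0 // exprn_gt0 // normr_gt0.
  by rewrite ltr_wpDl ?exprn_ge0 // exprn_gt0 // normr_gt0.
have [|||P [sP Pnz HE]] := spectral_factor sH.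
- by rewrite crevD !revM.
- by move=> z z1; apply/eqP => h; have := Hpos z z1; rewrite h mulr0 ltxx.
- by exists 1; rewrite ?normr1 //; apply: Hpos; rewrite normr1.
have P00 : P.[0] != 0 by apply: Pnz; rewrite normr0 ler01.
pose k := `|P.[0]| / P.[0].
have k1 : k * k^* = 1.
  by rewrite -normCK normrM normfV normr_id divff ?expr1n // normr_eq0.
have k0 : k != 0 by rewrite mulf_neq0 ?invr_eq0 ?normr_eq0.
pose Q := k *: P.
have QE : H = Q * crev n Q.
  by rewrite /Q crevZ -scalerAl -scalerAr scalerA k1 scale1r.
have Q0 : Q.[0] = `|P.[0]| by rewrite hornerZ divfK.
have Qnz z : `|z| <= 1 -> Q.[z] != 0.
  by move=> z1; rewrite hornerZ mulf_neq0 ?Pnz.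
have sQ : (size Q <= n.+1)%N by rewrite size_scale.
pose Qc := map_poly Num.conj Q.
have QcE z : Qc.[z] = (Q.[z^*])^* by rewrite -horner_map /= conjCK.
have HcE : map_poly Num.conj H = H.
  have conj_toC (p : {poly R}) : map_poly Num.conj (toC p) = toC p.
    by rewrite -map_poly_comp; apply: eq_map_poly => x; apply: real_complex_conj.
  by rewrite rmorphD !rmorphM /= -!crev_map_conj !conj_toC.
have [||||c c1 cE] := @outer_factor_unique _ n Q Qc sQ.
- by rewrite size_map_poly.
- by move=> z /ltW /Qnz.
- by move=> z z1; rewrite QcE conjC_eq0 Qnz // norm_conjC ltW.
- by rewrite crev_map_conj -QE -[LHS]HcE QE rmorphM.
have c11 : c = 1.
  have := congr1 (horner^~ 0) cE; rewrite QcE conjC0 [RHS]hornerZ Q0.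
  rewrite geC0_conj // => /esym; rewrite -[X in _ = X]mul1r.
  by apply: mulIf; rewrite normr_eq0.
have Qreal i : (complex.Re Q`_i)%:C%C = Q`_i.
  rewrite RRe_real // CrealE -coef_map /=.
  by rewrite -/Qc cE c11 scale1r.
pose B : {poly R} := \poly_(i < n.+1) complex.Re Q`_i.
have BE : toC B = Q.
  apply/polyP => i; rewrite coef_map coef_poly /=; case: ltnP => hi.
    exact: Qreal.
  by rewrite nth_default // (leq_trans sQ).
exists B; split.
- exact: size_poly.
- by rewrite -ltcR -ceval0 /ceval BE Q0 normr_gt0.
- by move=> z z1; rewrite /ceval BE Qnz.
move=> z z0; have zn : z ^+ n != 0 by rewrite expf_neq0.
apply: (mulfI zn); rewrite mulrCA -crev_toC ?size_poly // BE.
rewrite /ceval BE -hornerM -QE hornerD !hornerM !crev_toC // /ceval.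
by ring.
Qed.

(** The zeros in [E] are simple, so none is left in the cofactor. *)
Lemma disk_part_factor w (E : seq R) : uniq E -> w != 0 ->
  (forall x, x \in E -> -1 < x < 1 /\ (w^`()).[x] != 0) ->
  (forall z, `|z| < 1 /\ ceval w z = 0 <-> exists2 x, x \in E & z = x%:C%C) ->
  exists2 v, w = root_poly E * v & forall z, `|z| < 1 -> ceval v z != 0.
Proof.
move=> uE w0 hE zE.
have : root_poly E %| w.
  apply: uniq_roots_dvdp; rewrite ?uniq_rootsE //; apply/allP => x xE.
  have [_ /eqP] : `|x%:C%C| < 1 :> C /\ ceval w x%:C%C = 0.
    by apply/zE; exists x.
  by rewrite ceval_real fmorph_eq0 rootE.
case/dvdpP => v wE; exists v => [|z z1]; first by rewrite mulrC.
apply/eqP => vz; have [x xE zx] : exists2 x, x \in E & z = x%:C%C.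
  by apply/zE; split=> //; rewrite wE cevalM vz mul0r.
have [_ /eqP] := hE x xE; apply.
move: vz => /eqP; rewrite zx ceval_real fmorph_eq0 => /eqP vx.
rewrite wE derivM hornerD !hornerM vx mul0r addr0.
suff -> : (root_poly E).[x] = 0 by rewrite mulr0.
by apply/eqP; rewrite -rootE root_prod_XsubC.
Qed.

(** Once the common disk zeros are divided out, both functions are outer with the same
modulus on the circle. *)
Lemma disk_zeros_determine w w' (E : seq R) : uniq E -> 0 < w.[0] -> 0 < w'.[0] ->
  (forall x, x \in E -> -1 < x < 1 /\ (w^`()).[x] != 0) ->
  (forall x, x \in E -> -1 < x < 1 /\ (w'^`()).[x] != 0) ->
  (forall z, `|z| < 1 /\ ceval w z = 0 <-> exists2 x, x \in E & z = x%:C%C) ->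
  (forall z, `|z| < 1 /\ ceval w' z = 0 <-> exists2 x, x \in E & z = x%:C%C) ->
  (forall z, z != 0 -> ceval w z * ceval w z^-1 = ceval w' z * ceval w' z^-1) ->
  w = w'.
Proof.
move=> uE w0 w0' hE hE' zE zE' ww.
have nz (g : {poly R}) : 0 < g.[0] -> g != 0.
  by apply: contraTneq => ->; rewrite horner0 ltxx.
have [v wE vnz] := disk_part_factor uE (nz w w0) hE zE.
have [v' wE' vnz'] := disk_part_factor uE (nz w' w0') hE' zE'.
pose D := root_poly E; pose N := (size D + size v + size v')%N.
have [sD sv sv'] : [/\ (size D <= N.+1)%N, (size v <= N.+1)%N & (size v' <= N.+1)%N].
  by rewrite /N; split; lia.
have D0 : toC D != 0.
  rewrite map_poly_eq0; apply: monic_neq0; apply: monic_prod_XsubC.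
have [|||||k k1 kE] := @outer_factor_unique _ N (toC v) (toC v').
- by rewrite size_toC.
- by rewrite size_toC.
- exact: vnz.
- exact: vnz'.
- have cD : crev N (toC D) != 0.
    apply: contraNneq D0 => h; apply/eqP; apply: crev_eq0 h.
    by rewrite size_toC.
  apply: (mulfI (mulf_neq0 D0 cD)); apply: poly_eq_nonzero => z z0.
  rewrite !hornerM !crev_toC // -!/(ceval _ _).
  have := ww z z0; rewrite wE wE' !cevalM -/D => h.
  transitivity (z ^+ N * z ^+ N *
     (ceval D z * ceval v z * (ceval D z^-1 * ceval v z^-1))); first by ring.
  by rewrite h; ring.
have [v0 v0'] : 0 < v'.[0] * v.[0] /\ v.[0] != 0.
  have := mulr_gt0 w0 w0'; rewrite wE wE' !hornerM mulrACA -expr2 => h.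
  have D02 : 0 < D.[0] ^+ 2.
    rewrite exprn_even_gt0 //; apply: contraTneq w0 => h0.
    by rewrite wE hornerM -/D h0 mul0r ltxx.
  move: h; rewrite -/D pmulr_rgt0 // mulrC => h; split=> //.
  by apply: contraTneq h => ->; rewrite mulr0 ltxx.
have kr : k = (v'.[0] / v.[0])%:C%C.
  have := congr1 (horner^~ 0) kE; rewrite hornerZ -!/(ceval _ _) !ceval0 => h.
  rewrite fmorph_div /= h mulfK // fmorph_eq0 //.
have kpos : 0 < v'.[0] / v.[0].
  have -> : v'.[0] / v.[0] = v'.[0] * v.[0] / v.[0] ^+ 2 by field.
  by rewrite divr_gt0 // exprn_even_gt0.
have k11 : k = 1.
  by rewrite -k1 ger0_norm // kr -[0]/((0 : R)%:C%C) lecR ltW.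
rewrite wE wE'; congr (_ * _); apply: (@map_poly_inj _ _ (real_complex R)).
by rewrite /= kE k11 scale1r.
Qed.
End RealFactor.

(** * Jost solutions as polynomials *)

(** Stripping a site is reading off these three coefficients: the first gives
[a], the second [b], and the third, as the first one for the next site says
that [f2`_0 = a' * f1`_0], gives [a'] up to sign. *)
Lemma three_term_coefs (R : comNzRingType) (a' a b : R) (f0 f1 f2 : {poly R}) :
  a' *: ('X^2 * f2) = ('X^2 - b *: 'X + 1) * f1 - a *: f0 ->
  [/\ f1`_0 = a * f0`_0, f1`_1 = b * f1`_0 + a * f0`_1 &
      a' * f2`_0 = f1`_0 - b * f1`_1 + f1`_2 - a * f0`_2].
Proof.
move=> E; have coefE i := congr1 (fun f : {poly R} => f`_i) E.
split; move: (coefE 0%N) (coefE 1%N) (coefE 2%N);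
  rewrite !coefB mulrDl mulrBl mul1r !coefD !coefN -scalerAl !coefZ !coefXM
    !coefXnM /= => e0 e1 e2.
- by move/esym/eqP: e0; rewrite !mulr0 subr0 add0r subr_eq0 => /eqP.
- by move/esym/eqP: e1; rewrite mulr0 sub0r subr_eq0 addrC subr_eq addrC => /eqP.
- by rewrite e2; ring.
Qed.
Section Jost.
Variable R : realType.
Local Notation C := R[i].
Implicit Types (q : int -> R) (u : nat -> {poly R}) (z : C) (psi : int -> C).

(** What the analysis of the Jost solutions uses about a potential. *)
Definition compact_perturbation (p : nat) q :=
  (forall n, 0 < coef_a q n) /\
  (forall n : int, ~~ (1 <= n <= p%:Z) -> coef_a q n = 1 /\ coef_b q n = 0).

Lemma potentials_compact p nu tau q : potentials p nu tau q -> compact_perturbation p q.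
Proof.
move=> [_ _ qlt q0]; split=> [n|n hn]; first by rewrite /coef_a subr_gt0 qlt.
split; rewrite /coef_a /coef_b q0 ?subr0 //; move: hn; case: nu {q0}; case: tau => /=; lia.
Qed.

(** The Jacobi equation at site [n.+1] for [psi_n = z^n u_n], multiplied by
[z^(1 - n)]. *)
Definition jost_rec (a b : nat -> R) u := forall n,
  a n.+1 *: ('X^2 * u n.+2) = ('X^2 - b n.+1 *: 'X + 1) * u n.+1 - a n *: u n.

Definition jost_poly (p : nat) q u :=
  jost_rec (fun n => coef_a q n) (fun n => coef_b q n) u /\
  forall n, (p < n)%N -> u n = 1.

(** Downward recursion from site [p.+1]; [W k] holds the pair of values at the sites
[p.+1 - k] and [p.+2 - k]. *)
Lemma jost_poly_exists p q : compact_perturbation p q -> exists u, jost_poly p q u.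
Proof.
move=> [apos aout].
pose step k (P : {poly R} * {poly R}) := let n := (p.+1 - k)%N in
  ((coef_a q n.-1)^-1 *: (('X^2 - coef_b q n *: 'X + 1) * P.1
      - coef_a q n *: ('X^2 * P.2)), P.1).
pose fix W k := if k is k'.+1 then step k' (W k') else (1, 1) : {poly R} * {poly R}.
exists (fun n => (W (p.+1 - n)%N).1); split=> [n|n pn]; last first.
  by have -> : (p.+1 - n = 0)%N by lia.
have a0 k : coef_a q k != 0 by rewrite gt_eqF.
have [pn|np] := ltnP p n.
  have -> : (p.+1 - n = 0)%N by lia.
  have -> : (p.+1 - n.+1 = 0)%N by lia.
  have -> : (p.+1 - n.+2 = 0)%N by lia.
  have [-> _] : coef_a q n = 1 /\ coef_b q n = 0 by apply: aout; lia.
  have [-> ->] : coef_a q n.+1 = 1 /\ coef_b q n.+1 = 0 by apply: aout; lia.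
  by rewrite /= !scale1r scale0r subr0 !mulr1 addrK.
pose k := (p - n)%N.
have -> : (p.+1 - n = k.+1)%N by rewrite /k; lia.
have -> : (p.+1 - n.+1 = k)%N by rewrite /k; lia.
have E : (W (p.+1 - n.+2)%N).1 = (W k).2.
  case Ek : k => [|k']; first by have -> : (p.+1 - n.+2 = 0)%N by move: Ek; rewrite /k; lia.
  by have -> : (p.+1 - n.+2 = k')%N by move: Ek; rewrite /k; lia.
rewrite E /= /step.
have -> : (p.+1 - k = n.+1)%N by rewrite /k; lia.
by rewrite /= scalerA divff // scale1r opprB addrC subrK.
Qed.

(** The solution with values [x] and [y] at the sites 0 and 1.  [F k] holds the values
at [k] and [k.+1], and [G k] those at [1 - k] and [- k]. *)
Definition jacobi_path q z (x y : C) (n : int) : C :=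
  let a k := (coef_a q k)%:C%C in let b k := (coef_b q k)%:C%C in
  let fix F (k : nat) := if k is k'.+1 then
     ((F k').2, ((z + z^-1 - b k) * (F k').2 - a k' * (F k').1) / a k) else (x, y) in
  let fix G (k : nat) := if k is k'.+1 then
     ((G k').2, ((z + z^-1 - b (- k'%:Z)) * (G k').2 - a (- k'%:Z) * (G k').1)
        / a (- k%:Z)) else (y, x) in
  match n with Posz k => (F k).1 | Negz k => (G k.+1).2 end.

Lemma jacobi_path_solution q z x y : (forall n, coef_a q n != 0) ->
  jacobi_solution q z (jacobi_path q z x y).
Proof.
move=> a0; have a0' n : (coef_a q n)%:C%C != 0 :> C by rewrite fmorph_eq0.
have solve (c d f g h : C) : d != 0 ->
    c * f + d * (((z + z^-1 - g) * h - c * f) / d) + g * h = (z + z^-1) * h.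
  by move=> d0; rewrite mulrC [d * _]mulrC divfK //; ring.
have solve' (c d f g h : C) : d != 0 ->
    d * (((z + z^-1 - g) * h - c * f) / d) + c * f + g * h = (z + z^-1) * h.
  by move=> d0; rewrite -(solve c d f g h) //; ring.
case=> [[|k]|k].
- have -> : (0%:Z - 1) = Negz 0 by [].
  have -> : (0%:Z + 1) = 1%:Z by [].
  by rewrite /= solve' //; exact: (a0' (-1)).
- have -> : (k.+1%:Z - 1) = k%:Z by lia.
  have -> : (k.+1%:Z + 1) = k.+2%:Z by lia.
  by rewrite /=; apply: solve.
- have -> : Negz k - 1 = Negz k.+1 by lia.
  case: k => [|k].
    have -> : Negz 0 + 1 = 0 by [].
    exact: (solve' _ _ _ _ _ (a0' (Negz 1))).
  have -> : Negz k.+1 + 1 = Negz k by lia.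
  exact: (solve' _ _ _ _ _ (a0' (Negz k.+2))).
Qed.

Lemma wronskian_const q z (f g : int -> C) : jacobi_solution q z f ->
  jacobi_solution q z g -> forall n, wronskian q f g n = wronskian q f g 0.
Proof.
move=> hf hg.
have step n : wronskian q f g n = wronskian q f g (n - 1).
  rewrite /wronskian subrK; have := hf n; have := hg n.
  move: (f (n - 1)) (f n) (f (n + 1)) (g (n - 1)) (g n) (g (n + 1)).
  move: (coef_a q n)%:C%C (coef_a q (n - 1))%:C%C (coef_b q n)%:C%C (z + z^-1).
  move=> a a' b l f' f0 f1 g' g0 g1 Eg Ef.
  have -> : a * (f0 * g1 - g0 * f1) = f0 * (a' * g' + a * g1 + b * g0) -
     g0 * (a' * f' + a * f1 + b * f0) + a' * (f' * g0 - g' * f0) by ring.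
  by rewrite Eg Ef; ring.
elim/int_ind => // n IH.
  by rewrite step -addn1 PoszD addrK IH.
by rewrite -IH [in RHS]step; congr wronskian; lia.
Qed.

Lemma jost_poly_of_initial p q u z psi : (forall n, coef_a q n != 0) -> jost_poly p q u ->
  z != 0 -> jacobi_solution q z psi ->
  psi 0 = ceval (u 0) z -> psi 1 = z * ceval (u 1) z ->
  forall n : nat, psi n%:Z = z ^+ n * ceval (u n) z.
Proof.
move=> a0 [rec _] z0 sol p0 p1.
suff H n : psi n%:Z = z ^+ n * ceval (u n) z /\ psi n.+1%:Z = z ^+ n.+1 * ceval (u n.+1) z.
  by move=> n; case: (H n).
elim: n => [|n [IH0 IH1]]; first by rewrite p0 p1 expr0 mul1r expr1.
split=> //.
have a1 : (coef_a q n.+1)%:C%C != 0 :> C by rewrite fmorph_eq0.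
apply: (mulfI a1).
have := sol n.+1%:Z.
have -> : n.+1%:Z - 1 = n%:Z by lia.
have -> : n.+1%:Z + 1 = n.+2%:Z by lia.
rewrite IH0 IH1 => E.
have := congr1 (fun f => ceval f z) (rec n); rewrite !cevalE => E'.
have -> : (coef_a q n.+1)%:C%C * psi n.+2%:Z =
  (z + z^-1) * (z ^+ n.+1 * ceval (u n.+1) z) - (coef_a q n)%:C%C * (z ^+ n * ceval (u n) z)
  - (coef_b q n.+1)%:C%C * (z ^+ n.+1 * ceval (u n.+1) z) by rewrite -E; ring.
have -> : (coef_a q n.+1)%:C%C * (z ^+ n.+2 * ceval (u n.+2) z) =
  z ^+ n * ((coef_a q n.+1)%:C%C * (z ^+ 2 * ceval (u n.+2) z)) by rewrite !exprS; ring.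
by rewrite E' !exprS; field.
Qed.

Lemma jost_poly_of_tail p q u z psi : (forall n, coef_a q n != 0) -> jost_poly p q u ->
  z != 0 -> jacobi_solution q z psi -> (forall n : int, p%:Z < n -> psi n = z ^ n) ->
  forall n : nat, psi n%:Z = z ^+ n * ceval (u n) z.
Proof.
move=> a0 [rec u1] z0 sol far.
suff H k n : (p < n + k)%N -> psi n%:Z = z ^+ n * ceval (u n) z.
  by move=> n; apply: (H p.+1); rewrite ltn_addl.
elim: k n => [|k IH] n.
  rewrite addn0 => pn; rewrite far ?ltz_nat // u1 // ceval1 mulr1; exact/esym/exprnP.
move=> pnk; have a1 : (coef_a q n)%:C%C != 0 :> C by rewrite fmorph_eq0.
apply: (mulfI a1).
have := sol n.+1%:Z.
have -> : n.+1%:Z - 1 = n%:Z by lia.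
have -> : n.+1%:Z + 1 = n.+2%:Z by lia.
rewrite (IH n.+1) ?(IH n.+2) //; try lia; move=> E.
have := congr1 (fun f => ceval f z) (rec n); rewrite !cevalE => E'.
have -> : (coef_a q n)%:C%C * psi n%:Z =
  (z + z^-1) * (z ^+ n.+1 * ceval (u n.+1) z)
  - (coef_a q n.+1)%:C%C * (z ^+ n.+2 * ceval (u n.+2) z)
  - (coef_b q n.+1)%:C%C * (z ^+ n.+1 * ceval (u n.+1) z) by rewrite -E; ring.
have -> : (coef_a q n.+1)%:C%C * (z ^+ n.+2 * ceval (u n.+2) z) =
  z ^+ n * ((coef_a q n.+1)%:C%C * (z ^+ 2 * ceval (u n.+2) z)) by rewrite !exprS; ring.
by rewrite E' !exprS; field.
Qed.

Lemma jost_minus_01 p q z psi : compact_perturbation p q -> z != 0 ->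
  jacobi_solution q z psi -> (forall n : int, n <= 0 -> psi n = z ^ (- n)) ->
  psi 0 = 1 /\ psi 1 = z^-1.
Proof.
move=> [_ out] z0 sol near.
have p0 : psi 0 = 1 by rewrite near // oppr0 expr0z.
split=> //; have := sol 0; rewrite sub0r add0r near // opprK expr1z p0 !mulr1.
have [-> _] : coef_a q (- 1) = 1 /\ coef_b q (- 1) = 0 by apply: out.
have [-> ->] : coef_a q 0 = 1 /\ coef_b q 0 = 0 by apply: out.
by rewrite !mul1r addr0 => /addrI.
Qed.

Lemma jost_minus_path p q z : compact_perturbation p q -> z != 0 ->
  forall n : int, n <= 0 -> jacobi_path q z 1 z^-1 n = z ^ (- n).
Proof.
move=> [apos out] z0.
have a0 n : coef_a q n != 0 by rewrite gt_eqF.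
have sol := jacobi_path_solution z 1 z^-1 a0.
set psi := jacobi_path _ _ _ _ in sol *.
suff H (k : nat) : psi (- k%:Z) = z ^+ k /\ psi (1 - k%:Z) = z ^+ k * z^-1.
  case=> [[|k]|k] // _.
  by have [] := H k.+1; rewrite NegzE opprK.
elim: k => [|k [IH0 IH1]]; first by rewrite subr0 oppr0 expr0 mul1r.
have -> : 1 - k.+1%:Z = - k%:Z by lia.
split; last by rewrite IH0 exprS mulrAC divff // mul1r.
have := sol (- k%:Z).
have [-> ->] : coef_a q (- k%:Z) = 1 /\ coef_b q (- k%:Z) = 0 by apply: out; lia.
have [-> _] : coef_a q (- k%:Z - 1) = 1 /\ coef_b q (- k%:Z - 1) = 0 by apply: out; lia.
have -> : - k%:Z - 1 = - k.+1%:Z by lia.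
have -> : - k%:Z + 1 = 1 - k%:Z by lia.
rewrite IH0 IH1 !mul1r mul0r addr0 => E.
have -> : psi (- k.+1%:Z) = (z + z^-1) * z ^+ k - z ^+ k * z^-1 by rewrite -E addrK.
by rewrite exprS; ring.
Qed.

Lemma poly_eq_ceval (f g : {poly R}) :
  (forall z, z != 0 -> ceval f z = ceval g z) -> f = g.
Proof.
by move=> fg; apply: (@map_poly_inj _ _ (real_complex R)); apply: poly_eq_nonzero.
Qed.

(** The Wronskians are evaluated at the site 0, where [psi^-] is free. *)
Section Wronskians.
Variables (p : nat) (q : int -> R) (u : nat -> {poly R}).
Hypotheses (cq : compact_perturbation p q) (ju : jost_poly p q u).

Let a0 n : coef_a q n != 0. Proof. by rewrite gt_eqF //; case: cq. Qed.
Let a01 : coef_a q 0 = 1. Proof. by case: cq => _ /(_ 0 isT)[]. Qed.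

Let psip z := jacobi_path q z (ceval (u 0) z) (z * ceval (u 1) z).
Let psim z := jacobi_path q z 1 z^-1.

Let jost_psip : jost_plus p q psip.
Proof.
move=> z z0; have sol := jacobi_path_solution z (ceval (u 0) z) (z * ceval (u 1) z) a0.
split=> // -[n|//] pn.
rewrite /psip (jost_poly_of_initial a0 ju z0 sol) //; case: ju => _ ->; last by rewrite -ltz_nat.
by rewrite ceval1 mulr1.
Qed.

Let jost_psim : jost_minus q psim.
Proof.
move=> z z0; split; first exact: jacobi_path_solution.
exact: (jost_minus_path cq).
Qed.

Lemma is_wP w : is_w p q w <-> w = u 0 - 'X^2 * u 1.
Proof.
split=> [[psi [phi [jp jm wE]]]|->].
  apply: poly_eq_ceval => z z0.
  have [solp farp] := jp z z0; have [solm nearm] := jm z z0.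
  have psiE := jost_poly_of_tail a0 ju z0 solp farp.
  have [m0 m1] := jost_minus_01 cq z0 solm nearm.
  rewrite (wE z 0 z0) /wronskian a01 add0r m0 m1 (psiE 0) (psiE 1) !cevalE.
  by field.
exists psip, psim; split=> // z n z0.
have [solp _] := jost_psip z0; have [solm _] := jost_psim z0.
rewrite (wronskian_const solp solm) /wronskian a01 /= !cevalE.
by field.
Qed.

Lemma is_sP s : is_s p q s <-> 'X * s = u 0 - u 1.
Proof.
split=> [[psi [phi [jp jm sE]]]|E].
  apply: poly_eq_ceval => z z0; have z0' : z^-1 != 0 by rewrite invr_eq0.
  have [solp farp] := jp z z0; have [solm nearm] := jm _ z0'.
  have psiE := jost_poly_of_tail a0 ju z0 solp farp.
  have [m0 m1] := jost_minus_01 cq z0' solm nearm.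
  rewrite !cevalE (sE z 0 z0) /wronskian a01 add0r m0 m1 (psiE 0) (psiE 1).
  by field.
exists psip, psim; split=> // z n z0; have z0' : z^-1 != 0 by rewrite invr_eq0.
have [solp _] := jost_psip z0; have [solm _] := jost_psim z0'.
have solm' : jacobi_solution q z (psim z^-1).
  by move=> k; have := solm k; rewrite invrK [z^-1 + z]addrC.
rewrite (wronskian_const solp solm') /wronskian a01 /=.
have := congr1 (fun f => ceval f z) E; rewrite !cevalE => E'.
by apply: (mulfI z0); rewrite E'; field.
Qed.
End Wronskians.
End Jost.

(** * The direct problem: unitarity, eigenvalues and degrees *)
Section Direct.
Variable R : realType.
Local Notation C := R[i].
Variables (p : nat) (q : int -> R) (u : nat -> {poly R}).
Hypotheses (cq : compact_perturbation p q) (ju : jost_poly p q u).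

Let a (n : nat) := coef_a q n.
Let b (n : nat) := coef_b q n.

Let apos n : 0 < a n. Proof. by case: cq => h _; apply: h. Qed.
Let aneq0 n : a n != 0. Proof. by rewrite gt_eqF. Qed.
Let aout n : (p < n)%N -> a n = 1 /\ b n = 0.
Proof. by move=> pn; case: cq => _; apply; lia. Qed.
Let a_0 : a 0 = 1. Proof. by case: cq => _ /(_ 0 isT)[]. Qed.
Let rec n : a n.+1 *: ('X^2 * u n.+2) = ('X^2 - b n.+1 *: 'X + 1) * u n.+1 - a n *: u n.
Proof. by case: ju => h _; apply: h. Qed.
Let u1 n : (p < n)%N -> u n = 1. Proof. by case: ju => _; apply. Qed.

Lemma jost_descend (P : nat -> Prop) :
  (forall n, (p < n)%N -> P n) -> (forall n, P n.+1 -> P n) -> forall n, P n.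
Proof.
move=> far step; suff H k n : (p < n + k)%N -> P n.
  by move=> n; apply: (H p.+1); rewrite ltn_addl.
elim: k n => [|k IH] n; first by rewrite addn0; apply: far.
by rewrite addnS -addSn => h; apply: step; apply: IH.
Qed.

Lemma jost_coef0 n : (u n.+1)`_0 = a n * (u n)`_0.
Proof. by have [] := three_term_coefs (rec n). Qed.

Lemma jost_coef1 n : (u n.+1)`_1 = b n.+1 * (u n.+1)`_0 + a n * (u n)`_1.
Proof. by have [] := three_term_coefs (rec n). Qed.

Lemma jost_coef2 n : a n.+1 * (u n.+2)`_0 =
  (u n.+1)`_0 - b n.+1 * (u n.+1)`_1 + (u n.+1)`_2 - a n * (u n)`_2.
Proof. by have [] := three_term_coefs (rec n). Qed.

Lemma jost_coef0_gt0 n : 0 < (u n)`_0.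
Proof.
move: n; apply: jost_descend => [n pn|n]; first by rewrite u1 // coef1.
by rewrite jost_coef0 pmulr_rgt0.
Qed.

Lemma jost_wronskian z n : z != 0 ->
  (a n)%:C%C * (z^-1 * ceval (u n) z * ceval (u n.+1) z^-1
      - z * ceval (u n) z^-1 * ceval (u n.+1) z) = z^-1 - z :> C.
Proof.
move=> z0; move: n; apply: jost_descend => [n pn|n <-].
  by rewrite !u1 // ?leqW // !ceval1; have [-> _] := aout pn; rewrite !mulr1 mul1r.
have := congr1 (fun f => ceval f z) (rec n).
have := congr1 (fun f => ceval f z^-1) (rec n); rewrite !cevalE.
move: (ceval (u n) z) (ceval (u n.+1) z) (ceval (u n.+2) z) => f0 f1 f2.
move: (ceval (u n) z^-1) (ceval (u n.+1) z^-1) (ceval (u n.+2) z^-1) => g0 g1 g2.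
move: (a n)%:C%C (a n.+1)%:C%C (b n.+1)%:C%C => a0 a1 b1 Eg Ef.
have -> : a0 * (z^-1 * f0 * g1 - z * g0 * f1) = z^-1 * g1 * (a0 * f0) - z * f1 * (a0 * g0).
  by ring.
have -> : a0 * f0 = (z ^+ 2 - b1 * z + 1) * f1 - a1 * (z ^+ 2 * f2).
  by rewrite Ef; ring.
have -> : a0 * g0 = (z^-1 ^+ 2 - b1 * z^-1 + 1) * g1 - a1 * (z^-1 ^+ 2 * g2).
  by rewrite Eg; ring.
by field.
Qed.

(** Constancy of the Wronskian of [psi^+(z)] and [psi^+(1/z)], evaluated at 0. *)
Lemma unitarity w s : w = u 0 - 'X^2 * u 1 -> 'X * s = u 0 - u 1 ->
  forall z : C, z != 0 -> ceval w z * ceval w z^-1 =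
    ceval s z * ceval s z^-1 - (z - z^-1) ^+ 2.
Proof.
move=> -> sE z z0.
have := congr1 (fun f => ceval f z) sE.
have := congr1 (fun f => ceval f z^-1) sE; rewrite !cevalE => E2 E1.
have -> : ceval s z = (ceval (u 0) z - ceval (u 1) z) / z by rewrite -E1 mulrC mulKf.
have -> : ceval s z^-1 = (ceval (u 0) z^-1 - ceval (u 1) z^-1) * z.
  by rewrite -E2 mulrAC mulVf // mul1r.
have := jost_wronskian 0 z0; rewrite a_0 mul1r => W.
have -> : - (z - z^-1) ^+ 2 = (z^-1 - z) * (z - z^-1) by ring.
by rewrite -W; field.
Qed.

(** Selfadjointness: if [z] is not real, the flux
[a_n (U_{n+1} conj U_n - conj U_{n+1} U_n)] divided by [z - conj z] is positive far to
the right and grows to the left, because [|z| < 1]; a zero of [w] means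
[U_0 = z U_1], for which the same quotient is nonpositive at [n = 0]. *)
Lemma disk_zeros_real w : w = u 0 - 'X^2 * u 1 ->
  forall z : C, `|z| < 1 -> ceval w z = 0 -> exists x : R, z = x%:C%C.
Proof.
move=> -> z z1; rewrite !cevalE => wz.
have [->|z0] := eqVneq z 0; first by exists 0.
have zc0 : z^* != 0 by rewrite conjC_eq0.
pose U n := z ^+ n * ceval (u n) z.
suff zr : z = z^* by apply/complex_realP; rewrite CrealE -zr.
have flux (A B A1 x0 x1 x2 t : C) : A^* = A -> B^* = B -> A1^* = A1 ->
    A1 * (x2 * x1^* - x2^* * x1) = (z - z^* ) * t ->
    A * x0 = (z + z^-1) * x1 - B * x1 - A1 * x2 ->
    A * (x1 * x0^* - x1^* * x0) = (z - z^* ) * (t + (`|z| ^- 2 - 1) * `|x1| ^+ 2).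
  move=> cA cB cA1 tE E; have Ec := congr1 (fun x => x^*) E.
  rewrite !(rmorphM, rmorphB, rmorphD) /= fmorphV cA cB cA1 in Ec.
  rewrite mulrBr mulrCA Ec [x1^* * _]mulrC mulrA E [(z - z^* ) * _]mulrDr -tE !normCK.
  by field; rewrite z0 zc0.
have tE n : exists2 t : C, 0 < t &
    (a n)%:C%C * (U n.+1 * (U n)^* - (U n.+1)^* * U n) = (z - z^* ) * t.
  move: n; apply: jost_descend => [n pn|n [t t0 tE]].
    exists ((z * z^* ) ^+ n); first by rewrite -normCK !exprn_gt0 // normr_gt0.
    have [-> _] := aout pn; rewrite /U !u1 // ?leqW // !ceval1 !mulr1 mul1r.
    by rewrite !rmorphXn !exprS exprMn; ring.
  exists (t + (`|z| ^- 2 - 1) * `|U n.+1| ^+ 2).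
    rewrite ltr_wpDr // mulr_ge0 ?exprn_ge0 // subr_ge0 invf_ge1 ?exprn_gt0 ?normr_gt0 //.
    by rewrite exprn_ile1 // ltW.
  have E := congr1 (fun f => ceval f z) (rec n); rewrite !cevalE in E.
  have E' : (a n)%:C%C * U n = (z + z^-1) * U n.+1 - (b n.+1)%:C%C * U n.+1
      - (a n.+1)%:C%C * U n.+2.
    have -> : (a n)%:C%C * U n = z ^+ n * ((a n)%:C%C * ceval (u n) z) by rewrite /U; ring.
    have -> : (a n)%:C%C * ceval (u n) z = (z ^+ 2 - (b n.+1)%:C%C * z + 1) * ceval (u n.+1) z
       - (a n.+1)%:C%C * (z ^+ 2 * ceval (u n.+2) z) by rewrite E; ring.
    by rewrite /U !exprS; field.
  by apply: flux tE E'; apply: real_complex_conj.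
have [t t0] := tE 0%N; rewrite a_0 mul1r.
have -> : U 0%N = z * U 1%N.
  by move/eqP: wz; rewrite subr_eq0 /U => /eqP; rewrite expr0 expr1 mul1r => ->; ring.
rewrite rmorphM /= => E.
have : (z - z^* ) * (t + `|U 1%N| ^+ 2) = 0.
  by rewrite mulrDr -E normCK; ring.
move/eqP; rewrite mulf_eq0 => /orP[|]; first by rewrite subr_eq0 => /eqP.
by rewrite gt_eqF // ltr_pwDl // exprn_ge0.
Qed.

(** The Wronskian of the Jost solution and its derivative in the spectral variable: it
is [x^(2n)] to the right of [p] and gains [(x^-2 - 1) psi_{n+1}^2] at each step to the left.
At [n = 0] it adds up to a multiple of the sum of the [psi_n(x)^2] over [n >= 1]. *)
Lemma jost_deriv_wronskian x n : x != 0 ->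
  let v k := 'X^k * u k in `|x| < 1 ->
  0 < a n * ((v n).[x] * (v n.+1)^`().[x] - (v n)^`().[x] * (v n.+1).[x]).
Proof.
move=> x0 v x1; have recv k : 'X * (a k *: v k + a k.+1 *: v k.+2 + b k.+1 *: v k.+1) =
    ('X^2 + 1) * v k.+1.
  have -> : a k *: v k = 'X^k * (('X^2 - b k.+1 *: 'X + 1) * u k.+1
      - a k.+1 *: ('X^2 * u k.+2)).
    by rewrite rec opprB addrC subrK -scalerAr.
  by rewrite /v -!mul_polyC !exprS; ring.
have vfar k : (p < k)%N -> v k = 'X^k by move=> pk; rewrite /v u1 // mulr1.
clearbody v; move: n; apply: jost_descend => [n pn|n IH].
  have [-> _] := aout pn; rewrite !vfar ?leqW // mul1r !derivXn !hornerMn !hornerXn.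
  have -> : x ^+ n * (x ^+ n *+ n.+1) - (x ^+ n.-1 *+ n) * x ^+ n.+1 = (x ^+ n) ^+ 2.
    rewrite -[_ *+ n.+1]mulr_natr -[_ *+ n]mulr_natr.
    case: n {pn} => [|n]; first by rewrite !expr0 mulr0 mul0r; ring.
    by rewrite /= -natr1 !exprS; ring.
  by rewrite exprn_even_gt0 // expf_neq0.
have E : x * (a n * (v n).[x] + a n.+1 * (v n.+2).[x] + b n.+1 * (v n.+1).[x]) =
    (x ^+ 2 + 1) * (v n.+1).[x].
  by have := congr1 (fun f => f.[x]) (recv n); rewrite !hornerE.
have E' : a n * (v n).[x] + a n.+1 * (v n.+2).[x] + b n.+1 * (v n.+1).[x] +
    x * (a n * (v n)^`().[x] + a n.+1 * (v n.+2)^`().[x] + b n.+1 * (v n.+1)^`().[x]) =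
    2 * x * (v n.+1).[x] + (x ^+ 2 + 1) * (v n.+1)^`().[x].
  have := congr1 (fun f => f^`().[x]) (recv n).
  rewrite !derivM derivX !derivD !derivZ derivXn derivC /= addr0 !hornerE => ->.
  by rewrite mulr2n; ring.
move: (v n).[x] (v n)^`().[x] (v n.+1).[x] (v n.+1)^`().[x] (v n.+2).[x] (v n.+2)^`().[x]
  (a n) (a n.+1) (b n.+1) IH E E' => f0 g0 f1 g1 f2 g2 a0 a1 b1 IH E E'.
have -> : a0 * (f0 * g1 - g0 * f1) = a1 * (f1 * g2 - g1 * f2) + (x ^- 2 - 1) * f1 ^+ 2.
  apply: (mulfI (expf_neq0 2 x0)).
  have h1 : x * (a0 * f0) = (x ^+ 2 + 1) * f1 - x * (a1 * f2 + b1 * f1) by rewrite -E; ring.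
  have h2 : x ^+ 2 * (a0 * g0) = 2 * x ^+ 2 * f1 + (x ^+ 2 + 1) * x * g1
     - (x ^+ 2 + 1) * f1 - x ^+ 2 * (a1 * g2 + b1 * g1).
    have -> : 2 * x ^+ 2 * f1 + (x ^+ 2 + 1) * x * g1 = x * (2 * x * f1 + (x ^+ 2 + 1) * g1) by ring.
    by rewrite -E' -E; ring.
  have -> : x ^+ 2 * (a0 * (f0 * g1 - g0 * f1)) =
    x * g1 * (x * (a0 * f0)) - f1 * (x ^+ 2 * (a0 * g0)) by ring.
  by rewrite h1 h2; field.
rewrite ltr_wpDr // mulr_ge0 ?sqr_ge0 // subr_ge0 invf_ge1 ?exprn_even_gt0 //.
by rewrite -real_normK ?num_real // exprn_ile1 // ltW.
Qed.

(** At a zero of [w] one has [psi_0 = x psi_1]; then [psi_1 w'] is minus the positive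
quantity of [jost_deriv_wronskian] minus a square, and [x^2 s = (x^2 - 1) psi_1]. *)
Lemma disk_zero_residue w s x : w = u 0 - 'X^2 * u 1 -> 'X * s = u 0 - u 1 ->
  x != 0 -> `|x| < 1 -> w.[x] = 0 -> 0 < s.[x] * w^`().[x].
Proof.
move=> wE sE x0 x1 wx.
have := jost_deriv_wronskian 0 x0 x1; rewrite a_0 mul1r.
set v0 := 'X^0 * u 0; set v1 := 'X^1 * u 1 => W.
have wE' : w = v0 - 'X * v1 by rewrite wE /v0 /v1 expr0 expr1 mul1r mulrA -expr2.
have sv : 'X^2 * s = 'X * v0 - v1.
  by rewrite /v0 /v1 expr0 expr1 mul1r expr2 -mulrA sE mulrBr.
clearbody v0 v1.
have v0E : v0.[x] = x * v1.[x].
  by move: wx; rewrite wE' !hornerE => /eqP; rewrite subr_eq0 => /eqP.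
have sE' : x ^+ 2 * s.[x] = (x ^+ 2 - 1) * v1.[x].
  by move/(congr1 (fun f => f.[x])): sv; rewrite !hornerE v0E => ->; ring.
have x21 : x ^+ 2 < 1.
  by rewrite -real_normK ?num_real // expr_lt1.
have dw : v1.[x] * w^`().[x] < 0.
  rewrite wE' derivB derivM derivX mul1r !hornerE.
  have -> : v1.[x] * (v0^`().[x] - (v1.[x] + x * v1^`().[x])) =
    - (x * v1.[x] * v1^`().[x] - v0^`().[x] * v1.[x] + v1.[x] ^+ 2) by ring.
  by rewrite oppr_lt0 ltr_wpDr ?sqr_ge0 // -v0E.
have x2 : 0 < x ^+ 2 by rewrite exprn_even_gt0.
rewrite -(pmulr_rgt0 _ x2) mulrA sE' -mulrA nmulr_rgt0 // subr_lt0 //.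
Qed.

Section Size.
Variables nu tau : bool.
Hypotheses (hm : (3 <= m_of p nu tau)%N) (pq : potentials p nu tau q).

Let D := (2 * p - tau)%N.

Lemma potential_top_false : tau = false -> a p != 1.
Proof.
move=> t0; case: pq; rewrite t0 subr0 => _ qp _ _.
by rewrite /a /coef_a -subr_eq0 addrAC subrr add0r oppr_eq0.
Qed.

Lemma potential_top_true : tau = true -> a p = 1 /\ b p != 0.
Proof.
move=> t0; case: pq; rewrite t0 => _ qp _ q0; split=> //.
by rewrite /a /coef_a q0 ?subr0 //; lia.
Qed.

Lemma potential_bottom_false : nu = false -> b 1%N != 0.
Proof. by move=> t0; case: pq; rewrite t0. Qed.

Lemma potential_bottom_true : nu = true -> b 1%N = 0 /\ a 1%N != 1.
Proof.
move=> t0; case: pq; rewrite t0 => q1 _ _ q0; split; first by rewrite /b /coef_b q0.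
by rewrite /a /coef_a -subr_eq0 addrAC subrr add0r oppr_eq0.
Qed.

(** From [u_p] on the polynomials are constant; [u_{p-1}] has degree [2 - tau], because of
the top coefficient of the potential, and each further step adds 2.  The truncated
subtraction covers the constant range. *)
Lemma size_jost n : size (u n) = (D - n.*2).+1.
Proof.
have p2 : (1 < p)%N by move: hm; rewrite /m_of; lia.
have recd k : a k *: u k = ('X^2 - b k.+1 *: 'X + 1) * u k.+1 - a k.+1 *: ('X^2 * u k.+2).
  by rewrite rec opprB addrC subrK.
have hD k : (p <= k)%N -> (D - k.*2 = 0)%N by rewrite /D; lia.
have up : u p = (a p)^-1%:P.
  have ap : a p *: u p = 1.
    have [a1 b1] := aout (ltnSn p).
    rewrite recd (u1 (ltnSn p)) (u1 (leqW (ltnSn p))) a1 b1 scale0r subr0 !mulr1.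
    by rewrite scale1r addrAC subrr add0r.
  by rewrite -[LHS]scale1r -(mulVf (aneq0 p)) -scalerA ap alg_polyC.
have far k : (p <= k)%N -> size (u k) = (D - k.*2).+1.
  move=> pk; rewrite hD //; move: pk; rewrite leq_eqVlt => /predU1P[<-|pk].
    by rewrite up size_polyC invr_eq0 aneq0.
  by rewrite u1 // size_poly1.
have quad (c : R) : size ('X^2 - c *: 'X + 1 : {poly R})%R = 3%N /\ 'X^2 - c *: 'X + 1 \is monic.
  have h1 : (size (- (c *: 'X) + 1 : {poly R})%R < size ('X^2 : {poly R})%R)%N.
    rewrite size_polyXn ltnS (leq_trans (size_polyD _ _)) // geq_max size_polyN.
    by rewrite (leq_trans (size_scale_leq _ _)) ?size_polyX // size_poly1.
  by rewrite -addrA size_polyDl // size_polyXn monicE lead_coefDl // lead_coefXn.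
suff near k n0 : (n0 + k.+1 = p)%N -> size (u n0) = (D - n0.*2).+1 /\ (size (u n0.+1) < size (u n0))%N.
  have [/far //|np] := leqP p n; have [] := near (p - n).-1 n _ => //; lia.
elim: k n0 => [|k IH] n0 hn.
  have hn' : n0.+1 = p by lia.
  have szp : size (u p) = 1%N.
    by apply: etrans (far p (leqnn p)) _; rewrite hD.
  suff sz : size (u n0) = (D - n0.*2).+1.
    split=> //; rewrite hn' szp sz; rewrite /D; lia.
  pose f : {poly R} := (1 - a p ^+ 2) *: 'X^2 - b p *: 'X + 1.
  have E : a p *: (a n0 *: u n0) = f.
    have u2 : u n0.+2 = 1 by rewrite u1 // hn'.
    rewrite recd u2 hn' up -[_ * (a p)^-1%:P]mulrC mul_polyC scalerBr scalerA divff //.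
    by rewrite scale1r scalerA -expr2 mulr1 /f scalerBl scale1r; ring.
  rewrite -(@size_scale _ (a n0)) // -(@size_scale _ (a p)) // E /f.
  have sz2 (c : R) : c != 0 -> size (- (c *: 'X) + 1 : {poly R})%R = 2%N.
    move=> c0; rewrite size_polyDl size_polyN size_scale // ?size_polyX //.
    by rewrite size_poly1.
  have le2 (c : R) : (size (- (c *: 'X) + 1 : {poly R})%R < 3)%N.
    rewrite ltnS (leq_trans (size_polyD _ _)) // geq_max size_polyN.
    by rewrite (leq_trans (size_scale_leq _ _)) ?size_polyX // size_poly1.
  case tauE: tau.
    have [ap1 bp0] := potential_top_true tauE; rewrite ap1 expr1n subrr scale0r sub0r.
    by rewrite sz2 // /D tauE; lia.
  have ap1 := potential_top_false tauE.
  have c0 : 1 - a p ^+ 2 != 0 by rewrite subr_eq0 eq_sym sqrp_eq1 ?ltW.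
  by rewrite -addrA size_polyDl size_scale // size_polyXn ?le2 // /D tauE; lia.
have hn' : (n0.+1 + k.+1 = p)%N by rewrite addSn -addnS.
have [sz lt] := IH n0.+1 hn'.
have {}sz1 : size (('X^2 - b n0.+1 *: 'X + 1) * u n0.+1) = (size (u n0.+1)).+2.
  have [s3 mq] := quad (b n0.+1); rewrite size_monicM // ?s3 //.
  by rewrite -size_poly_gt0 sz.
have sz2 : (size (- (a n0.+1 *: ('X^2 * u n0.+2))) < (size (u n0.+1)).+2)%N.
  rewrite size_polyN size_scale // mulrC; have [->|h] := eqVneq (u n0.+2) 0.
    by rewrite mul0r size_poly0.
  by rewrite size_mulXn // addSn addSn !ltnS add0n.
have szn : size (u n0) = (size (u n0.+1)).+2.
  by rewrite -(@size_scale _ (a n0)) // recd size_polyDl sz1.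
split; last by rewrite szn leqW.
rewrite szn sz; rewrite /D; lia.
Qed.
End Size.
End Direct.

(** * The class of scattering data in terms of one polynomial *)
Section Shape.
Variable R : realType.
Local Notation C := R[i].
Local Notation toC := (map_poly (real_complex R)).

Lemma poly_shapeP (f : {poly R}) (k m : nat) :
  (exists (c : R) (zeta : 'I_m -> C), [/\ c != 0, forall n, zeta n != 0
     & toC f = c%:C%C *: ('X^k * \prod_(n < m) ('X - (zeta n)%:P))]) <->
  [/\ size f = (m + k).+1, f`_k != 0 & forall i, (i < k)%N -> f`_i = 0].
Proof.
split=> [[c [zeta [c0 z0 fE]]]|[sf fk f0]].
  have cC0 : c%:C%C != 0 :> C by rewrite fmorph_eq0.
  set P : {poly C} := \prod_(n < m) ('X - (zeta n)%:P) in fE.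
  have szP : size P = m.+1.
    by rewrite /P size_prod_XsubC -[RHS]/(m.+1) /index_enum -enumT size_enum_ord.
  have P0 : P`_0 != 0.
    rewrite -horner_coef0 horner_prod; apply/prodf_neq0 => i _.
    by rewrite hornerXsubC sub0r oppr_eq0.
  have coefs i : (f`_i)%:C%C = c%:C%C * (if (i < k)%N then 0 else P`_(i - k)) :> C.
    by rewrite -coefXnM -coefZ -fE coef_map.
  split.
  - rewrite -(size_toC f) fE size_scale // mulrC size_mulXn ?szP ?addnS 1?addnC //.
    by rewrite -size_poly_gt0 szP.
  - by rewrite -(fmorph_eq0 (real_complex R)) /= coefs ltnn subnn mulf_neq0.
  - by move=> i ik; apply: (@complexI R); rewrite coefs ik mulr0.
set g := drop_poly k f.
have fE : f = 'X^k * g.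
  apply/polyP => i; rewrite coefXnM coef_drop_poly; case: ltnP => [/f0//|ki].
  by rewrite subnK.
have szg : size g = m.+1 by rewrite /g size_drop_poly sf subSn ?leq_addl // addnK.
have g0 : g`_0 != 0 by rewrite coef_drop_poly.
have gn0 : g != 0 by rewrite -size_poly_gt0 szg.
case: (closed_field_poly_normal (toC g)) => rs gE.
have szrs : size rs = m.
  apply: succn_inj; rewrite -szg -(size_toC g) gE size_scale ?size_prod_XsubC //.
  by rewrite lead_coef_eq0 map_poly_eq0.
exists (lead_coef g), (fun i : 'I_m => nth 0 rs i); split.
- by rewrite lead_coef_eq0.
- move=> n; apply: contraNneq g0 => n0.
  have : root (toC g) 0.
    by rewrite gE rootZ ?lead_coef_eq0 ?map_poly_eq0 // root_prod_XsubC -n0 mem_nth ?szrs.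
  by rewrite rootE -/(ceval _ _) ceval0 fmorph_eq0 horner_coef0.
rewrite {1}fE rmorphM /= map_polyXn [RHS]scalerAr; congr (_ * _).
rewrite [LHS]gE lead_coef_map; congr (_ *: _).
by rewrite (big_nth 0) szrs big_mkord.
Qed.

End Shape.

Section Signs.
Variable R : realType.
Implicit Types (K : seq R) (x y : R).

(** Each factor [x - y] with [y] above [x] contributes one sign. *)
Lemma sgr_prod_sub K x : x \notin K ->
  Num.sg (\prod_(y <- K) (x - y)) = (-1) ^+ count (fun y => x < y) K.
Proof.
elim: K => [|y K IH]; first by rewrite big_nil sgr1.
rewrite inE negb_or big_cons sgrM => /andP[xy /IH ->] /=.
rewrite exprD; congr (_ * _); case: ltrgtP xy => // h _.
  by rewrite ltr0_sg // subr_lt0.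
by rewrite gtr0_sg // subr_gt0.
Qed.

Lemma sgr_root_poly K x : x \notin K ->
  Num.sg (root_poly K).[x] = (-1) ^+ count (fun y => x < y) K.
Proof.
move=> xK; rewrite -sgr_prod_sub // horner_prod; congr Num.sg.
by apply: eq_bigr => y _; rewrite hornerXsubC.
Qed.

Lemma sgr_deriv_root_poly K x : uniq K -> x \in K ->
  Num.sg (root_poly K)^`().[x] = (-1) ^+ count (fun y => x < y) K.
Proof.
move=> uK xK; rewrite deriv_root_poly // /root_poly_except -big_filter.
rewrite -/(root_poly _) sgr_root_poly; last by rewrite mem_filter eqxx.
rewrite count_filter; congr (_ ^+ _); apply: eq_count => y /=.
by case: ltrgtP.
Qed.

Lemma count_gt_nth K i : sorted <%R K -> (i < size K)%N ->
  count (fun y => nth 0 K i < y) K = (size K - i.+1)%N.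
Proof.
elim: K i => [|y K IH] [|i] //= yK iK.
  rewrite ltxx add0n subn1 /=; apply/eqP; rewrite -all_count.
  by apply: order_path_min yK; apply: lt_trans.
rewrite subSS -IH ?(path_sorted yK) //; suff -> : (nth 0 K i < y) = false by [].
apply/negbTE; rewrite -leNgt ltW //.
by have /allP := order_path_min lt_trans yK; apply; apply: mem_nth.
Qed.

Lemma nth_lt0 K i : sorted <%R K -> (i < size K)%N ->
  (nth 0 K i < 0) = (i < count (fun x => (x < 0)%R) K)%N.
Proof.
elim: K i => [|y K IH] i //= yK iK; have [y0|y0] := ltP y 0.
  case: i iK => [|i] iK /=; first by rewrite y0.
  by rewrite add1n ltnS IH // (path_sorted yK).
have -> : count (fun x => x < 0) K = 0%N.
  apply/eqP; rewrite -leqn0 leqNgt -has_count; apply/hasPn => x xK.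
  rewrite -leNgt (le_trans y0) // ltW //.
  by have /allP := order_path_min lt_trans yK; apply.
apply/negbTE; rewrite -leNgt; case: i iK => [|i] iK //=.
rewrite (le_trans y0) // ltW //.
by have /allP := order_path_min lt_trans yK; apply; apply: mem_nth.
Qed.

Lemma count_signs K : 0 \notin K ->
  size K = (count (fun x => (x < 0)%R) K + count (fun x => (0 < x)%R) K)%N.
Proof.
elim: K => [|y K IH] //=; rewrite inE negb_or => /andP[y0 /IH ->].
by case: ltrgtP y0 => //= _ _; lia.
Qed.

Lemma signr_absz (j : int) : (-1) ^ j = (-1) ^+ `|j|%N :> R.
Proof. by case: j => n //; rewrite NegzE -exprnN -signr_odd; case: odd; rewrite ?expr1 ?expr0 ?invrN ?invr1. Qed.

Section Labels.
Variables (K : seq R).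
Hypotheses (sK : sorted <%R K) (K0 : 0 \notin K).

Let n := count (fun x => x < 0) K.
Let m := count (fun x => 0 < x) K.

Lemma ZN_index j : ZN K j -> exists i : nat, [/\ (i < size K)%N, zlabel K j = nth 0 K i &
  if 0 < j then (i + 1 = `|j| + n)%N else (i + `|j| = n)%N].
Proof.
rewrite /ZN /zlabel /n_minus /n_plus -/n -/m (count_signs K0) -/n -/m => /andP[jnm j0].
exists (absz (if 0 < j then j - - n%:Z - 1 else j - - n%:Z)).
by split=> //; case h: (0 < j); rewrite ?h; lia.
Qed.

Lemma zlabel_mem j : ZN K j -> zlabel K j \in K.
Proof. by case/ZN_index => i [iK -> _]; apply: mem_nth. Qed.

Lemma zlabel_onto x : x \in K -> exists2 j, ZN K j & zlabel K j = x.
Proof.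
move=> xK; have iK : (index x K < size K)%N by rewrite index_mem.
have xE : nth 0 K (index x K) = x by apply: nth_index.
move: iK xE; set i := index x K; rewrite (count_signs K0) -/n -/m => iK xE.
have [hin|hin] := ltnP i n.
  exists (i%:Z - n%:Z); first by rewrite /ZN /n_minus /n_plus -/n -/m; lia.
  rewrite -xE /zlabel /n_minus -/n; congr nth.
  have -> : (0 < i%:Z - n%:Z) = false by apply/negbTE; rewrite -leNgt; lia.
  by lia.
exists (i%:Z - n%:Z + 1); first by rewrite /ZN /n_minus /n_plus -/n -/m; lia.
rewrite -xE /zlabel /n_minus -/n; congr nth.
have -> : (0 < i%:Z - n%:Z + 1) = true by lia.
by lia.
Qed.

(** Counting the entries of [K] above [z_j] and above 0 shows that the sign [(-1)^j] of
the definition is that of [z_j D'(z_j) D(0)], for the polynomial [D] with roots [K]. *)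
Lemma zlabel_sign j : ZN K j -> 0 < (-1) ^ j * zlabel K j *
  ((root_poly K)^`().[zlabel K j] * (root_poly K).[0]).
Proof.
move=> hj; have [i [iK xE hi]] := ZN_index hj.
have xK := zlabel_mem hj.
have uK := lt_sorted_uniq sK.
rewrite -sgr_gt0 !sgrM sgr_deriv_root_poly // sgr_root_poly // -/m.
rewrite signr_absz {2}xE count_gt_nth // (count_signs K0) -/n -/m.
have iK' : (i < n + m)%N by rewrite -count_signs.
have sgx : Num.sg (zlabel K j) = (-1) ^+ (i < n)%N.
  have := nth_lt0 sK iK; rewrite -xE -/n => <-; case: ltrgtP => [h|h|h] /=.
  - by rewrite expr1 ltr0_sg.
  - by rewrite expr0 gtr0_sg.
  - by move: K0; rewrite -h xK.
rewrite sgx sgrX sgrN1 -!exprD -signr_odd.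
suff -> : odd (`|j| + (i < n) + (n + m - i.+1 + m)) = false by rewrite expr0.
move: hj hi; rewrite /ZN /n_minus /n_plus -/n -/m => /andP[hj j0].
by case: ifP => h hi; case: (ltnP i n) => /= h'; lia.
Qed.
End Labels.

(** This removes the labels from the class.  The condition on [f] at [1 / x] follows
from the one at [x], since the product of the two values is [(x - 1/x)^2 > 0].  The
new form is the one that a function [w = D v] with [w(0) > 0] satisfies when [D] has the
roots [K] and [v] has no zero in the disk: the sign of [v] is that of [D(0)], so
[w'(x)], [w(1)] and [w(-1)] have the signs of [D'(x) D(0)], [D(0)] and [D(0) D(-1)]. *)
Lemma scattering_classP p nu tau (f : {poly R}) K :
  scattering_class p nu tau (f, K) <->
  [/\ [/\ size f = (m_of p nu tau + nu).+1, f`_nu != 0 & forall i, (i < nu)%N -> f`_i = 0],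
      [/\ sorted <%R K, forall x, x \in K -> -1 < x < 1 & 0 \notin K],
      forall x, x \in K -> f.[x] * f.[x^-1] = (x - x^-1) ^+ 2,
      forall x, x \in K -> 0 < f.[x] * (root_poly K)^`().[x] * (root_poly K).[0]
    & 0 <= (root_poly K).[0] * f.[1] /\
      (root_poly K).[0] * (root_poly K).[-1] * f.[-1] <= 0].
Proof.
have ends : sorted <%R K -> (forall x, x \in K -> -1 < x < 1) -> 0 \notin K ->
   (0 <= (-1) ^ n_plus K * f.[1] /\ (-1) ^ n_minus K * f.[-1] <= 0) <->
   (0 <= (root_poly K).[0] * f.[1] /\
      (root_poly K).[0] * (root_poly K).[-1] * f.[-1] <= 0).
  move=> sK aK K0; set m := count (fun x : R => 0 < x) K.
  have s0 : Num.sg (root_poly K).[0] = (-1) ^+ m by rewrite sgr_root_poly.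
  have r0 : 0 < `|(root_poly K).[0]|.
    by rewrite normr_gt0 -rootE root_prod_XsubC.
  have N1 : -1 \notin K by apply/negP => /aK; rewrite ltxx.
  have s1 : Num.sg (root_poly K).[-1] = (-1) ^+ size K.
    rewrite sgr_root_poly //; congr (_ ^+ _); apply/eqP; rewrite -all_count.
    by apply/allP => x /aK/andP[].
  have r1 : 0 < `|(root_poly K).[-1]|.
    by rewrite normr_gt0 -rootE root_prod_XsubC.
  set d0 := (root_poly K).[0] in s0 r0 *; set d1 := (root_poly K).[-1] in s1 r1 *.
  have d0E : d0 = `|d0| * (-1) ^+ m by rewrite -s0 mulrC -numEsg.
  have d1E : d1 = `|d1| * (-1) ^+ size K by rewrite -s1 mulrC -numEsg.
  have e1 : d0 * f.[1] = `|d0| * ((-1) ^ n_plus K * f.[1]).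
    by rewrite {1}d0E -mulrA.
  have e2 : d0 * d1 * f.[-1] = `|d0| * `|d1| * ((-1) ^ n_minus K * f.[-1]).
    have -> : (-1) ^ n_minus K = (-1) ^+ m * (-1) ^+ size K :> R.
      rewrite signr_absz /n_minus abszN absz_nat (count_signs K0) -/m.
      by rewrite exprD mulrCA -exprD addnn -mul2n exprM sqrrN !expr1n mulr1.
    by rewrite {1}d0E {1}d1E; ring.
  by rewrite e1 e2 (pmulr_rge0 _ r0) (pmulr_rle0 _ (mulr_gt0 r0 r1)).
split=> [[/= shape [sK /allP aK K0] zer sgn end_]|[shape [sK aK K0] zer sgn end_]].
  have zer' x : x \in K -> f.[x] * f.[x^-1] = (x - x^-1) ^+ 2.
    move=> /(zlabel_onto sK K0)[j hj <-].
    by have := zer j hj => /eqP; rewrite subr_eq0 => /eqP.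
  split=> //; first exact/poly_shapeP.
    move=> x /(zlabel_onto sK K0)[j hj <-].
    have [s1 _] := sgn j hj; have s2 := zlabel_sign sK K0 hj.
    have := mulr_gt0 s1 s2; set x' := zlabel K j; set c := (-1) ^ j.
    have -> : c * x' * f.[x'] * (c * x' * ((root_poly K)^`().[x'] * (root_poly K).[0])) =
       (c * x') ^+ 2 * (f.[x'] * (root_poly K)^`().[x'] * (root_poly K).[0]) by ring.
    rewrite pmulr_rgt0 // exprn_even_gt0 //= mulf_neq0 //.
      by rewrite /c signr_absz signr_eq0.
    by have xK := zlabel_mem sK K0 hj; apply: contraNneq K0 => <-.
  exact/(ends sK aK K0).
split=> /=.
- exact/poly_shapeP.
- by split=> //; apply/allP.
- by move=> j hj; rewrite zer ?subrr //; apply: (zlabel_mem sK K0 hj).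
- move=> j hj; have xK := zlabel_mem sK K0 hj.
  have s1 := sgn _ xK; have s2 := zlabel_sign sK K0 hj.
  set x := zlabel K j in xK s1 s2 *; set c := (-1) ^ j in s2 *.
  have x0 : x != 0 by apply: contraNneq K0 => <-.
  have s3 : 0 < c * x * f.[x].
    have := mulr_gt0 s1 s2.
    have -> : f.[x] * (root_poly K)^`().[x] * (root_poly K).[0] *
       (c * x * ((root_poly K)^`().[x] * (root_poly K).[0])) =
       ((root_poly K)^`().[x] * (root_poly K).[0]) ^+ 2 * (c * x * f.[x]) by ring.
    rewrite pmulr_rgt0 // exprn_even_gt0 //=.
    by apply/eqP => h; move: s1; rewrite -mulrA h mulr0 ltxx.
  split=> //; have : 0 < (c * x * f.[x]) * (c * x * f.[x^-1]).
    have -> : (c * x * f.[x]) * (c * x * f.[x^-1]) = (c * x) ^+ 2 * (f.[x] * f.[x^-1]) by ring.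
    rewrite zer // mulr_gt0 // exprn_even_gt0 //=.
      by rewrite mulf_neq0 // /c signr_absz signr_eq0.
    rewrite subr_eq0; apply/eqP => xx; have : x ^+ 2 = 1 by rewrite expr2 {2}xx divff.
    move/eqP; rewrite sqrf_eq1; have /andP[h1 h2] := aK x xK.
    by rewrite (lt_eqF h2) gt_eqF.
  by rewrite pmulr_rgt0.
- exact/(ends sK aK K0).
Qed.
End Signs.

(** * Scattering data of a potential, and injectivity *)
Section ScatteringData.
Variable R : realType.
Local Notation C := R[i].

Lemma no_root_sign_closed (g : {poly R}) :
  (forall z : C, `|z| < 1 -> ceval g z != 0) ->
  forall x : R, -1 <= x <= 1 -> 0 <= g.[0] * g.[x].
Proof.
move=> hg x hx; rewrite leNgt; apply/negP => gx.
have [x1|] := boolP (-1 < x < 1).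
  by have := no_root_sign hg x1; rewrite ltNge ltW.
have nz (y : R) : -1 < y < 1 -> g.[y] != 0.
  move=> y1; have := no_root_sign hg y1; apply: contraTneq => ->.
  by rewrite mulr0 ltxx.
have gx0 : g.[x] != 0 by apply: contraTneq gx => ->; rewrite mulr0 ltxx.
have g00 : g.[0] != 0 by apply: nz; rewrite ltrN10 ltr01.
move=> x1; have [y y1 /eqP gy] : exists2 y, (-1 < y < 1) || (y == x) & g.[y] == 0.
  have [x0|x0] := leP 0 x.
  - have [|y /andP[y0 yx]] := @poly_ivt _ (- g.[0] *: g) 0 x x0.
    + by rewrite !hornerZ !mulNr oppr_le0 oppr_ge0 -expr2 sqr_ge0 ltW.
    + rewrite rootZ ?oppr_eq0 // => gy; exists y => //.
      by case: (ltrgtP y x) yx => // yx _; lra.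
  - have [|y /andP[yx y0]] := @poly_ivt _ (g.[0] *: g) x 0 (ltW x0).
    + by rewrite !hornerZ -expr2 sqr_ge0 ltW.
    + rewrite rootZ // => gy; exists y => //.
      by case: (ltrgtP y x) yx => // yx _; lra.
case/orP: y1 => [/nz|/eqP yx]; first by rewrite gy eqxx.
by move: gx0; rewrite -yx gy eqxx.
Qed.

(** A function positive at 0 changes sign in the disk exactly at its zeros there, and
the possible zeros at the end points are harmless for weak inequalities. *)
Lemma end_signs (E : seq R) (v : {poly R}) : (forall x, x \in E -> -1 < x < 1) ->
  (forall z : C, `|z| < 1 -> ceval v z != 0) -> 0 < (root_poly E * v).[0] ->
  0 <= (root_poly E).[0] * (root_poly E * v).[1] /\
  0 <= (root_poly E).[0] * (root_poly E).[-1] * (root_poly E * v).[-1].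
Proof.
move=> hE vnz; rewrite !hornerM; set D := root_poly E => D0v0.
have sign_end x : -1 <= x <= 1 -> 0 <= D.[0] * v.[x].
  move=> x1; have h := no_root_sign_closed vnz x1.
  have := mulr_ge0 (ltW D0v0) h.
  have -> : D.[0] * v.[0] * (v.[0] * v.[x]) = v.[0] ^+ 2 * (D.[0] * v.[x]) by ring.
  rewrite pmulr_rge0 // exprn_even_gt0 //=.
  by apply/eqP => v0; move: D0v0; rewrite v0 mulr0 ltxx.
have m11 : -1 <= 1 :> R by apply: le_trans ler01; rewrite lerN10.
split.
  have D1 : 0 <= D.[1].
    rewrite horner_prod big_seq; apply: prodr_ge0 => x /hE/andP[_ x1].
    by rewrite hornerXsubC subr_ge0 ltW.
  by rewrite mulrCA mulr_ge0 // sign_end // lexx andbT.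
have -> : D.[0] * D.[-1] * (D.[-1] * v.[-1]) = D.[-1] ^+ 2 * (D.[0] * v.[-1]) by ring.
by rewrite mulr_ge0 ?sqr_ge0 // sign_end // lexx.
Qed.

Section Facts.
Variables (p : nat) (nu tau : bool) (q : int -> R) (u : nat -> {poly R}).
Hypotheses (hm : (3 <= m_of p nu tau)%N) (pq : potentials p nu tau q)
  (ju : jost_poly p q u).
Variables (s w : {poly R}) (E : seq R).
Hypotheses (wE : w = u 0 - 'X^2 * u 1) (sE : 'X * s = u 0 - u 1).

Let cq := potentials_compact pq.

Lemma w0_gt0 : 0 < w.[0].
Proof.
by rewrite wE hornerD hornerN hornerM hornerXn expr0n mul0r subr0 horner_coef0 (jost_coef0_gt0 cq ju).
Qed.

Hypothesis zE : disk_zeros w E.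

Lemma disk_zeros_facts : uniq E /\ forall x, x \in E ->
  [/\ -1 < x < 1, x != 0, w.[x] = 0 & 0 < s.[x] * w^`().[x]].
Proof.
case: zE => sorE zer; split; first exact: lt_sorted_uniq sorE.
move=> x xE; have [x1 wx] : `|x%:C%C| < 1 :> C /\ ceval w x%:C%C = 0 by apply/zer; exists x.
have {wx} wx : w.[x] = 0 by move/eqP: wx; rewrite ceval_real fmorph_eq0 => /eqP.
have x0 : x != 0.
  by apply: contraTneq w0_gt0 => h; move: wx; rewrite h => ->; rewrite ltxx.
split=> //; first by rewrite -normC_lt1.
apply: (disk_zero_residue cq ju wE sE) => //.
by rewrite ltr_norml -normC_lt1.
Qed.

Lemma scattering_in_class : scattering_class p nu tau (s, E).
Proof.
have [uE fE] := disk_zeros_facts; have w0 := w0_gt0.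
have E0 : 0 \notin E by apply/negP => /fE[_]; rewrite eqxx.
have wn0 : w != 0 by apply: contraTneq w0 => ->; rewrite horner0 ltxx.
have [v wv vnz] : exists2 v, w = root_poly E * v & forall z : C, `|z| < 1 -> ceval v z != 0.
  apply: disk_part_factor zE.2 => // x /fE[x1 x0 wx sw]; split=> //.
  by apply: contraTneq sw => ->; rewrite mulr0 ltxx.
set D := root_poly E in wv.
have D0v0 : 0 < D.[0] * v.[0] by rewrite -hornerM -wv.
have sz n := size_jost cq ju hm pq n.
have s1 : s.[1] = w.[1].
  have := congr1 (fun f => f.[1]) sE; rewrite wE !hornerE => ->.
  by rewrite expr1n mul1r.
have sN1 : s.[-1] = - w.[-1].
  have := congr1 (fun f => f.[-1]) sE; rewrite wE !(hornerXn, hornerD, hornerN, hornerM, hornerX).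
  by rewrite sqrrN expr1n mul1r => <-; rewrite mulN1r opprK.
apply/scattering_classP; split.
- have coefs i : s`_i = (u 0)`_i.+1 - (u 1)`_i.+1.
    by rewrite -coefB -sE coefXM.
  have n0 : s != 0.
    apply/eqP => s0; move: sE; rewrite s0 mulr0 => /esym/eqP; rewrite subr_eq0 => /eqP u01.
    by have := sz 0%N; rewrite u01 sz; move: hm; rewrite /m_of; lia.
  split.
  + have : size ('X * s) = (2 * p - tau).+1.
      rewrite sE size_polyDl ?size_polyN !sz ?subn0 //.
      by move: hm; rewrite /m_of; lia.
    rewrite mulrC size_mulX // => -[->]; move: hm; rewrite /m_of; lia.
  + rewrite coefs; have c0 := jost_coef0_gt0 cq ju.
    have := jost_coef1 ju 0; have := jost_coef2 ju 0; have := jost_coef0 ju 1.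
    case nuE: nu => /= h0 h2 h1.
      have [b1 a1] := potential_bottom_true pq nuE.
      have -> : (u 0%N)`_2 - (u 1%N)`_2 = (u 1%N)`_0 * (1 - coef_a q 1%N ^+ 2).
        move: h2; rewrite h0 b1 mul0r subr0.
        have [_ out] := cq; have [-> _] := out 0 isT; rewrite mul1r => h2.
        transitivity ((u 1%N)`_0 - ((u 1%N)`_0 + (u 1%N)`_2 - (u 0%N)`_2)); first by ring.
        by rewrite -h2; ring.
      apply: mulf_neq0; first by rewrite gt_eqF.
      by have [apos _] := cq; rewrite subr_eq0 eq_sym sqrp_eq1 ?ltW.
    have b1 := potential_bottom_false pq nuE.
    move: h1; have [_ out] := cq; have [-> _] := out 0 isT; rewrite mul1r => h1.
    have -> : (u 0%N)`_1 - (u 1%N)`_1 = - (coef_b q 1%N * (u 1%N)`_0) by rewrite h1; ring.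
    by rewrite oppr_eq0 mulf_neq0 // gt_eqF.
  + case nuE: nu => // -[|//] _; rewrite coefs.
    have [b1 _] := potential_bottom_true pq nuE.
    have := jost_coef1 ju 0; rewrite b1 mul0r add0r.
    by have [_ out] := cq; have [-> _] := out 0 isT; rewrite mul1r => ->; rewrite subrr.
- by split=> // [|x /fE[]]; first by case: zE.
- move=> x /fE[x1 x0 wx _]; have xC0 : x%:C%C != 0 :> C by rewrite fmorph_eq0.
  have := unitarity cq ju wE sE xC0.
  rewrite -fmorphV !ceval_real wx mul0r -!rmorphM -rmorphB -rmorphXn -rmorphB.
  by move/eqP; rewrite eq_sym fmorph_eq0 subr_eq0 => /eqP.
- move=> x xE; have [x1 x0 wx sw] := fE x xE.
  have h1 := no_root_sign vnz x1.
  have dw : w^`().[x] = D^`().[x] * v.[x].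
    rewrite wv derivM !hornerE; have -> : D.[x] = 0; last by rewrite mul0r addr0.
    by apply/eqP; rewrite -rootE root_prod_XsubC.
  have := mulr_gt0 (mulr_gt0 sw h1) D0v0; rewrite dw.
  have -> : s.[x] * (D^`().[x] * v.[x]) * (v.[0] * v.[x]) * (D.[0] * v.[0]) =
    (v.[0] * v.[x]) ^+ 2 * (s.[x] * D^`().[x] * D.[0]) by ring.
  by rewrite pmulr_rgt0 // exprn_gt0.
- have [] := @end_signs E v (fun x xE => let: And4 h _ _ _ := fE x xE in h) vnz.
    by rewrite -wv.
  by rewrite -wv s1 sN1 => e1 e2; rewrite mulrN oppr_le0.
Qed.
End Facts.

Lemma scattering_data_exists p nu tau (q : int -> R) : (3 <= m_of p nu tau)%N ->
  potentials p nu tau q ->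
  exists2 d : {poly R} * seq R, scattering_data p q d & scattering_class p nu tau d.
Proof.
move=> hm pq; have cq := potentials_compact pq; have [u ju] := jost_poly_exists cq.
pose w := u 0 - 'X^2 * u 1; pose s := drop_poly 1 (u 0%N - u 1%N).
have sE : 'X * s = u 0 - u 1.
  apply/polyP => -[|i]; rewrite coefXM /= ?coef_drop_poly ?addn1 //.
  rewrite coefB (jost_coef0 ju 0); have [_ out] := cq; have [-> _] := out 0 isT.
  by rewrite mul1r subrr.
have w0 := w0_gt0 pq ju (erefl w).
have zE : disk_zeros w (roots w (-1) 1).
  split; first exact: sorted_roots.
  move=> z; split=> [[z1 wz]|[x + ->]].
    have [x zx] := disk_zeros_real cq ju (erefl w) z1 wz.
    exists x => //; rewrite in_roots in_itv /= -normC_lt1 -zx z1 /=; apply/andP; split=> //.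
      by move/eqP: wz; rewrite zx ceval_real fmorph_eq0.
    by apply: contraTneq w0 => ->; rewrite horner0 ltxx.
  rewrite in_roots in_itv /= -normC_lt1 => /and3P[/rootP wx x1 _]; split=> //.
  by rewrite ceval_real wx.
exists (s, roots w (-1) 1); last exact: (scattering_in_class hm pq ju (erefl w) sE zE).
split; first exact/(is_sP cq ju).
by exists w => //; apply/(is_wP cq ju).
Qed.

Lemma scattering_data_unique p nu tau (q : int -> R) d d' : potentials p nu tau q ->
  scattering_data p q d -> scattering_data p q d' -> d = d'.
Proof.
move=> pq; have cq := potentials_compact pq; have [u ju] := jost_poly_exists cq.
case: d => s E; case: d' => s' E' [/= /(is_sP cq ju) sE [w /(is_wP cq ju) wE [soE zE]]].
move=> [/= /(is_sP cq ju) sE' [w' /(is_wP cq ju) wE' [soE' zE']]].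
have ss : s = s'.
  by apply: (mulfI (_ : 'X != 0)); rewrite ?polyX_eq0 // sE.
have ww : w = w' by rewrite wE.
rewrite -ww in zE'; subst s'; congr pair; apply: lt_sorted_eq => // x.
have tr (A B : seq R) :
   (forall z : C, `|z| < 1 /\ ceval w z = 0 <-> exists2 x : R, x \in A & z = x%:C%C) ->
   (forall z : C, `|z| < 1 /\ ceval w z = 0 <-> exists2 x : R, x \in B & z = x%:C%C) ->
   x \in A -> x \in B.
  move=> hA hB xA; have [y yB /(@complexI R) ->] // : exists2 y, y \in B & x%:C%C = y%:C%C :> C.
  by apply/hB/hA; exists x.
by apply/idP/idP; [apply: (tr E E' zE zE') | apply: (tr E' E zE' zE)].
Qed.

Lemma scattering_mapP p nu tau (q : int -> R) d : potentials p nu tau q ->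
  scattering_data p q d -> scattering_map p q = d.
Proof.
move=> pq hd; rewrite /scattering_map; case: xgetP => [x _|nd].
  by move=> hx; apply: scattering_data_unique pq hx hd.
by have := nd d.
Qed.

(** Both potentials have the same [w], hence the same [u_0] and [u_1]; from there on
[three_term_coefs] gives the coefficients site by site. *)
Lemma scattering_data_inj p nu tau (q q' : int -> R) d : (3 <= m_of p nu tau)%N ->
  potentials p nu tau q -> potentials p nu tau q' ->
  scattering_data p q d -> scattering_data p q' d -> q = q'.
Proof.
move=> hm pq pq'; have cq := potentials_compact pq; have [u ju] := jost_poly_exists cq.
have cq' := potentials_compact pq'; have [u' ju'] := jost_poly_exists cq'.
case: d => s E [/= /(is_sP cq ju) sE [w /(is_wP cq ju) wE zE]].
move=> [/= /(is_sP cq' ju') sE' [w' /(is_wP cq' ju') wE' zE']].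
have [uE fE] := disk_zeros_facts pq ju wE sE zE.
have [_ fE'] := disk_zeros_facts pq' ju' wE' sE' zE'.
have neq0 (x y : R) : 0 < x * y -> y != 0.
  by apply: contraTneq => ->; rewrite mulr0 ltxx.
have ww : w = w'.
  apply: (disk_zeros_determine uE (w0_gt0 pq ju wE) (w0_gt0 pq' ju' wE') _ _ zE.2 zE'.2).
  - by move=> x /fE[? _ _ /neq0].
  - by move=> x /fE'[? _ _ /neq0].
  - by move=> z z0; rewrite (unitarity cq ju wE sE z0) (unitarity cq' ju' wE' sE' z0).
have e1 : u 1%N = u' 1%N.
  have nz : ('X^2 - 1 : {poly R}) != 0 by rewrite monic_neq0 // monicXnsubC.
  apply: (mulfI nz).
  have h1 (v : nat -> {poly R}) : ('X^2 - 1) * v 1%N = (v 0%N - v 1%N) - (v 0%N - 'X^2 * v 1%N).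
    by ring.
  by rewrite !h1 -sE -sE' -wE -wE' ww.
have e0 : u 0%N = u' 0%N.
  by apply: (addIr (- u' 1%N)); rewrite -sE' sE e1.
have [apos out] := cq; have [apos' out'] := cq'.
have strip n : [/\ u n = u' n, u n.+1 = u' n.+1 & coef_a q n = coef_a q' n].
  elim: n => [|n [I0 I1 Ia]].
    by split=> //; have [-> _] := out 0 isT; have [-> _] := out' 0 isT.
  have c0 : (u n.+1)`_0 != 0 by rewrite gt_eqF // (jost_coef0_gt0 cq ju).
  have bb : coef_b q n.+1 = coef_b q' n.+1.
    apply: (mulIf c0); have := jost_coef1 ju n; have := jost_coef1 ju' n.
    by rewrite -I0 -I1 Ia => -> /addIr.
  have T : coef_a q n.+1 *: ('X^2 * u n.+2) = coef_a q' n.+1 *: ('X^2 * u' n.+2).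
    by have [r _] := ju; have [r' _] := ju'; rewrite r r' I0 I1 Ia bb.
  have aa : coef_a q n.+1 = coef_a q' n.+1.
    have := congr1 (fun f : {poly R} => f`_2) T; rewrite !coefZ !coefXnM /= subnn.
    rewrite (jost_coef0 ju) (jost_coef0 ju') -I1 !mulrA => /(mulIf c0).
    by move/eqP; rewrite -!expr2 eqrXn2 ?ltW // => /eqP.
  split=> //; apply: (mulfI (_ : 'X^2 != 0)); first by rewrite monic_neq0 // monicXn.
  move: T; rewrite aa => /(congr1 (fun f => (coef_a q' n.+1)^-1 *: f)).
  by rewrite !scalerA mulVf ?gt_eqF // !scale1r.
have aE n : coef_a q n = coef_a q' n.
  case: n => n; first by have [] := strip n.
  have [-> _] : coef_a q (Negz n) = 1 /\ coef_b q (Negz n) = 0 by apply: out; lia.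
  by have [-> _] : coef_a q' (Negz n) = 1 /\ coef_b q' (Negz n) = 0 by apply: out'; lia.
have bE n : coef_b q n = coef_b q' n.
  have [n0|n0] := leP n 0.
    have [_ ->] : coef_a q n = 1 /\ coef_b q n = 0 by apply: out; lia.
    by have [_ ->] : coef_a q' n = 1 /\ coef_b q' n = 0 by apply: out'; lia.
  case: n n0 => [[|n]|n] // _.
  have c0 : (u n.+1)`_0 != 0 by rewrite gt_eqF // (jost_coef0_gt0 cq ju).
  have [I0 I1 Ia] := strip n.
  apply: (mulIf c0); have := jost_coef1 ju n; have := jost_coef1 ju' n.
  by rewrite -I0 -I1 Ia => -> /addIr.
apply/funext => k; have [n [kn|kn]] : exists n, k = 2 * n \/ k = 2 * n - 1.
  have [n kn] : exists n : int, k = 2 * n \/ k = 2 * n - 1.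
    exists ((k + 1) %/ 2)%Z; lia.
  by exists n.
  by have := aE n; rewrite /coef_a -kn => /addrI /oppr_inj.
by have := bE n; rewrite /coef_b -kn.
Qed.
End ScatteringData.

(** * The function w from the data *)
Section OuterFunction.
Variable R : realType.
Local Notation C := R[i].
Implicit Types (f g : {poly R}) (z : C).

Lemma ceval_root_poly (K : seq R) z :
  ceval (root_poly K) z = \prod_(x <- K) (z - x%:C%C).
Proof.
rewrite /ceval rmorph_prod horner_prod; apply: eq_bigr => x _.
by rewrite /= rmorphB /= map_polyX map_polyC hornerXsubC.
Qed.

Lemma ceval_root_poly_eq0 (K : seq R) z :
  ceval (root_poly K) z = 0 <-> exists2 x, x \in K & z = x%:C%C.
Proof.
rewrite ceval_root_poly; split=> [/eqP|[x xK ->]].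
  rewrite prodf_seq_eq0 => /hasP[x xK]; rewrite subr_eq0 => /eqP zx.
  by exists x.
by rewrite (big_rem x) //= subrr mul0r.
Qed.

(** [P] is the greatest common divisor of [f] and [z^2 - 1].  Both terms of
[f f~ + (z^2-1)(z^-2-1)] contain [P P~], and what remains has no zero on the circle. *)
Lemma circle_gcd f : exists P P' f1 : {poly R},
  [/\ P * P' = 'X^2 - 1, f = P * f1, P \is monic /\ P' \is monic,
     forall z, ceval P z = 0 -> z = 1 \/ z = -1 &
     forall z, `|z| = 1 -> (ceval f1 z != 0) || (ceval P' z != 0)].
Proof.
pose s : seq R := [:: 1; -1].
have us : uniq s by rewrite /= inE andbT -subr_eq0 opprK -(natrD _ 1 1) pnatr_eq0.
pose P := root_poly [seq x <- s | root f x].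
pose P' := root_poly [seq x <- s | ~~ root f x].
have : P %| f.
  apply: uniq_roots_dvdp; last by rewrite uniq_rootsE filter_uniq.
  by apply/allP => x; rewrite mem_filter => /andP[].
case/dvdpP => f1 fE; exists P, P', f1.
have ends z (A : pred R) : ceval (root_poly (filter A s)) z = 0 ->
    exists2 x, A x /\ z = x%:C%C & x = 1 \/ x = -1.
  move/ceval_root_poly_eq0 => [x]; rewrite mem_filter => /andP[Ax].
  by rewrite !inE => /orP[/eqP xE|/eqP xE] zx; exists x => //; rewrite xE; [left|right].
split.
- have -> : P * P' = root_poly s by rewrite /P /P' /root_poly !big_filter [RHS](bigID (root f)).
  rewrite /root_poly /s big_cons big_seq1; rewrite polyCN polyC1 opprK; ring.
- by rewrite mulrC.
- by split; apply: monic_prod_XsubC.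
- move=> z /ends[x [_ ->] []->]; first by left.
  by right; rewrite rmorphN.
move=> z _; apply/norP => -[/negPn/eqP f1z /negPn/eqP/ends[x [nfx zx] _]].
have : ceval f z = 0 by rewrite fE cevalM f1z mul0r.
rewrite zx ceval_real => /eqP; rewrite fmorph_eq0 => fx.
by move: nfx; rewrite /= rootE fx.
Qed.

Lemma reflect_linear_factor (x : R) z : x != 0 -> z != 0 ->
  (z - x%:C%C) * (z^-1 - x%:C%C) =
  x%:C%C ^+ 2 * ((z - (x^-1)%:C%C) * (z^-1 - (x^-1)%:C%C)).
Proof.
move=> x0 z0; have xC0 : x%:C%C != 0 :> C by rewrite fmorph_eq0.
by rewrite fmorphV; field; rewrite xC0 z0.
Qed.

(** Moving a root [x] to [1/x] changes the modulus on the circle by a constant. *)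
Lemma reflect_root_poly (K : seq R) z : 0 \notin K -> z != 0 ->
  ceval (root_poly K) z * ceval (root_poly K) z^-1 =
  ((\prod_(x <- K) x)%:C%C) ^+ 2 *
    (ceval (root_poly (map GRing.inv K)) z * ceval (root_poly (map GRing.inv K)) z^-1).
Proof.
move=> + z0; rewrite !ceval_root_poly !big_map; elim: K => [|x K IH].
  by rewrite !big_nil !mulr1 expr1n.
rewrite inE negb_or eq_sym => /andP[x0 /IH {}IH]; rewrite !big_cons.
rewrite mulrACA reflect_linear_factor // IH rmorphM /=.
by ring.
Qed.

(** [P] times the spectral factor of [f1 f1~ + P' P'~] solves the equation for [w] but
has no zero in the disk.  Each [x] in [K] is a zero of the right-hand side, so [1/x]
is a zero of that factor, and reflecting these zeros puts exactly [K] into the disk. *)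
Lemma outer_function f (K : seq R) n : (2 <= n)%N -> size f = n.+1 ->
  uniq K -> (forall x, x \in K -> -1 < x < 1) -> 0 \notin K ->
  (forall x, x \in K -> f.[x] * f.[x^-1] = (x - x^-1) ^+ 2) ->
  exists w P P' B : {poly R},
   [/\ P * P' = 'X^2 - 1, w = P * root_poly K * B, 0 < w.[0], (size w <= n.+1)%N &
   [/\ forall z, `|z| < 1 -> ceval P z != 0,
      forall z, `|z| <= 1 -> ceval B z != 0 &
      forall z, z != 0 -> ceval w z * ceval w z^-1 =
        ceval f z * ceval f z^-1 - (z - z^-1) ^+ 2]].
Proof.
move=> n2 sf uK aK K0 zer.
have [P [P' [f1 [PP' fE [mP mP'] Pz f1P']]]] := circle_gcd f.
have f0 : f != 0 by rewrite -size_poly_gt0 sf.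
have f10 : f1 != 0 by apply: contraNneq f0 => h; rewrite fE h mulr0.
have szPP : (size P + size P' = 4)%N.
  have : size (P * P') = 3%N by rewrite PP' size_XnsubC.
  have P1 : (0 < size P)%N by rewrite size_poly_gt0 monic_neq0.
  rewrite size_monicM ?monic_neq0 //; move: P1; generalize (size P) (size P') => a b; lia.
have szf : (size P + size f1 = n.+2)%N.
  have := sf; rewrite fE size_monicM //.
  have P1 : (0 < size P)%N by rewrite size_poly_gt0 monic_neq0.
  move: P1; generalize (size P) (size f1) => a b; lia.
have P1 : (0 < size P)%N by rewrite size_poly_gt0 monic_neq0.
have P'1 : (0 < size P')%N by rewrite size_poly_gt0 monic_neq0.
pose n1 := (size f1).-1.
have f11 : (0 < size f1)%N by rewrite size_poly_gt0.
have [||//|B [sB B0 Bnz BB]] := @real_spectral_factor R n1 f1 P'.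
- by rewrite /n1 prednK.
- rewrite /n1 prednK //; move: szPP szf P'1 n2.
  by generalize (size P) (size P') (size f1) => a b c; lia.
have Pnz z : ceval P z = 0 -> `|z| = 1.
  by move=> /Pz[->|->]; rewrite ?normrN normr1.
have normK x : x \in K -> `|x%:C%C| < 1 :> C by move=> xK; rewrite normC_lt1 aK.
pose K' := map GRing.inv K.
have uK' : uniq K' by rewrite map_inj_uniq //; apply: invr_inj.
have : root_poly K' %| B.
  apply: uniq_roots_dvdp; last by rewrite uniq_rootsE.
  apply/allP => y /mapP[x xK ->].
  have x0 : x != 0 by apply: contraNneq K0 => <-.
  have xC0 : x%:C%C != 0 :> C by rewrite fmorph_eq0.
  have x1 := normK x xK.
  have Bx : ceval B x%:C%C != 0 by rewrite Bnz // ltW.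
  have Px : ceval P x%:C%C * ceval P (x%:C%C)^-1 != 0.
    apply: mulf_neq0; apply/eqP => /Pnz h; first by move: x1; rewrite h ltxx.
    by move/eqP: h; rewrite normfV invr_eq1 lt_eqF.
  have : ceval B x%:C%C * ceval B (x%:C%C)^-1 = 0.
    apply: (mulfI Px); rewrite mulr0 BB // mulrDr.
    have e1 : ceval P x%:C%C * ceval P (x%:C%C)^-1 * (ceval P' x%:C%C * ceval P' (x%:C%C)^-1)
       = (x%:C%C ^+ 2 - 1) * ((x%:C%C)^-1 ^+ 2 - 1).
      by rewrite mulrACA -!cevalM PP' !cevalE.
    have e2 : ceval P x%:C%C * ceval P (x%:C%C)^-1 * (ceval f1 x%:C%C * ceval f1 (x%:C%C)^-1)
       = (x%:C%C - (x%:C%C)^-1) ^+ 2.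
      rewrite mulrACA -!cevalM -fE -fmorphV !ceval_real -rmorphM zer //.
      by rewrite rmorphXn rmorphB.
    by rewrite e1 e2; field.
  move/eqP; rewrite mulf_eq0 (negPf Bx) /= -fmorphV ceval_real fmorph_eq0.
  by rewrite rootE.
case/dvdpP => B1 BE.
pose pK := \prod_(x <- K) x.
have pK0 : pK != 0.
  by rewrite /pK prodf_seq_neq0; apply/allP => x xK; apply: contraNneq K0 => <-.
pose w1 := P * root_poly K * B1.
have w10 : w1.[0] != 0.
  rewrite -(fmorph_eq0 (real_complex R)) /= -ceval0 !cevalM !mulf_neq0 //.
  - by apply/eqP => /Pnz; rewrite normr0 => /eqP; rewrite eq_sym oner_eq0.
  - apply/eqP => /ceval_root_poly_eq0[x xK] /esym/eqP; rewrite fmorph_eq0 => /eqP x0.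
    by move: K0; rewrite -x0 xK.
  - have := Bnz 0; rewrite normr0 ler01 => /(_ isT).
    by rewrite BE cevalM mulf_eq0 negb_or => /andP[].
pose c := Num.sg w1.[0] / `|pK|.
have c0 : c != 0 by rewrite mulf_neq0 ?sgr_eq0 // invr_eq0 normr_eq0.
have c2 : c ^+ 2 = pK ^- 2.
  rewrite /c exprMn exprVn real_normK ?num_real // -[X in _ = X]mul1r; congr (_ * _).
  by rewrite sqr_sg w10.
exists (P * root_poly K * (c *: B1)), P, P', (c *: B1); split=> //.
- rewrite -scalerAr -/w1 hornerZ /c mulrAC -normrEsg.
  by rewrite divr_gt0 // normr_gt0.
- have szB1 : (size B1 + size K <= size f1)%N.
    have B10 : B1 != 0 by apply: contraNneq w10 => h; rewrite /w1 h mulr0 horner0.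
    have := sB; rewrite {1}BE size_Mmonic ?monic_prod_XsubC // size_prod_XsubC size_map.
    by rewrite addnS /= /n1 prednK.
  rewrite -scalerAr size_scale // -mulrA.
  have h : (size (root_poly K * B1)%R <= size f1)%N.
    apply: leq_trans (size_polyMleq _ _) _; rewrite size_prod_XsubC addSn /=.
    by rewrite addnC.
  apply: leq_trans (size_polyMleq _ _) _.
  by rewrite -subn1 leq_subLR add1n -szf leq_add2l.
split.
- by move=> z z1; apply/eqP => /Pnz h; move: z1; rewrite h ltxx.
- move=> z z1; rewrite cevalZ mulf_neq0 // ?fmorph_eq0 //.
  by have := Bnz z z1; rewrite BE cevalM mulf_eq0 negb_or => /andP[].
move=> z z0; rewrite !cevalM !cevalZ.
have -> : ceval P z * ceval (root_poly K) z * (c%:C%C * ceval B1 z) *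
  (ceval P z^-1 * ceval (root_poly K) z^-1 * (c%:C%C * ceval B1 z^-1)) =
  c%:C%C ^+ 2 * (ceval (root_poly K) z * ceval (root_poly K) z^-1) *
  (ceval P z * ceval P z^-1) * (ceval B1 z * ceval B1 z^-1) by ring.
have cpK : c%:C%C ^+ 2 * (\prod_(x <- K) x)%:C%C ^+ 2 = 1 :> C.
  by rewrite -!rmorphXn -rmorphM c2 mulVf ?expf_neq0.
rewrite reflect_root_poly // [c%:C%C ^+ 2 * (_ * _)]mulrA cpK mul1r.
have -> : ceval (root_poly (map GRing.inv K)) z * ceval (root_poly (map GRing.inv K)) z^-1
    * (ceval P z * ceval P z^-1) * (ceval B1 z * ceval B1 z^-1) =
   ceval P z * ceval P z^-1 * (ceval B z * ceval B z^-1).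
  by rewrite BE !cevalM; ring.
rewrite BB // fE mulrDr !cevalM.
have -> : ceval P z * ceval P z^-1 * (ceval P' z * ceval P' z^-1) =
   (z ^+ 2 - 1) * (z^-1 ^+ 2 - 1).
  by rewrite mulrACA -!cevalM PP' !cevalE.
by field.
Qed.

(** At 1 and -1 the equation for [w] only gives [w^2 = f^2]; the sign conditions decide
between the two roots. *)
Lemma outer_function_ends f w v (K : seq R) : w = root_poly K * v -> 0 < w.[0] ->
  (forall x, x \in K -> -1 < x < 1) ->
  (forall z, `|z| < 1 -> ceval v z != 0) ->
  (forall z, z != 0 -> ceval w z * ceval w z^-1 =
        ceval f z * ceval f z^-1 - (z - z^-1) ^+ 2) ->
  0 <= (root_poly K).[0] * f.[1] ->
  (root_poly K).[0] * (root_poly K).[-1] * f.[-1] <= 0 ->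
  w.[1] = f.[1] /\ w.[-1] = - f.[-1].
Proof.
move=> wE w0 aK vnz uni f1 fN1.
have [|w1 wN1] := end_signs aK vnz; first by rewrite -wE.
rewrite -wE in w1 wN1.
set D := root_poly K in wE f1 fN1 w1 wN1.
have sq (x : R) : x ^+ 2 = 1 -> w.[x] ^+ 2 = f.[x] ^+ 2.
  move=> x2; have xV : x^-1 = x by apply: (mulfI (_ : x != 0)); rewrite -?expr2 ?x2 ?divff //;
    apply: contraTneq (oner_neq0 R) => x0; rewrite -x2 x0 expr0n eqxx.
  have x0 : x%:C%C != 0 :> C.
    by rewrite fmorph_eq0; apply: contraTneq (oner_neq0 R) => x0; rewrite -x2 x0 expr0n eqxx.
  have := uni _ x0; rewrite -fmorphV xV subrr expr0n subr0 !ceval_real -!rmorphM.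
  by move/(@complexI R); rewrite !expr2.
have D0 : D.[0] != 0 by apply: contraTneq w0 => h; rewrite wE hornerM h mul0r ltxx.
have DN1 : D.[-1] != 0.
  by rewrite -rootE root_prod_XsubC; apply/negP => /aK; rewrite ltxx.
have cmp (k x y : R) : k != 0 -> 0 <= k * x -> 0 <= k * y -> x ^+ 2 = y ^+ 2 -> x = y.
  move=> k0 kx ky xy; apply: (mulfI k0); apply/eqP.
  by rewrite -(@eqrXn2 _ 2 _ _ isT kx ky) // !exprMn xy.
split; first by apply: (cmp D.[0]) => //; rewrite sq ?expr1n.
apply: (cmp (D.[0] * D.[-1])) => //; first by rewrite mulf_neq0.
  by rewrite mulrN oppr_ge0.
by rewrite sqrrN sq // sqrrN expr1n.
Qed.
End OuterFunction.

(** * Layer stripping *)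
Section Stripping.
Variable R : realType.
Local Notation C := R[i].
Local Notation toC := (map_poly (real_complex R)).
Implicit Types (t : {poly R}).

(** [strip_alpha], [strip_beta] play the roles of [a_{n-1}^2] and [b_n] for the monic
normalisation [t_n = a_0 ... a_{n-1} u_n], for which only squares of the [a_n] appear. *)
Definition strip_alpha t t' := t'`_0 / t`_0.
Definition strip_beta t t' := (t'`_1 - strip_alpha t t' * t`_1) / t'`_0.
Definition strip_next t t' :=
  drop_poly 2 (('X^2 - strip_beta t t' *: 'X + 1) * t' - strip_alpha t t' *: t).

Lemma strip_nextE t t' : t`_0 != 0 -> t'`_0 != 0 ->
  'X^2 * strip_next t t' =
    ('X^2 - strip_beta t t' *: 'X + 1) * t' - strip_alpha t t' *: t.
Proof.
move=> h h'; apply/polyP => i; rewrite coefXnM /strip_next coef_drop_poly.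
case: ltnP => [|i2]; last by rewrite subnK.
case: i => [|[|//]] _; rewrite coefB mulrDl mulrBl mul1r !coefD coefN -scalerAl
   !coefZ coefXM !coefXnM /=.
  by rewrite /strip_alpha divfK //; ring.
by rewrite /strip_beta divfK //; ring.
Qed.

Section Sequence.
Variables (t0 t1 : {poly R}).

Fixpoint strip_pair n := if n is k.+1 then
  ((strip_pair k).2, strip_next (strip_pair k).1 (strip_pair k).2) else (t0, t1).
Definition strip n := (strip_pair n).1.
Definition alpha n := strip_alpha (strip n) (strip n.+1).
Definition beta n := strip_beta (strip n.-1) (strip n).

(** The Jost solution from the left in the same normalisation,
[psi^-_n = z^-n adjoint_n / (a_0 ... a_{n-1})]. *)
Fixpoint adjoint_pair n : {poly R} * {poly R} := if n is k.+1 then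
  ((adjoint_pair k).2, ('X^2 - beta k.+1 *: 'X + 1) * (adjoint_pair k).2
     - alpha k *: ('X^2 * (adjoint_pair k).1)) else (1, 1).
Definition adjoint n := (adjoint_pair n).1.

Lemma strip_rec n : (strip n)`_0 != 0 -> (strip n.+1)`_0 != 0 ->
  'X^2 * strip n.+2 = ('X^2 - beta n.+1 *: 'X + 1) * strip n.+1 - alpha n *: strip n.
Proof. by move=> h h'; apply: strip_nextE. Qed.

Lemma adjoint_rec n : adjoint n.+2 =
  ('X^2 - beta n.+1 *: 'X + 1) * adjoint n.+1 - alpha n *: ('X^2 * adjoint n).
Proof. by []. Qed.

Variables (w f P P' B : {poly R}) (K : seq R).
Hypotheses (PP' : P * P' = 'X^2 - 1) (wE : w = P * root_poly K * B) (w0 : 0 < w.[0])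
  (Pnz : forall z : C, `|z| < 1 -> ceval P z != 0)
  (Bnz : forall z : C, `|z| <= 1 -> ceval B z != 0)
  (uK : uniq K) (aK : forall x, x \in K -> -1 < x < 1) (K0 : 0 \notin K)
  (sgn : forall x, x \in K -> 0 < f.[x] * (root_poly K)^`().[x] * (root_poly K).[0])
  (uni : forall z : C, z != 0 -> ceval w z * ceval w z^-1 =
        ceval f z * ceval f z^-1 - (z - z^-1) ^+ 2)
  (wt : w = t0 - 'X^2 * t1) (ft : 'X * f = t0 - t1).

(** Three solutions of a second-order recursion are linearly dependent: here
[psi^-(1/z)], [psi^-(z)] and [psi^+(z)], with the Wronskians [w], [s] and [z - 1/z] as
coefficients. *)
Definition strip_identity n := forall z : C, z != 0 ->
  ceval w z * ceval (adjoint n) z^-1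
    - z ^+ 3 * (z^-1 ^+ n) ^+ 2 * ceval f z * ceval (adjoint n) z
  = (1 - z ^+ 2) * ceval (strip n) z.

Let circ (z : C) : `|z| = 1 ->
  `|ceval w z| ^+ 2 = `|ceval f z| ^+ 2 + `|z ^+ 2 - 1| ^+ 2.
Proof.
move=> z1; have z0 : z != 0 by rewrite -normr_gt0 z1.
rewrite !normCK rmorphB rmorphXn rmorph1 /= !ceval_conj unit_conj // uni //.
by field.
Qed.

Let strip_gt0_of_identity n : strip_identity n -> (adjoint n).[0] = 1 -> 0 < (strip n).[0].
Proof.
move=> idn y0; apply: (stripped_coef_gt0 PP' wE w0 Pnz Bnz uK _ sgn circ idn y0).
by move=> x xK; split; [apply: aK | apply: contraNneq K0 => <-].
Qed.

(** The identity and [adjoint_n(0) = 1] propagate by linearity, but the recursion for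
[strip] is valid only as long as the previous values at 0 do not vanish, which is what
[stripped_coef_gt0] provides; hence one induction for the three facts. *)
Lemma strip_invariant n : [/\ 0 < (strip n).[0], strip_identity n & (adjoint n).[0] = 1].
Proof.
have id0 : strip_identity 0.
  move=> z z0; have := congr1 (fun g => ceval g z) ft; rewrite wt !cevalE => E.
  rewrite expr0 expr1n !mulr1.
  have -> : z ^+ 3 * ceval f z = z ^+ 2 * (z * ceval f z) by ring.
  by rewrite E; ring.
have id1 : strip_identity 1.
  move=> z z0; have := congr1 (fun g => ceval g z) ft; rewrite wt !cevalE => E.
  rewrite expr1 !mulr1.
  have -> : z ^+ 3 * z^-1 ^+ 2 * ceval f z = z * ceval f z by field.
  by rewrite E; ring.
suff: [/\ 0 < (strip n).[0], strip_identity n & (adjoint n).[0] = 1] /\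
  [/\ 0 < (strip n.+1).[0], strip_identity n.+1 & (adjoint n.+1).[0] = 1] by case.
elim: n => [|n [[p0 i0 y0] [p1 i1 y1]]].
  by split; split=> //; rewrite ?hornerC //; apply: strip_gt0_of_identity => //; rewrite hornerC.
split=> //.
have rec := strip_rec (_ : (strip n)`_0 != 0) (_ : (strip n.+1)`_0 != 0).
rewrite -!horner_coef0 !gt_eqF // in rec; have {}rec := rec isT isT.
have y2 : (adjoint n.+2).[0] = 1.
  rewrite adjoint_rec hornerD hornerN hornerM hornerZ hornerM hornerXn y1 !hornerE.
  by rewrite expr0n /= !(mulr0, mul0r, oppr0, addr0, subr0, add0r).
have i2 : strip_identity n.+2.
  move=> z z0; apply: (mulfI (expf_neq0 2 z0)).
  have E := congr1 (fun g => ceval g z) rec; rewrite !cevalE in E.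
  rewrite [RHS]mulrCA E.
  rewrite adjoint_rec !cevalE.
  have := i0 z z0; have := i1 z z0.
  rewrite [z^-1 ^+ n.+1]exprS [z^-1 ^+ n.+2]exprS [z^-1 ^+ n.+1]exprS.
  move: (ceval (adjoint n) z) (ceval (adjoint n) z^-1) (ceval (adjoint n.+1) z)
    (ceval (adjoint n.+1) z^-1) (z^-1 ^+ n) (ceval (strip n) z) (ceval (strip n.+1) z).
  move=> a0 b0 a1 b1 zn s0 s1 E1 E0.
  transitivity ((z ^+ 2 - (beta n.+1)%:C%C * z + 1) * ((1 - z ^+ 2) * s1)
     - (alpha n)%:C%C * ((1 - z ^+ 2) * s0)); last by ring.
  by rewrite -E1 -E0; field.
by split=> //; apply: strip_gt0_of_identity.
Qed.

Lemma strip_coef0_gt0 n : 0 < (strip n)`_0.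
Proof. by rewrite -horner_coef0; case: (strip_invariant n). Qed.

Let s0 n : (strip n)`_0 != 0. Proof. by rewrite gt_eqF // strip_coef0_gt0. Qed.

Lemma alpha_gt0 n : 0 < alpha n.
Proof. by rewrite divr_gt0 // strip_coef0_gt0. Qed.

Lemma alpha0 : alpha 0 = 1.
Proof.
rewrite /alpha /strip_alpha /strip /=.
have := congr1 (fun g : {poly R} => g`_0) ft; rewrite coefXM coefB /= => /esym/eqP.
by rewrite subr_eq0 => /eqP ->; rewrite divff //; apply: (s0 1).
Qed.

Lemma strip_wronskian n : exists2 k : R, k = \prod_(i < n) alpha i &
  forall z : C, z != 0 ->
  z^-1 * ceval (strip n) z * ceval (strip n.+1) z^-1
   - z * ceval (strip n) z^-1 * ceval (strip n.+1) z = k%:C%C * (z^-1 - z).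
Proof.
exists (\prod_(i < n) alpha i) => // z z0; elim: n => [|n IH].
  rewrite big_ord0 mul1r /strip /=.
  have [z2|z2] := eqVneq (z - z^-1) 0.
    have zz : z^-1 = z by apply/eqP; rewrite eq_sym -subr_eq0 z2.
    by rewrite zz; ring.
  have E1 := congr1 (fun g => ceval g z) ft.
  have E2 := congr1 (fun g => ceval g z^-1) ft; rewrite !cevalE in E1 E2.
  have := uni z0; rewrite wt !cevalE.
  have -> : ceval f z * ceval f z^-1 = (z * ceval f z) * (z^-1 * ceval f z^-1).
    by field.
  rewrite E1 E2 => h; apply: (mulfI z2).
  have -> : (z - z^-1) * (z^-1 - z) = - (z - z^-1) ^+ 2 by ring.
  have -> : - (z - z^-1) ^+ 2 = (ceval t0 z - z ^+ 2 * ceval t1 z) *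
     (ceval t0 z^-1 - z^-1 ^+ 2 * ceval t1 z^-1) -
     (ceval t0 z - ceval t1 z) * (ceval t0 z^-1 - ceval t1 z^-1) by rewrite h; ring.
  by field.
rewrite big_ord_recr rmorphM [RHS]mulrAC -IH.
have E1 := congr1 (fun g => ceval g z) (strip_rec (s0 n) (s0 n.+1)).
have E2 := congr1 (fun g => ceval g z^-1) (strip_rec (s0 n) (s0 n.+1)).
rewrite !cevalE in E1 E2.
have -> : ceval (strip n.+2) z = z ^- 2 * (z ^+ 2 * ceval (strip n.+2) z) by field.
have -> : ceval (strip n.+2) z^-1 = z ^+ 2 * (z^-1 ^+ 2 * ceval (strip n.+2) z^-1) by field.
rewrite E1 E2; by field.
Qed.

Let toC0 t : t`_0 != 0 -> (toC t)`_0 != 0.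
Proof. by move=> h; rewrite coef_map fmorph_eq0. Qed.

Lemma size_crev_full N (t : {poly C}) : t`_0 != 0 -> size (crev N t) = N.+1.
Proof.
move=> h; apply/eqP; rewrite eqn_leq size_crev /=.
rewrite leqNgt; apply/negP => h'; have := nth_default 0 (_ : (size (crev N t) <= N)%N).
rewrite -ltnS => /(_ h') /eqP; rewrite coef_poly ltnSn subnn conjC_eq0.
by apply/negP.
Qed.

(** Multiplied by [z^(N+1)], the Wronskian relation equates
[z^N - z^(N+2)], up to a constant, with a difference of two products of degrees
[d + N] and [e + N + 2], where [d] and [e] are the degrees of the two consecutive
polynomials.  Either these degrees agree, so that [e = d - 2], or the larger one is
[N + 2], and this leaves only [e = 0] and [d < 2]. *)
Lemma size_strip_step n : (size (strip n.+1)).-1 = ((size (strip n)).-1 - 2)%N.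
Proof.
have [k kE W] := strip_wronskian n.
have k0 : k != 0 by rewrite kE; apply/prodf_neq0 => i _; rewrite gt_eqF ?alpha_gt0.
set A := strip n; set A' := strip n.+1.
have sA : (0 < size A)%N by rewrite size_poly_gt0; apply: contraNneq (s0 n) => h; rewrite -/A h coef0.
have sA' : (0 < size A')%N by rewrite size_poly_gt0; apply: contraNneq (s0 n.+1) => h; rewrite -/A' h coef0.
pose N := (size A + size A')%N.
have [leA leA'] : (size A <= N.+1)%N /\ (size A' <= N.+1)%N.
  by rewrite /N -addSn; split; [rewrite leqW // leq_addr | rewrite leq_addl].
have E : toC A * crev N (toC A') - 'X^2 * crev N (toC A) * toC A' =
   k%:C%C *: ('X^N - 'X^(N.+2)).
  apply: poly_eq_nonzero => z z0.
  rewrite hornerD hornerN !hornerM hornerZ hornerD hornerN !hornerXn !crev_toC //.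
  rewrite -!/(ceval _ _) hornerX.
  transitivity (z ^+ N * z * (z^-1 * ceval A z * ceval A' z^-1
      - z * ceval A z^-1 * ceval A' z)); first by field.
  by rewrite W // !exprS; field.
have A0 : toC A != 0 by rewrite -size_poly_gt0 size_toC.
have A'0 : toC A' != 0 by rewrite -size_poly_gt0 size_toC.
have szc m : size (crev N (toC (strip m))) = N.+1 by apply: size_crev_full; apply: toC0.
have c0 m : crev N (toC (strip m)) != 0 by rewrite -size_poly_gt0 szc.
have sz1 : size (toC A * crev N (toC A')) = (size A + N)%N.
  by rewrite size_mul ?c0 // szc size_toC addnS.
have sz2 : size ('X^2 * crev N (toC A) * toC A') = (size A' + N + 2)%N.
  rewrite -mulrA mulrC size_mulXn ?mulf_neq0 ?c0 // size_mul ?c0 // szc size_toC.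
  by rewrite addSn /= addn2 [(N + _)%N]addnC.
have sz3 : size (k%:C%C *: ('X^N - 'X^(N.+2)) : {poly C}) = N.+3.
  rewrite size_scale ?fmorph_eq0 // addrC size_polyDl size_polyN size_polyXn //.
  by rewrite size_polyXn.
have D1 : (size A' + N + 2 < size A + N)%N -> (size A + N = N.+3)%N.
  by move=> h; rewrite -sz3 -E size_polyDl ?size_polyN ?sz1 // sz2.
have D2 : (size A + N < size A' + N + 2)%N -> (size A' + N + 2 = N.+3)%N.
  by move=> h; rewrite -sz3 -E addrC size_polyDl ?size_polyN ?sz2 // sz1.
clear -sA sA' D1 D2; move: (size A) (size A') N sA sA' D1 D2 => a a' N.
by have [h|h|h] := ltngtP (a' + N + 2)%N (a + N)%N => ? ? D1 D2;
  try (have := D1 isT); try (have := D2 isT); lia.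
Qed.

Lemma size_strip d n : size t0 = d.+1 -> size (strip n) = (d - n.*2).+1.
Proof.
move=> st; have szp m : (0 < size (strip m))%N.
  by rewrite size_poly_gt0; apply: contraNneq (s0 m) => ->; rewrite coef0.
suff : (size (strip n)).-1 = (d - n.*2)%N by move: (szp n); case: size => //= ? _ ->.
elim: n => [|n IH]; first by rewrite subn0 /strip /= st.
by rewrite size_strip_step IH; lia.
Qed.

End Sequence.
End Stripping.

(** * The potential from the stripped sequence *)
Section Reconstruction.
Variable R : realType.
Local Notation C := R[i].

Section Chain.
Variables (p : nat) (nu tau : bool) (hm : (3 <= m_of p nu tau)%N).
Variables (T : nat -> {poly R}) (al be : nat -> R) (f w : {poly R}).
Hypotheses (rec : forall n, 'X^2 * T n.+2 =
     ('X^2 - be n.+1 *: 'X + 1) * T n.+1 - al n *: T n)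
  (T0 : forall n, 0 < (T n)`_0) (al0 : al 0 = 1)
  (szT : forall n, size (T n) = (2 * p - tau - n.*2).+1)
  (wr : forall n (z : C), z != 0 ->
    z^-1 * ceval (T n) z * ceval (T n.+1) z^-1
      - z * ceval (T n) z^-1 * ceval (T n.+1) z
    = (\prod_(i < n) al i)%:C%C * (z^-1 - z))
  (wT : w = T 0 - 'X^2 * T 1) (fT : 'X * f = T 0 - T 1)
  (fnu : f`_nu != 0) (flow : forall i, (i < nu)%N -> f`_i = 0).

Let p2 : (1 < p)%N. Proof. by move: hm; rewrite /m_of; lia. Qed.

Let Tn0 n : (T n)`_0 != 0. Proof. by rewrite gt_eqF. Qed.

Let coefs n := three_term_coefs (etrans (scale1r _) (rec n)).

Lemma chain_coef0 n : (T n.+1)`_0 = al n * (T n)`_0.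
Proof. by have [] := coefs n. Qed.

Lemma chain_coef1 n : be n.+1 * (T n.+1)`_0 = (T n.+1)`_1 - al n * (T n)`_1.
Proof. by have [_ -> _] := coefs n; rewrite addrK. Qed.

Lemma chain_coef2 n : al n.+1 * (T n.+1)`_0 =
  (T n.+1)`_0 - be n.+1 * (T n.+1)`_1 + (T n.+1)`_2 - al n * (T n)`_2.
Proof. by have [_ _ <-] := coefs n; rewrite mul1r (chain_coef0 n.+1). Qed.

Let al_gt0 n : 0 < al n.
Proof. by have := T0 n.+1; rewrite chain_coef0 pmulr_lgt0. Qed.

Let high n i : (2 * p - tau - n.*2 < i)%N -> (T n)`_i = 0.
Proof. by move=> h; rewrite nth_default // szT. Qed.

Let top n : (T n)`_(2 * p - tau - n.*2) != 0.
Proof.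
have -> : (2 * p - tau - n.*2)%N = (size (T n)).-1 by rewrite szT.
by rewrite -/(lead_coef _) lead_coef_eq0 -size_poly_gt0 szT.
Qed.

(** The polynomials are constant there, so comparing coefficients leaves the free
equation. *)
Lemma chain_far n : (p < n)%N -> al n = 1 /\ be n = 0.
Proof.
case: n => // n pn.
have b0 : be n.+1 = 0.
  apply: (mulIf (Tn0 n.+1)); rewrite chain_coef1 mul0r !high; try lia.
  by rewrite mulr0 subrr.
split=> //; apply: (mulIf (Tn0 n.+1)); rewrite mul1r chain_coef2 b0 mul0r.
by rewrite (@high n.+1 2) ?(@high n 2); try lia; rewrite mulr0 !subr0 addr0.
Qed.

Let al_p : al p * (T p)`_0 = (T p)`_0 - al p.-1 * (T p.-1)`_2.
Proof.
have pE : p = p.-1.+1 by rewrite prednK // ltnW.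
by rewrite {1 2 3}pE chain_coef2 -pE (@high p 1) ?(@high p 2); try lia; ring.
Qed.

Lemma chain_top_false : tau = false -> al p != 1.
Proof.
move=> tE; apply/eqP => a1; move: al_p; rewrite a1 mul1r => /eqP.
rewrite eq_sym subr_eq addrC -subr_eq subrr eq_sym mulf_eq0 gt_eqF //=; apply/negP.
by have := top p.-1; have -> : (2 * p - tau - p.-1.*2 = 2)%N by rewrite tE; lia.
Qed.

Lemma chain_top_true : tau = true -> al p = 1 /\ be p != 0.
Proof.
move=> tE; split.
  by apply: (mulIf (Tn0 p)); rewrite al_p (@high p.-1 2) ?mulr0 ?subr0 ?mul1r // tE; lia.
have pE : p = p.-1.+1 by rewrite prednK // ltnW.
apply/eqP => b0; have := chain_coef1 p.-1; rewrite -pE b0 mul0r (@high p 1); last by lia.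
move/eqP; rewrite sub0r eq_sym oppr_eq0 mulf_eq0 gt_eqF //=; apply/negP.
by have := top p.-1; have -> : (2 * p - tau - p.-1.*2 = 1)%N by rewrite tE; lia.
Qed.

Let fcoef i : f`_i = (T 0%N)`_i.+1 - (T 1%N)`_i.+1.
Proof. by rewrite -coefB -fT coefXM. Qed.

Let be_1 : be 1 * (T 1%N)`_0 = - f`_0.
Proof. by rewrite chain_coef1 al0 fcoef mul1r opprB. Qed.

Lemma chain_bottom_false : nu = false -> be 1 != 0.
Proof.
move=> nE; apply/eqP => b1; move: be_1 fnu; rewrite b1 mul0r nE => /esym/eqP.
by rewrite oppr_eq0 => ->.
Qed.

Lemma chain_bottom_true : nu = true -> be 1 = 0 /\ al 1 != 1.
Proof.
move=> nE; have b1 : be 1 = 0.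
  by apply: (mulIf (Tn0 1)); rewrite be_1 mul0r flow ?oppr0 // nE.
split=> //; apply/eqP => a1; have := chain_coef2 0; rewrite a1 b1 al0 mul0r !mul1r subr0.
move=> h; move: fnu; rewrite nE fcoef; apply/negP; rewrite negbK; apply/eqP.
by move: h; lra.
Qed.

Definition chain_potential (k : int) : R :=
  match k with
  | Posz j => if odd j then be (uphalf j) else 1 - Num.sqrt (al j./2)
  | Negz _ => 0
  end.

Lemma chain_coef_a n : coef_a chain_potential (Posz n) = Num.sqrt (al n).
Proof.
rewrite /coef_a; have -> : 2 * n%:Z = n.*2%:Z by lia.
by rewrite /= odd_double doubleK opprB addrC subrK.
Qed.

Lemma chain_coef_b n : coef_b chain_potential (Posz n.+1) = be n.+1.
Proof.
rewrite /coef_b; have -> : 2 * n.+1%:Z - 1 = n.*2.+1%:Z by lia.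
by rewrite /= odd_double /= doubleK.
Qed.

Let sqrt_neq1 (x : R) : 0 < x -> x != 1 -> 1 - Num.sqrt x != 0.
Proof.
move=> x0; apply: contraNneq => /eqP; rewrite subr_eq0 => /eqP h.
by rewrite -[x]sqr_sqrtr ?ltW // -h expr1n.
Qed.

Lemma chain_potentials : potentials p nu tau chain_potential.
Proof.
split.
- case nE: nu.
    by have [_ a1] := chain_bottom_true nE; rewrite /= sqrt_neq1.
  exact: (chain_bottom_false nE).
- case tE: tau.
    have [_ bp] := chain_top_true tE.
    have pE : p = p.-1.+1 by rewrite prednK // ltnW.
    by have := chain_coef_b p.-1; rewrite /coef_b -pE => ->.
  have -> : 2 * p%:Z - false%:Z = p.*2%:Z by lia.
  by rewrite /= odd_double doubleK sqrt_neq1 // (chain_top_false tE).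
- case=> n.
    have -> : 2 * n%:Z = n.*2%:Z by lia.
    by rewrite /= odd_double doubleK gtrBl sqrtr_gt0.
  have -> : 2 * Negz n = Negz (n.*2.+1) by lia.
  exact: ltr01.
- case=> // j hj /=; have [n [jE|jE]] : exists n, j = n.*2 \/ j = n.*2.+1.
    by exists j./2; move: (odd_double_half j); case: odd => /= h; [right|left]; lia.
  + rewrite jE odd_double doubleK; suff -> : al n = 1 by rewrite sqrtr1 subrr.
    case: n jE => [//|n] jE; have [/chain_far[]//|np] := ltnP p n.+1.
    have [n1|n1] := eqVneq n.+1 p; case tE: tau hj => hj.
    * by have [] := chain_top_true tE; rewrite -n1.
    * by move: hj; rewrite jE -n1; case: nu; lia.
    * by move: hj; rewrite jE; case: nu; lia.
    * by move: hj; rewrite jE; case: nu; lia.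
  + rewrite jE /= odd_double /= doubleK.
    have [/chain_far[]//|np] := ltnP p n.+1.
    case nE: nu hj => hj; last by move: hj; rewrite jE; case: tau; lia.
    case: n jE np => [|n] jE np; first by have [] := chain_bottom_true nE.
    by move: hj; rewrite jE; case: tau; lia.
Qed.

Let a n := Num.sqrt (al n).
Let a_gt0 n : 0 < a n. Proof. by rewrite sqrtr_gt0. Qed.
Let a2 n : a n ^+ 2 = al n. Proof. by rewrite sqr_sqrtr // ltW. Qed.
Let c n := (\prod_(i < n) a i)^-1.
Let prod_gt0 n : 0 < \prod_(i < n) a i. Proof. by apply: prodr_gt0. Qed.

(** Undoing the monic normalisation.  Far to the right [T n] is a constant, and the
Wronskian relation says that its square is the product of the [al i], so that the
normalised polynomial is 1. *)
Lemma chain_jost : jost_poly p chain_potential (fun n => c n *: T n).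
Proof.
have cS n : a n * c n.+1 = c n.
  by rewrite /c big_ord_recr /= invfM mulrCA divff ?mulr1 // gt_eqF.
split=> n; last move=> pn.
  rewrite !chain_coef_a chain_coef_b -/(a n) -/(a n.+1).
  rewrite -scalerAr scalerA cS rec scalerBr scalerA -scalerAr; congr (_ - _).
  by rewrite scalerA; congr (_ *: _); rewrite -(a2 n) -(cS n); ring.
have [k kE] : exists k, T n = k%:P.
  by exists (T n)`_0; apply: size1_polyC; rewrite szT; lia.
have TS : T n.+1 = T n.
  have -> : T n.+1 = ((T n.+1)`_0)%:P by apply: size1_polyC; rewrite szT; lia.
  by rewrite chain_coef0; have [-> _] := chain_far pn; rewrite mul1r kE coefC.
have k0 : 0 < k by have := T0 n; rewrite kE coefC.
have k2 : k ^+ 2 = (\prod_(i < n) a i) ^+ 2.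
  (* Any point with z^-1 - z nonzero would do. *)
  have i0 : ('i : C) != 0 by rewrite neq0Ci.
  have := wr n i0; rewrite TS kE !cevalC.
  have d0 : ('i : C)^-1 - 'i != 0.
    by rewrite invCi -opprD oppr_eq0 -mulr2n mulrn_eq0 neq0Ci.
  have -> : ('i : C)^-1 * k%:C%C * k%:C%C - 'i * k%:C%C * k%:C%C =
     (k ^+ 2)%:C%C * ('i^-1 - 'i) by rewrite rmorphXn /=; ring.
  move/(mulIf d0)/(@complexI R) => ->.
  by rewrite -prodrXl; apply: eq_bigr => i _; rewrite a2.
have -> : T n = (\prod_(i < n) a i)%:P.
  rewrite kE; congr (_%:P); apply/eqP.
  by rewrite -(@eqrXn2 _ 2 _ _ isT (ltW k0) (ltW (prod_gt0 n))) k2.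
by rewrite -alg_polyC scalerA mulVf ?scale1r // gt_eqF.
Qed.

Lemma chain_scattering : is_s p chain_potential f /\ is_w p chain_potential w.
Proof.
have cp := potentials_compact chain_potentials.
have c0 : c 0 = 1 by rewrite /c big_ord0 invr1.
have c1 : c 1 = 1 by rewrite /c big_ord_recr big_ord0 /= /a al0 sqrtr1 mulr1 invr1.
split; first by apply/(is_sP cp chain_jost); rewrite c0 c1 !scale1r.
by apply/(is_wP cp chain_jost); rewrite c0 c1 !scale1r.
Qed.
End Chain.

(** The solution is [t1 = (w - z f) / (1 - z^2)] and [t0 = z f + t1]. *)
Lemma jost_pair (f w : {poly R}) : w.[1] = f.[1] -> w.[-1] = - f.[-1] ->
  exists t0 t1, w = t0 - 'X^2 * t1 /\ 'X * f = t0 - t1.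
Proof.
move=> w1 wN1.
have : \prod_(x <- [:: 1; -1 : R]) ('X - x%:P) %| w - 'X * f.
  apply: uniq_roots_dvdp; last first.
    by rewrite uniq_rootsE /= inE andbT -subr_eq0 opprK -(natrD _ 1 1) pnatr_eq0.
  by rewrite /= !rootE !hornerD !hornerN !hornerM !hornerX w1 wN1 mul1r mulN1r subrr subrr eqxx.
rewrite big_cons big_seq1 => /dvdpP[g gE].
have gE' : w - 'X * f = g * ('X^2 - 1) by rewrite gE polyCN polyC1 opprK; ring.
exists ('X * f - g), (- g); split; last by rewrite opprK subrK.
by rewrite -[LHS](subrK ('X * f)) gE'; ring.
Qed.

Lemma scattering_surj p nu tau (d : {poly R} * seq R) : (3 <= m_of p nu tau)%N ->
  scattering_class p nu tau d -> exists2 q, potentials p nu tau q & scattering_data p q d.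
Proof.
case: d => f K hm /scattering_classP[[sf fnu flow] [sK aK K0] zer sgn [f1 fN1]].
have uK := lt_sorted_uniq sK.
have n2 : (2 <= m_of p nu tau + nu)%N by move: hm; lia.
have [w [P [P' [B [[PP' wE w0 sw] [Pnz Bnz uni]]]]]] :=
  outer_function n2 sf uK aK K0 zer.
have wv : w = root_poly K * (P * B) by rewrite wE; ring.
have vnz (z : C) : `|z| < 1 -> ceval (P * B) z != 0.
  by move=> z1; rewrite cevalM mulf_neq0 ?Pnz ?Bnz // ltW.
have [w1 wN1] := outer_function_ends wv w0 aK vnz uni f1 fN1.
have [t0 [t1 [wt ft]]] := jost_pair w1 wN1.
have f0 : f != 0 by rewrite -size_poly_gt0 sf.
have st0 : size t0 = (2 * p - tau).+1.
  have E : ('X^2 - 1) * t0 = 'X^3 * f - w.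
    have -> : 'X^3 * f = 'X^2 * ('X * f) by ring.
    by rewrite ft wt; ring.
  have s3 : size ('X^3 * f) = (m_of p nu tau + nu).+4.
    by rewrite mulrC size_mulXn // sf.
  have : size (('X^2 - 1) * t0) = (m_of p nu tau + nu).+4.
    by rewrite E size_polyDl ?size_polyN s3 // ltnS leqW // leqW.
  have t00 : t0 != 0.
    by apply/eqP => t00; move: E s3; rewrite t00 mulr0 => /esym/eqP; rewrite subr_eq0 => /eqP -> sw';
      move: sw; rewrite sw' !ltnS ltnNge leqW.
  rewrite size_monicM ?monicXnsubC // size_XnsubC // => -[] h.
  rewrite -[size t0]add0n h; move: hm; rewrite /m_of; lia.
have inv n := strip_coef0_gt0 PP' wE w0 Pnz Bnz uK aK K0 sgn uni wt ft n.
have inv0 n : (strip t0 t1 n)`_0 != 0 by rewrite gt_eqF.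
have rec n : _ := strip_rec (inv0 n) (inv0 n.+1).
have a0 := alpha0 PP' wE w0 Pnz Bnz uK aK K0 sgn uni wt ft.
have sz n := size_strip PP' wE w0 Pnz Bnz uK aK K0 sgn uni wt ft n st0.
have wr n (z : C) : z != 0 ->
    z^-1 * ceval (strip t0 t1 n) z * ceval (strip t0 t1 n.+1) z^-1
      - z * ceval (strip t0 t1 n) z^-1 * ceval (strip t0 t1 n.+1) z
    = (\prod_(i < n) alpha t0 t1 i)%:C%C * (z^-1 - z).
  by have [k -> h] := strip_wronskian PP' wE w0 Pnz Bnz uK aK K0 sgn uni wt ft n; apply: h.
have [qs qw] := chain_scattering hm rec inv a0 sz wr wt ft fnu flow.
exists (chain_potential (alpha t0 t1) (beta t0 t1)).
  exact: (chain_potentials hm rec inv a0 sz ft fnu flow).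
split=> //; exists w => //; split=> // z; split=> [[z1 wz]|[x xK zx]].
  apply/ceval_root_poly_eq0; move/eqP: wz; rewrite wv cevalM mulf_eq0.
  by rewrite (negPf (vnz z z1)) orbF => /eqP.
split; first by rewrite zx normC_lt1 aK.
rewrite wv cevalM; have -> : ceval (root_poly K) z = 0 by apply/ceval_root_poly_eq0; exists x.
by rewrite mul0r.
Qed.
End Reconstruction.

Theorem theorem1p1 (R : realType) (p : nat) (nu tau : bool)
    (hp : (0 < p)%N) (hm : (3 <= m_of p nu tau)%N) :
  set_bij (@potentials R p nu tau) (@scattering_class R p nu tau)
    (@scattering_map R p).
Proof.
split.
- move=> q pq; have [d dq dc] := scattering_data_exists hm pq.
  by rewrite (scattering_mapP pq dq).
- move=> q q'; rewrite !inE => pq pq' qq.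
  have [d dq _] := scattering_data_exists hm pq.
  have [d' dq' _] := scattering_data_exists hm pq'.
  move: qq; rewrite (scattering_mapP pq dq) (scattering_mapP pq' dq') => dd.
  by rewrite -dd in dq'; apply: scattering_data_inj hm pq pq' dq dq'.
- move=> d /(scattering_surj hm)[q pq dq].
  by exists q => //; apply: scattering_mapP pq dq.
Qed.
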